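(* If $f\in\mathscr F$, $\gamma\in(0,1/3)$ and (A1) and (A5) hold, then, as $n\to\infty$, $$\sup_{t\in\mathbb R}\Bigl|P^\star\bigl(n^{1/2}(\tilde d_n^{(2)\star}-\tilde d_n^{(2)})\le t\bigr)-P(C_2Z_1\le t)\Bigr|\stackrel{P}{\to}0,$$ where $C_2=\sigma/[f'(d_0)(1-p)^{1/2}]$ and $Z_1$ is standard normal.
   Context: Let $d_0\in(0,1)$, $f:[0,1]\to\mathbb R$ and $\theta_0=f(d_0)$. $\mathscr F_0$: increasing real functions on $[0,1]$ with positive and continuous first derivative in a neighborhood of $d_0$. $\mathscr F$: those $f\in\mathscr F_0$ whose third derivative exists and is uniformly bounded in a neighborhood of $d_0$. Probabilistic setting. For each sample size $m$ there are deterministic distinct design points $x_1<\dots<x_m$ in $[0,1]$ (a triangular array; the $x_i$ depend on $m$), with empirical distribution function $F_m$. $\varepsilon$ is a continuous real random variable with mean $0$ and variance $\sigma^2\in(0,\infty)$. On a probability space $(\Omega,\mathscr A,P)$ there are, for every $n$, errors $\{\varepsilon_{in}\}_{i\le n},\{\varepsilon'_{in}\}_{i\le n},\{\varepsilon''_{in}\}_{i\le n}$, all i.i.d. copies of $\varepsilon$ (over all $i$, $n$ and the three families); the index $n$ is suppressed. Assumptions. (A1) There is a distribution function $G$, with Lebesgue density $g$ positive at $d_0$, such that $\sup_{x\in[0,1]}|F_m(x)-G(x)|=o(m^{-1/3})$. (A5) $\mathbb E\varepsilon^6<\infty$. Isotonic estimator. Given $Y_i=f(x_i)+\varepsilon_i$,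 $i=1,\dots,m$, $\hat f$ is the least squares fit over nondecreasing functions, determined at the $x_i$ and extended to $[0,1]$ as a right-continuous step function with jumps only at design points ($\hat f(x)=\hat f(x_1)$ for $x<x_1$). Set $\hat d_m^{(1)}=\inf\{x\in[0,1]:\hat f(x)\ge\theta_0\}$, with value $1$ if the set is empty. Two-stage procedure. Fix $p\in(0,1)$, $\gamma>0$, $K>0$. For total budget $n$, let $n_1$ be $\lfloor np\rfloor$ or $\lfloor np\rfloor+1$, whichever makes $n-n_1$ even, and $n_2=(n-n_1)/2$. Stage one: compute $\hat d_{n_1}^{(1)}$ from $n_1$ design points and responses. Put $L=\hat d_{n_1}^{(1)}-Kn_1^{-\gamma}$, $U=\hat d_{n_1}^{(1)}+Kn_1^{-\gamma}$. Stage two: $Y_i'=f(L)+\varepsilon_i'$, $Y_i''=f(U)+\varepsilon_i''$, $i=1,\dots,n_2$ ($f$ extended to $\mathbb R$ in any fixed measurable way). Let $(\hat\beta_0,\hat\beta_1)$ be the least squares intercept and slope from fitting $y=\beta_0+\beta_1x$ to $\{(L,Y_i'),(U,Y_i'')\}_{i\le n_2}$, and $\tilde d_n^{(2)}=(\theta_0-\hat\beta_0)/\hat\beta_1$. Bootstrap. Conditionally on the data, $Y_1'^{\star},\dots,Y_{n_2}'^{\star}$ are drawn i.i.d. uniformly (with replacement) from $\{Y_i'\}_{i\le n_2}$ and, independently, $Y_1''^{\star},\dots,Y_{n_2}''^{\star}$ i.i.d. uniformly from $\{Y_i''\}_{i\le n_2}$. $(\hat\beta_0^\star,\hat\beta_1^\star)$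 are the least squares intercept and slope from $\{(L,Y_i'^\star),(U,Y_i''^\star)\}_{i\le n_2}$ and $\tilde d_n^{(2)\star}=(\theta_0-\hat\beta_0^\star)/\hat\beta_1^\star$. (Quotients are defined arbitrarily when the denominator is zero.) $P^\star$ denotes conditional probability given the original data, and $\stackrel{P}{\to}$ denotes convergence in $P$-probability.
   Formalization: In (A1), since a density has no well-defined value at a single point, ''g positive at d0'' is read as: G is differentiable at d0 with G'(d0) = g(d0) > 0 (automatic if g is continuous at d0); for an arbitrary version of g the claim fails. *)

(* Defs.v *)
From HB Require Import structures.
From mathcomp Require Import all_boot all_order all_algebra finmap.
From mathcomp Require Import all_classical all_reals all_analysis.

Set Implicit Arguments.
Unset Strict Implicit.
Unset Printing Implicit Defensive.

Import Order.TTheory GRing.Theory Num.Theory.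
Import numFieldNormedType.Exports.

Local Open Scope ring_scope.
Local Open Scope classical_set_scope.

(* Samples are numbered from 0: the i-th observation of the text is the
   observation of index i - 1 here. Arrays indexed by (n, i) are only
   constrained, and only used, for i < n. *)

Section function_classes.
Context {R : realType}.

(* A function on [0, 1] is represented by a total function. As d0 is an
   interior point of [0, 1], the values outside [0, 1] play no role here.
   Increasing is meant in the weak sense, which includes the strict one. *)
Definition class_F0 (d0 : R) (f : R -> R) : Prop :=
  {in `[0, 1] &, {homo f : x y / x <= y}} /\
  \forall x \near d0,
    [/\ derivable f x 1, 0 < f^`() x & {for x, continuous f^`()}].

Definition class_F (d0 : R) (f : R -> R) : Prop :=
  class_F0 d0 f /\
  exists M : R, \forall x \near d0,
    (forall k, (k < 3)%N -> derivable f^`(k) x 1) /\ `|f^`(3) x| <= M.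

End function_classes.

Section design.
Context {R : realType}.

Definition is_design (x : nat -> nat -> R) : Prop :=
  (forall m i, (i < m)%N -> 0 <= x m i <= 1) /\
  (forall m i j, (i < j < m)%N -> x m i < x m j).

Definition empirical_df (m : nat) (x : nat -> R) (t : R) : R :=
  #|[pred i : 'I_m | x i <= t]|%:R / m%:R.

Definition has_density (G g : R -> R) : Prop :=
  [/\ measurable_fun setT g, forall t, 0 <= g t,
      (\int[lebesgue_measure]_t (g t)%:E = 1)%E &
      forall t, ((G t)%:E =
                 \int[lebesgue_measure]_(s in `]-oo, t]) (g s)%:E)%E].

(* A density is only determined up to a null set, so its value at the single
   point d0 is meaningful only if g is the derivative of G there; this is
   automatic when g is continuous at d0. *)
Definition assumption_A1 (d0 : R) (x : nat -> nat -> R) : Prop :=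
  exists G g : R -> R,
    [/\ has_density G g, is_derive d0 1 G (g d0), 0 < g d0 &
        (fun m => sup [set `|empirical_df m (x m) t - G t| | t in `[0, 1]])
          =o_\oo (fun m => m%:R `^ (- 3^-1))].

End design.

Section errors.
Context {R : realType} d {Omega : measurableType d} (P : probability Omega R).

Definition mutually_independent (I : choiceType) (D : set I)
    (X : I -> {RV P >-> R}) : Prop :=
  forall (J : {fset I}) (A : I -> set R),
    [set` J] `<=` D -> (forall i, i \in J -> measurable (A i)) ->
    (P (\bigcap_(i in [set` J]) (X i @^-1` A i)) =
     \prod_(i <- J) P (X i @^-1` A i))%E.

Definition iid_copies (eps : {RV P >-> R}) (I : choiceType) (D : set I)
    (X : I -> {RV P >-> R}) : Prop :=
  mutually_independent D X /\
  forall i A, D i -> measurable A ->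
    distribution P (X i) A = distribution P eps A.

Definition pooled_index := ((nat * nat) + (nat * nat) + (nat * nat))%type.

Definition pooled (e e' e'' : nat -> nat -> {RV P >-> R})
    (k : pooled_index) : {RV P >-> R} :=
  match k with
  | inl (inl (n, i)) => e n i
  | inl (inr (n, i)) => e' n i
  | inr (n, i) => e'' n i
  end.

Definition pooled_dom : set pooled_index :=
  [set k | match k with
           | inl (inl (n, i)) | inl (inr (n, i)) | inr (n, i) => (i < n)%N
           end].

Definition cvg_in_probability (X : nat -> Omega -> R) (l : R) : Prop :=
  forall a : R, 0 < a ->
    P [set w | a < `|X n w - l|] @[n --> \oo] --> 0%E.

End errors.

Section isotonic.
Context {R : realType}.
Variables (m : nat) (x Y : nat -> R).

Definition nondecreasing_upto (v : nat -> R) : Prop :=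
  forall i j, (i <= j < m)%N -> v i <= v j.

Definition is_isotonic_fit (v : nat -> R) : Prop :=
  nondecreasing_upto v /\
  forall w, nondecreasing_upto w ->
    \sum_(i < m) (Y i - v i) ^+ 2 <= \sum_(i < m) (Y i - w i) ^+ 2.

(* The values at indices i < m are uniquely determined; the others are
   arbitrary. *)
Definition isotonic_fit : nat -> R := get is_isotonic_fit.

(* For sorted x, if j design points are <= t, the last of them has index j.-1;
   if there is none, 0.-1 = 0 is the index of the first design point. *)
Definition isotonic_regression (t : R) : R :=
  let j := #|[pred i : 'I_m | x i <= t]| in isotonic_fit j.-1.

Definition dhat1 (theta0 : R) : R :=
  let S := [set t | 0 <= t <= 1 /\ theta0 <= isotonic_regression t] in
  if `[< S !=set0 >] then inf S else 1.

End isotonic.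

Section regression_line.
Context {R : realType}.

Definition line_sse (s : seq (R * R)) (b : R * R) : R :=
  \sum_(z <- s) (z.2 - (b.1 + b.2 * z.1)) ^+ 2.

(* (intercept, slope) *)
Definition least_squares_line (s : seq (R * R)) : R * R :=
  get [set b | forall b', line_sse s b <= line_sse s b'].

(* If the slope is zero, the quotient is 0 by the convention on division. *)
Definition dtilde2 (theta0 L U : R) (k : nat) (Y' Y'' : 'I_k -> R) : R :=
  let b := least_squares_line
    ([seq (L, Y' i) | i <- enum 'I_k] ++ [seq (U, Y'' i) | i <- enum 'I_k]) in
  (theta0 - b.1) / b.2.

End regression_line.

Section budget.
Context {R : realType}.
Variables (p : R) (n : nat).

Definition budget1 : nat :=
  let k := Num.truncn (n%:R * p) in if odd (n - k) then k.+1 else k.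

Definition budget2 : nat := (n - budget1)./2.

End budget.

(* Sampling i.i.d. uniformly with replacement from k observations amounts to
   drawing a uniformly distributed map 'I_k -> 'I_k of indices. The pair of
   maps (one per sample) is uniform on the set of all pairs, and
   [bootstrap_prob E] is the probability of E under this law. *)
Definition resampling (k : nat) := {ffun 'I_k -> 'I_k}.

Definition bootstrap_prob {R : realType} (k : nat)
    (E : pred (resampling k * resampling k)) : R :=
  #|E|%:R / #|{: resampling k * resampling k}|%:R.

Section two_stage.
Context {R : realType} d {Omega : measurableType d} {P : probability Omega R}.
Variables (f : R -> R) (d0 p gamma K : R) (x : nat -> nat -> R).
Variables e e' e'' : nat -> nat -> {RV P >-> R}.

Local Notation n1 n := (budget1 p n).
Local Notation n2 n := (budget2 p n).

Definition stage1_response n (w : Omega) (i : nat) : R :=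
  f (x (n1 n) i) + e n i w.

Definition stage1_estimate n w : R :=
  dhat1 (n1 n) (x (n1 n)) (stage1_response n w) (f d0).

Definition Lpoint n w : R := stage1_estimate n w - K * (n1 n)%:R `^ (- gamma).
Definition Upoint n w : R := stage1_estimate n w + K * (n1 n)%:R `^ (- gamma).

Definition Yprime n w (i : 'I_(n2 n)) : R := f (Lpoint n w) + e' n i w.
Definition Ysecond n w (i : 'I_(n2 n)) : R := f (Upoint n w) + e'' n i w.

Definition stage2_estimate n w : R :=
  dtilde2 (f d0) (Lpoint n w) (Upoint n w) (@Yprime n w) (@Ysecond n w).

Definition bootstrap_estimate n w
    (r : resampling (n2 n) * resampling (n2 n)) : R :=
  dtilde2 (f d0) (Lpoint n w) (Upoint n w)
    (fun i => Yprime w (r.1 i)) (fun i => Ysecond w (r.2 i)).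

(* The conditional distribution function, given the data at w, of
   n^(1/2) (bootstrap estimate - estimate). *)
Definition bootstrap_cdf n w (t : R) : R :=
  bootstrap_prob (fun r : resampling (n2 n) * resampling (n2 n) =>
    Num.sqrt n%:R * (bootstrap_estimate w r - stage2_estimate n w) <= t).

End two_stage.

(* Main.v *)
Require Import Defs.
From HB Require Import structures.
From mathcomp Require Import all_boot all_order all_algebra finmap.
From mathcomp Require Import all_classical all_reals all_analysis.
From mathcomp Require Import measurable_realfun ring lra zify.

Set Implicit Arguments.
Unset Strict Implicit.
Unset Printing Implicit Defensive.

Import Order.TTheory GRing.Theory Num.Theory.
Import numFieldNormedType.Exports.

Local Open Scope ring_scope.
Local Open Scope classical_set_scope.

(** Write delta for the half-width K n1^(-gamma) of the second-stage interval,
theta for f(d0), a for f'(d0), and u, v for the means of the responses at L and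
U.

The second stage. The least squares line through two vertical clouds joins
their means [dtilde2E], so the estimate is L - 2 delta (u - theta) / (v - u),
and the bootstrap estimate is the same function of the resampled means us and vs,
with L and U unchanged. If us < vs, clearing denominators turns the event
sqrt n (bootstrap estimate - estimate) <= t into an inequality which is affine
in us and vs [bootstrap_event]. Its conditional probability is therefore given
by a central limit theorem for a weighted sum of two resampled samples, and so
is that of the exceptional event us >= vs, which is negligible because v - u
is of order delta, much larger than n^(-1/2). The central limit theorem is
needed with an explicit error in terms of the data: [resampled_clt] is proved
by Lindeberg's replacement of the draws by Gaussian variables, tested on a
smooth approximation of an indicator, and its error vanishes as soon as the
empirical variances converge to sigma^2 and the empirical third absolute
moments are o(sqrt n) [bootstrap_cvg]. Both hold by moment bounds on the errors
[emp_variance_cvg, emp_third_moment_cvg]. Both weights tend to -2 a, and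
the threshold in units of the standard deviation to t / C2, provided that
(u - theta) / delta tends to -a and (v - theta) / delta to a.

The first stage. As L and U are the first-stage estimate plus or minus delta
and f is differentiable at d0, these two limits follow if the first-stage
estimate is d0 + o(delta) in probability [stage1_rate]. Since delta decays
slower than n^(-1/3), a crude argument is enough. By the first order conditions
of the least squares problem [isotonic_fit_lt, isotonic_fit_ge], an estimate
further than eta delta from d0 forces the partial sums of the errors, started at
d0, to reach a height of order delta M for some M of order at least n delta
[excursion_right, excursion_left]; the assumption on the design provides the
number of design points on the way [design_count_cvg]. A maximal inequality for
orthogonal variables, obtained by dyadic splitting [dyadic_maximal], bounds the
probability of this by a multiple of log^3 n / (n delta^3), which vanishes
since gamma < 1/3.

Convergence in probability is convergence along a filter of pairs (sample size,
outcome) [prob_filter], so that all limits above are ordinary limits along that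
filter. Polya's argument [polya] makes the pointwise limit of the bootstrap
distribution function uniform. The passage from the filter back to
probabilities uses that the supremum in the statement is measurable, which comes
down to an explicit criterion for the isotonic fit to reach a level
[isotonic_fit_geP]. *)

(** * Gaussian means: convolution and moments *)

Section gaussian.
Context {R : realType}.
Local Notation mu := (@lebesgue_measure R).
Local Notation phi := (@normal_pdf R 0 1).
Implicit Types (h : R -> R) (a b c : R).

Definition gauss_mean h : R := \int[mu]_z (h z * phi z).

Lemma phi_ge0 z : 0 <= phi z. Proof. exact: normal_pdf_ge0. Qed.

Lemma measurable_phi : measurable_fun setT phi.
Proof. exact: measurable_normal_pdf. Qed.

Lemma continuous_phi : continuous phi.
Proof. exact: continuous_normal_pdf. Qed.

Lemma integral_affine (G : R -> R) c d : 0 < c ->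
  continuous G -> (forall x, 0 <= G x) ->
  (\int[mu]_z (G z)%:E = \int[mu]_u (G (c * u + d) * c)%:E)%E.
Proof.
move=> c0 cG G0.
pose F (u : R) : R := c * u + d.
have dF x : is_derive (x : R^o) (1 : R) (F : R^o -> R^o) c.
  rewrite /F; apply: is_derive_eq; by rewrite addr0 /GRing.scale/= mulr1.
have F'E : F^`()%classic = cst c.
  by apply/funext => x; rewrite derive1E; have [_ ->] := dF x.
rewrite (@increasing_ge0_integration_by_substitutionT _ F G)//.
- by apply: eq_integral => u _; rewrite F'E.
- by move=> x y xy; rewrite /F ltrD2r ltr_pM2l.
- by rewrite F'E => ?; exact: cvg_cst.
- by rewrite F'E; exact: is_cvg_cst.
- by rewrite F'E; exact: is_cvg_cst.
- apply/cvgrNyPle => A; near=> u.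
  rewrite /F -lerBrDr -ler_pdivlMl//; near: u; exact: nbhs_ninfty_le.
- apply/cvgryPge => A; near=> u.
  rewrite /F -lerBlDr -ler_pdivrMl//; near: u; exact: nbhs_pinfty_ge.
Unshelve. all: by end_near. Qed.

Lemma integrable_phiM h (M : R) : measurable_fun setT h ->
  (forall z, `|h z| <= M) -> mu.-integrable setT (fun z => (h z * phi z)%:E).
Proof.
move=> mh hM.
have iphi := @integrable_normal_pdf R 0 1.
have iM : mu.-integrable setT (fun z => (M * phi z)%:E).
  under eq_fun do rewrite EFinM.
  by apply: integrableZl.
apply: le_integrable iM => //.
  apply/measurable_EFinP; apply: measurable_funM => //; exact: measurable_phi.
move=> z _; rewrite /= lee_fin !normrM (ger0_norm (phi_ge0 z)).
by rewrite ler_wpM2r ?phi_ge0// (le_trans (hM z))// ler_norm.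
Qed.

Lemma gauss_meanE h (M : R) : measurable_fun setT h ->
  (forall z, `|h z| <= M) ->
  ((gauss_mean h)%:E = \int[mu]_z (h z * phi z)%:E)%E.
Proof.
move=> mh hM; rewrite /gauss_mean /Rintegral fineK//.
exact: integrable_fin_num (integrable_phiM mh hM).
Qed.

Lemma gauss_mean_cst c : gauss_mean (fun=> c) = c.
Proof.
rewrite /gauss_mean RintegralZl//; last exact: integrable_normal_pdf.
by rewrite /Rintegral integral_normal_pdf mulr1.
Qed.

Lemma phiE z : phi z = normal_peak 1 * expR (- (z ^+ 2 / 2)).
Proof.
by rewrite normal_pdfE ?oner_eq0// /normal_fun subr0 expr1n mulNr.
Qed.

Lemma le_gauss_mean h1 h2 (M : R) : measurable_fun setT h1 ->
  measurable_fun setT h2 -> (forall z, `|h1 z| <= M) ->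
  (forall z, `|h2 z| <= M) -> (forall z, h1 z <= h2 z) ->
  gauss_mean h1 <= gauss_mean h2.
Proof.
move=> m1 m2 b1 b2 h12; apply: le_Rintegral => //.
- exact: integrable_phiM b1.
- exact: integrable_phiM b2.
- by move=> z _; rewrite ler_wpM2r ?phi_ge0.
Qed.

(** The joint density of two independent standard Gaussian variables v and z,
in the coordinates u and z where c u = a v + b z, factors into the density of
u and the conditional density of z given u; c / a is the Jacobian. *)
Lemma phi_complete_square a b c u z : 0 < a -> 0 < c ->
  a ^+ 2 + b ^+ 2 = c ^+ 2 ->
  phi (c / a * u + - (b / a) * z) * phi z * (c / a)
  = phi u * normal_pdf (b / c * u) (a / c) z.
Proof.
move=> a0 c0 abc.
have ac0 : 0 < a / c by rewrite divr_gt0.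
rewrite !phiE normal_pdfE ?gt_eqF// /normal_fun.
have -> : normal_peak (a / c) = normal_peak 1 * (c / a).
  rewrite /normal_peak expr1n mul1r -mulrnAr sqrtrM ?sqr_ge0//.
  by rewrite sqrtr_sqr gtr0_norm// invfM invf_div mulrC.
have -> : - (z - b / c * u) ^+ 2 / ((a / c) ^+ 2 *+ 2) =
   - ((c / a * u + - (b / a) * z) ^+ 2 / 2) - z ^+ 2 / 2 + u ^+ 2 / 2.
  rewrite -mulr_natr.
  have b2 : b ^+ 2 = c ^+ 2 - a ^+ 2 by rewrite -abc; ring.
  apply/eqP; rewrite -subr_eq0; apply/eqP.
  transitivity ((b ^+ 2 - (c ^+ 2 - a ^+ 2)) * ( - (u ^+ 2) + z ^+ 2) / (2 * a ^+ 2)).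
    by field; rewrite !gt_eqF.
  by rewrite b2 subrr !mul0r.
rewrite !expRD; set e1 := expR (- _); set e2 := expR (- _); set e3 := expR (u ^+ 2 / 2).
have -> : expR (- (u ^+ 2 / 2)) = e3^-1 by rewrite expRN.
have : e3 != 0 by rewrite gt_eqF ?expR_gt0.
by move=> ?; field; rewrite gt_eqF.
Qed.

(** A sum of independent Gaussian variables is Gaussian: after the change of
variable of [phi_complete_square] and an exchange of the integrals, z enters
through a probability density only and integrates out. *)
Lemma gauss_mean_add h a b : continuous h -> (forall z, 0 <= h z <= 1) ->
  0 <= a -> 0 <= b ->
  gauss_mean (fun z => gauss_mean (fun u => h (a * u + b * z))) =
  gauss_mean (fun u => h (Num.sqrt (a ^+ 2 + b ^+ 2) * u)).
Proof.
move=> ch h01 a0 b0.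
have mh : measurable_fun setT h by exact: continuous_measurable_fun.
have h1 z : `|h z| <= 1 by have /andP[? ?] := h01 z; rewrite ger0_norm.
have h0 z : 0 <= h z by have /andP[] := h01 z.
move: a0; rewrite le_eqVlt => /predU1P[<-|a0].
  rewrite expr0n/= add0r sqrtr_sqr ger0_norm//.
  by congr gauss_mean; apply/funext => z; under eq_fun do rewrite mul0r add0r; rewrite gauss_mean_cst.
set c := Num.sqrt _.
have c0 : 0 < c by rewrite sqrtr_gt0 ltr_pwDl ?sqr_ge0 ?exprn_gt0.
have cE : a ^+ 2 + b ^+ 2 = c ^+ 2 by rewrite sqr_sqrtr// addr_ge0 ?sqr_ge0.
have ca0 : 0 < c / a by rewrite divr_gt0.
pose k u z := h (c * u) * (phi (c / a * u + - (b / a) * z) * phi z * (c / a)).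
have k0 u z : 0 <= k u z.
  by rewrite /k mulr_ge0// mulr_ge0 ?(ltW ca0)// mulr_ge0// phi_ge0.
have step1 z : ((gauss_mean (fun u => h (a * u + b * z)) * phi z)%:E =
   \int[mu]_u (k u z)%:E)%E.
  rewrite EFinM (gauss_meanE (M := 1)) //; last first.
    apply: measurableT_comp => //; exact: measurable_funD.
  rewrite (@integral_affine _ (c / a) (- (b / a) * z))//; last 2 first.
    move=> y; apply: cvgM; last exact: continuous_phi.
    apply: (@continuous_comp _ _ _ (fun y => a * y + b * z) h); last exact: ch.
    by apply: cvgD; [apply: cvgM => //; exact: cvg_cst|exact: cvg_cst].
    by move=> y; rewrite mulr_ge0 ?phi_ge0.
  rewrite muleC -ge0_integralZl//.
  - apply: eq_integral => u _; rewrite -EFinM /k; congr EFin.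
    have -> : a * (c / a * u + - (b / a) * z) + b * z = c * u.
      by field; rewrite gt_eqF.
    ring.
  - apply/measurable_EFinP; apply: measurable_funM => //.
    apply: measurable_funM.
      apply: measurableT_comp => //; apply: measurable_funD => //.
      by apply: measurable_funM => //; apply: measurable_funD => //; exact: measurable_funM.
    apply: measurableT_comp; first exact: measurable_phi.
    by apply: measurable_funD => //; exact: measurable_funM.
  - by move=> u _; rewrite lee_fin mulr_ge0 ?(ltW ca0)// mulr_ge0// phi_ge0.
  - by rewrite lee_fin phi_ge0.
have mk : measurable_fun setT (fun uz : R * R => (k uz.1 uz.2)%:E).
  apply/measurable_EFinP; rewrite /k.
  apply: measurable_funM.
    by apply: measurableT_comp => //; apply: measurable_funM => //; exact: measurable_fst.
  apply: measurable_funM => //; apply: measurable_funM.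
    apply: measurableT_comp; first exact: measurable_phi.
    by apply: measurable_funD; apply: measurable_funM.
  by apply: measurableT_comp; first exact: measurable_phi.
rewrite [LHS]/gauss_mean [RHS]/gauss_mean /Rintegral; congr fine.
rewrite (_ : (\int[mu]_z _)%E = \int[mu]_z \int[mu]_u (k u z)%:E)%E; last first.
  by apply: eq_integral => z _; exact: step1.
rewrite -(@fubini_tonelli _ _ _ _ _ mu mu (fun uz => (k uz.1 uz.2)%:E))//=;
  last by move=> uz; rewrite lee_fin.
apply: eq_integral => u _.
under eq_integral do rewrite /k phi_complete_square// mulrA EFinM.
rewrite ge0_integralZl//.
- by rewrite integral_normal_pdf mule1.
- apply/measurable_EFinP; exact: measurable_normal_pdf.
- by move=> z _; rewrite lee_fin normal_pdf_ge0.
- by rewrite lee_fin mulr_ge0 ?phi_ge0.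
Qed.


(** The Gaussian splits into two equal factors exp (- z^2 / 4): one absorbs the
power z^4, the other is, up to a constant, the density of variance 2. *)
Lemma pow4_phi_ub z : z ^+ 4 * phi z <= 32 * Num.sqrt 2 * normal_pdf 0 (Num.sqrt 2) z.
Proof.
have s2 : Num.sqrt (2 : R) != 0 by rewrite gt_eqF// sqrtr_gt0.
rewrite phiE normal_pdfE// /normal_fun subr0 sqr_sqrtr//.
have -> : normal_peak 1 = Num.sqrt 2 * normal_peak (Num.sqrt 2) :> R.
  rewrite /normal_peak expr1n mul1r sqr_sqrtr// -[2 * pi *+ 2]mulrnAr.
  by rewrite [in RHS]sqrtrM// invfM mulVKf.
set q := normal_peak _; set r := Num.sqrt 2.
have q0 : 0 <= q by exact: normal_peak_ge0.
have r0 : 0 <= r by exact: sqrtr_ge0.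
have -> : - z ^+ 2 / (2 *+ 2) = - (z ^+ 2 / 4).
  by rewrite mulNr -mulr_natr -natrM.
have -> : - (z ^+ 2 / 2) = - (z ^+ 2 / 4) + - (z ^+ 2 / 4) by field.
rewrite expRD; set E := expR (- _).
have E0 : 0 < E by exact: expR_gt0.
have H : z ^+ 4 * E <= 32.
  rewrite /E expRN ler_pdivrMr ?expR_gt0//.
  have u0 : 0 <= z ^+ 2 / 4 by rewrite divr_ge0 ?sqr_ge0.
  have : (z ^+ 2 / 4) ^+ 2 / 2 <= expR (z ^+ 2 / 4).
    have := expR_ge1Dxn 1 u0; rewrite (_ : 2`!%:R = 2 :> R)//; lra.
  have e4 : z ^+ 4 = 16 * (z ^+ 2 / 4) ^+ 2 by field.
  by rewrite e4; move: (expR _) ((_ / 4) ^+ 2) => X Y ?; lra.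
have -> : z ^+ 4 * (r * q * (E * E)) = (z ^+ 4 * E) * (r * (q * E)) by ring.
have -> : 32 * r * (q * E) = 32 * (r * (q * E)) by ring.
by rewrite ler_wpM2r// mulr_ge0// mulr_ge0// ltW.
Qed.

Lemma integrable_phiM4 h : measurable_fun setT h ->
  (forall z, `|h z| <= 1 + z ^+ 4) ->
  mu.-integrable setT (fun z => (h z * phi z)%:E).
Proof.
move=> mh hM.
have i1 : mu.-integrable setT
    (fun z => (phi z + 32 * Num.sqrt 2 * normal_pdf 0 (Num.sqrt 2) z)%:E).
  under eq_fun do rewrite EFinD.
  apply: integrableD => //; first exact: integrable_normal_pdf.
  under eq_fun do rewrite EFinM.
  apply: integrableZl => //; exact: integrable_normal_pdf.
apply: le_integrable i1 => //.
  apply/measurable_EFinP; apply: measurable_funM => //; exact: measurable_phi.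
move=> z _; rewrite /= lee_fin.
rewrite [leRHS]ger0_norm; last first.
  by rewrite addr_ge0 ?phi_ge0// !mulr_ge0 ?normal_pdf_ge0.
rewrite normrM (ger0_norm (phi_ge0 z)).
rewrite (le_trans (ler_wpM2r (phi_ge0 z) (hM z)))//.
by rewrite mulrDl mul1r lerD2l pow4_phi_ub.
Qed.

Lemma is_derive_phi z : is_derive (z : R^o) (1 : R) (phi : R^o -> R^o) (- z * phi z).
Proof.
have -> : (phi : R^o -> R^o) = (fun z => normal_peak 1 * expR (- (z ^+ 2 / 2))).
  by apply/funext => y; rewrite phiE.
apply: is_derive_eq; rewrite /GRing.scale/=.
by rewrite !mulr1 mulr0 mulr0 add0r; field.
Qed.

Definition symitv (n : nat) : set R := `[- n%:R, n%:R].

(** Together with [integral_sym_FTC], this computes the integral over the line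
of a function with an explicit primitive. *)
Lemma cvg_integral_sym (g : R -> R) : mu.-integrable setT (EFin \o g) ->
  (\int[mu]_(z in symitv n) (g z)%:E)%E @[n --> \oo] -->
  (\int[mu]_z (g z)%:E)%E.
Proof.
move=> ig.
have mg : measurable_fun setT g by apply/measurable_EFinP; exact: measurable_int ig.
pose gn (n : nat) (z : R) := ((EFin \o g) \_ (symitv n)) z.
have := @dominated_convergence _ _ _ mu setT measurableT gn (EFin \o g)
  (fun z => `|(g z)%:E|)%E.
case.
- move=> n; apply/(measurable_restrictT _ _).1; first exact: measurable_itv.
  exact/measurable_funTS/measurable_EFinP.
- exact: measurable_int ig.
- apply/aeW => z _; apply: cvg_near_cst.
  near=> n; rewrite /gn patchE ifT// inE /symitv/= in_itv/= -ler_norml.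
  near: n; exact: nbhs_infty_ger.
- exact: integrable_abse.
- apply/aeW => z n _; rewrite /gn patchE; case: ifP => _ //.
  by rewrite abse0.
move=> _ _; rewrite /=; under eq_fun do rewrite -integral_mkcond//; exact.
Unshelve. all: by end_near. Qed.


Lemma integral_sym_FTC (g G : R -> R) : continuous g ->
  (forall z, is_derive (z : R^o) (1 : R) (G : R^o -> R^o) (g z)) ->
  forall n : nat, (0 < n)%N ->
  (\int[mu]_(z in symitv n) (g z)%:E = (G n%:R - G (- n%:R))%:E)%E.
Proof.
move=> cg dG n n0.
have dG' z : derivable (G : R^o -> R^o) z 1 by [].
have cG : continuous G.
  by move=> z; apply: differentiable_continuous; apply/derivable1_diffP.
rewrite /symitv (@continuous_FTC2 _ g G)//.
- by rewrite gtrN// ltr0n.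
- exact: continuous_subspaceT.
- split=> //; [by apply: cvg_at_right_filter; exact: cG|by apply: cvg_at_left_filter; exact: cG].
- by move=> z _; rewrite derive1E; have [_ ->] := dG z.
Qed.

Lemma continuousX_phi k : continuous (fun z : R => z ^+ k * phi z).
Proof.
by move=> z; apply: cvgM; [exact: exprn_continuous|exact: continuous_phi].
Qed.

Lemma integrableX_phi k : (k <= 4)%N ->
  mu.-integrable setT (fun z => (z ^+ k * phi z)%:E).
Proof.
move=> k4; apply: integrable_phiM4; first exact: measurable_funX.
move=> z; rewrite normrX.
have [z1|z1] := leP `|z| 1.
  rewrite (le_trans (exprn_ile1 _ _ z1))//.
  by rewrite lerDl -[4%N]/(2 * 2)%N exprM sqr_ge0.
rewrite (le_trans (ler_weXn2l (ltW z1) k4))//.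
by rewrite -normrX ger0_norm ?lerDr// -[4%N]/(2 * 2)%N exprM sqr_ge0.
Qed.

(** z phi(z) is the derivative of - phi, which is even. *)
Lemma gauss_mean_id : gauss_mean id = 0.
Proof.
have := cvg_integral_sym (integrableX_phi (isT : (1 <= 4)%N)).
have dphi z : is_derive (z : R^o) (1 : R) ((- phi) : R^o -> R^o) (z ^+ 1 * phi z).
  by have := is_derive_phi z => ?; apply: is_derive_eq; rewrite expr1 mulNr opprK.
move=> H.
have : \forall n \near \oo, (\int[mu]_(z in symitv n) (z ^+ 1 * phi z)%:E = 0)%E.
  near=> n; rewrite (integral_sym_FTC (@continuousX_phi 1) dphi); last first.
    by near: n; exists 1%N.
  rewrite /= !fctE !phiE sqrrN; congr EFin; lra.
move=> /cvg_near_cst H0.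
rewrite -[LHS]/(fine (\int[mu]_z (z ^+ 1 * phi z)%:E)%E).
by rewrite -(cvg_unique _ H0 H).
Unshelve. all: by end_near. Qed.

Lemma cvg_natM_phi : n%:R * phi n%:R @[n --> \oo] --> (0 : R).
Proof.
pose C : R := 32 * Num.sqrt 2 * normal_peak (Num.sqrt 2).
have : C * (n%:R^-1 : R) @[n --> \oo] --> (0 : R).
  rewrite -[X in _ --> X](mulr0 C); apply: cvgM; first exact: cvg_cst.
  by apply/gtr0_cvgV0; [near=> n; rewrite ltr0n; near: n; exists 1%N|exact: cvgr_idn].
apply: (@squeeze_cvgr _ _ _ _ (fun=> 0)); last exact: cvg_cst.
near=> n; rewrite mulr_ge0 ?phi_ge0//=.
have n1 : (1 : R) <= n%:R by rewrite ler1n; near: n; exists 1%N.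
have n0 : (0 : R) < n%:R by rewrite (lt_le_trans ltr01).
rewrite ler_pdivlMr//.
rewrite (@le_trans _ _ (n%:R ^+ 4 * phi n%:R))//.
  rewrite mulrAC ler_wpM2r ?phi_ge0// -expr2 ler_weXn2l//.
rewrite (le_trans (pow4_phi_ub _))// ler_wpM2l ?mulr_ge0//.
by rewrite normal_pdf_ub// gt_eqF// sqrtr_gt0.
Unshelve. all: by end_near. Qed.

(** (1 - z^2) phi(z) is the derivative of z phi(z), which vanishes at
infinity. *)
Lemma gauss_mean_sqr : gauss_mean (fun z => z ^+ 2) = 1.
Proof.
have i0 := integrableX_phi (isT : (0 <= 4)%N).
have i2 := integrableX_phi (isT : (2 <= 4)%N).
pose g z := z ^+ 0 * phi z - z ^+ 2 * phi z.
have ig : mu.-integrable setT (EFin \o g).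
  exact: (integrableB measurableT i0 i2).
have cg : continuous g.
  by move=> z; apply: cvgB; exact: continuousX_phi.
have := cvg_integral_sym ig.
have dG z : is_derive (z : R^o) (1 : R) ((fun z => z * phi z) : R^o -> R^o) (g z).
  have := is_derive_phi z => ?; apply: is_derive_eq.
  by rewrite /g /GRing.scale/=; ring.
move=> H.
have : (\int[mu]_(z in symitv n) (g z)%:E)%E @[n --> \oo] --> (0%R)%:E.
  apply: (@cvg_trans _ ((fun n : nat => (2 * (n%:R * phi n%:R))%:E) @ \oo)).
    apply: near_eq_cvg; near=> n; rewrite (integral_sym_FTC cg dG); last first.
      by near: n; exists 1%N.
    by rewrite !phiE sqrrN; congr EFin; ring.
  apply/fine_cvgP; split; first exact: nearW.
  rewrite -[X in _ --> X](mulr0 2); apply: cvgM; [exact: cvg_cst|exact: cvg_natM_phi].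
move=> /(cvg_unique _ H) => HH.
have := RintegralB measurableT i0 i2.
rewrite [X in X = _](_ : _ = 0); last first.
  transitivity (fine (0%:E : \bar R)) => //; congr fine.
  by rewrite -[LHS]/(\int[mu]_x (g x)%:E)%E; first [exact: HH|exact/esym].
rewrite [X in X - _](_ : _ = gauss_mean (fun=> 1))// gauss_mean_cst.
by move/esym/eqP; rewrite subr_eq0 => /eqP ->.
Unshelve. all: by end_near. Qed.

Lemma integrable_norm3_phi : mu.-integrable setT (fun z => (`|z| ^+ 3 * phi z)%:E).
Proof.
have := integrable_abse (integrableX_phi (isT : (3 <= 4)%N)).
by apply: eq_integrable => // z _; rewrite /= normrM normrX (ger0_norm (phi_ge0 z)).
Qed.

End gaussian.

(** * A smooth approximation of the indicator of a half-line *)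

Section smoothing.
Context {R : realType}.
Implicit Types (x y u s kappa C : R) (h : R -> R).

(** Regularity of class C^3 with third derivative at most 6 C, without
derivatives: a and b stand for h'(x) and h''(x) / 2. This is what the
replacement argument asks of a test function, and it is stable under linear
combinations, so that it can be checked on a spline. *)
Definition taylor3 C h := forall x, exists a b, forall y,
  `|h (x + y) - h x - a * y - b * y ^+ 2| <= C * `|y| ^+ 3.

(** The building block of cubic splines: of class C^2, with a second derivative
of Lipschitz constant 6, and with polynomial expansions on each side of 0. *)
Definition poscube x : R := Num.max x 0 ^+ 3.

Lemma taylor3_poscube : taylor3 1 poscube.
Proof.
move=> x; exists (3 * Num.max x 0 ^+ 2), (3 * Num.max x 0) => y.
rewrite mul1r /poscube.
have y3 : y ^+ 3 <= `|y| ^+ 3 by rewrite -normrX ler_norm.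
have y3' : - y ^+ 3 <= `|y| ^+ 3 by rewrite -normrX -normrN ler_norm.
have [x0|x0] := leP x 0; have [xy0|xy0] := leP (x + y) 0.
- by rewrite !expr0n/= !mulr0 !mul0r !subr0 normr0 exprn_ge0.
- rewrite !expr0n/= !mulr0 !mul0r !subr0 [leLHS]ger0_norm ?exprn_ge0 ?(ltW xy0)//.
  apply: le_trans y3; apply: lerXn2r; rewrite ?nnegrE; lra.
- rewrite expr0n/=; have y0 : y <= 0 by lra.
  have -> : 0 - x ^+ 3 - 3 * x ^+ 2 * y - 3 * x * y ^+ 2 = y ^+ 3 - (x + y) ^+ 3 by ring.
  have H : (- (x + y)) ^+ 3 <= (- y) ^+ 3.
    apply: lerXn2r; rewrite ?nnegrE; lra.
  have H0 : 0 <= (- (x + y)) ^+ 3 by apply: exprn_ge0; lra.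
  have e3 (t : R) : (- t) ^+ 3 = - t ^+ 3 by ring.
  rewrite !e3 in H H0; move: H H0 y3 y3'; move: ((x + y) ^+ 3) (y ^+ 3) (`|y| ^+ 3) => p q r *.
  by rewrite ler_norml; apply/andP; split; lra.
- have -> : (x + y) ^+ 3 - x ^+ 3 - 3 * x ^+ 2 * y - 3 * x * y ^+ 2 = y ^+ 3 by ring.
  by rewrite normrX.
Qed.

(** The integral of the quadratic B-spline with knots 0, 1, 2, 3: as a third
difference of truncated cubes it vanishes on the left of 0 and is constant on
the right of 3. *)
Definition smoothstep u : R :=
  (poscube u - 3 * poscube (u - 1) + 3 * poscube (u - 2) - poscube (u - 3)) / 6.

Lemma smoothstep_le0 u : u <= 0 -> smoothstep u = 0.
Proof.
move=> u0; rewrite /smoothstep /poscube !max_r ?expr0n/=; [|lra..].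
by rewrite !mulr0 !subr0 addr0 mul0r.
Qed.

Lemma smoothstep_ge3 u : 3 <= u -> smoothstep u = 1.
Proof. by move=> u0; rewrite /smoothstep /poscube !max_l; [field|lra..]. Qed.

Lemma smoothstep01 u : 0 <= smoothstep u <= 1.
Proof.
have [u0|u0] := leP u 0; first by rewrite smoothstep_le0// lexx ler01.
have [u3|u3] := leP 3 u; first by rewrite smoothstep_ge3// lexx ler01.
rewrite /smoothstep /poscube (max_l (ltW u0)) (max_r (_ : u - 3 <= 0)); last lra.
have [u1|u1] := leP u 1.
  rewrite (max_r (_ : u - 1 <= 0)) ?(max_r (_ : u - 2 <= 0)); [|lra..].
  rewrite expr0n/= !mulr0 !subr0 addr0.
  have : u ^+ 3 <= 1 by rewrite exprn_ile1// ltW.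
  have : 0 <= u ^+ 3 by rewrite exprn_ge0// ltW.
  by move: (u ^+ 3) => X; lra.
rewrite (max_l (_ : 0 <= u - 1)); last lra.
have [u2|u2] := leP u 2.
  rewrite (max_r (_ : u - 2 <= 0)); last lra.
  rewrite expr0n/= mulr0 subr0 addr0; set v := u - 1.
  have -> : u = 1 + v by rewrite /v; ring.
  have v0 : 0 <= v by rewrite /v; lra.
  have v1 : v <= 1 by rewrite /v; lra.
  have H1 : 0 <= v ^+ 2 * (3 - 2 * v) by rewrite mulr_ge0 ?sqr_ge0//; lra.
  have H2 : 0 <= (1 - v) ^+ 2 * (1 + 2 * v) by rewrite mulr_ge0 ?sqr_ge0//; lra.
  have -> : (1 + v) ^+ 3 - 3 * v ^+ 3 = 1 + 3 * v + v ^+ 2 * (3 - 2 * v) by ring.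
  have e : (1 - v) ^+ 2 * (1 + 2 * v) = 1 - v ^+ 2 * (3 - 2 * v) by ring.
  by move: H1 H2; rewrite e; move: (v ^+ 2 * _) => X; lra.
rewrite (max_l (_ : 0 <= u - 2)); last lra.
rewrite expr0n/= subr0.
have -> : u ^+ 3 - 3 * (u - 1) ^+ 3 + 3 * (u - 2) ^+ 3 = 6 - (3 - u) ^+ 3 by ring.
have : (3 - u) ^+ 3 <= 1 by rewrite exprn_ile1//; lra.
have : 0 <= (3 - u) ^+ 3 by rewrite exprn_ge0//; lra.
by move: ((3 - u) ^+ 3) => X; lra.
Qed.

Lemma continuous_poscube : continuous poscube.
Proof.
move=> x; rewrite /poscube; apply: (continuous_comp (f := fun x => Num.max x 0) (g := fun x => x ^+ 3)); last exact: exprn_continuous.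
by apply: continuous_max => //; exact: cst_continuous.
Qed.

Lemma continuous_smoothstep : continuous smoothstep.
Proof.
have sh a : continuous (fun u => poscube (u - a)).
  move=> u; apply: (continuous_comp (f := fun u => u - a)); last exact: continuous_poscube.
  by apply: cvgB => //; exact: cvg_cst.
move=> u; rewrite /smoothstep; apply: cvgM; last exact: cvg_cst.
apply: cvgB; last exact: sh.
apply: cvgD; last by apply: cvgM; [exact: cvg_cst|exact: sh].
by apply: cvgB; [exact: continuous_poscube|apply: cvgM; [exact: cvg_cst|exact: sh]].
Qed.

Lemma taylor3_smoothstep : taylor3 2 smoothstep.
Proof.
move=> u.
have [a0 [b0 H0]] := taylor3_poscube u.
have [a1 [b1 H1]] := taylor3_poscube (u - 1).
have [a2 [b2 H2]] := taylor3_poscube (u - 2).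
have [a3 [b3 H3]] := taylor3_poscube (u - 3).
exists ((a0 - 3 * a1 + 3 * a2 - a3) / 6), ((b0 - 3 * b1 + 3 * b2 - b3) / 6) => y.
have {}H0 := H0 y; have {}H1 := H1 y; have {}H2 := H2 y; have {}H3 := H3 y.
rewrite /smoothstep.
have e a : u + y - a = u - a + y by ring.
rewrite !e.
move: H0 H1 H2 H3; set Y := `|y| ^+ 3; have : 0 <= Y by rewrite exprn_ge0.
move: Y (poscube (u + y)) (poscube u) (poscube (u - 1 + y)) (poscube (u - 1))
   (poscube (u - 2 + y)) (poscube (u - 2)) (poscube (u - 3 + y)) (poscube (u - 3))
   (y ^+ 2) => Y p0 q0 p1 q1 p2 q2 p3 q3 y2 Y0.
rewrite !ler_norml => /andP[? ?] /andP[? ?] /andP[? ?] /andP[? ?].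
by apply/andP; split; lra.
Qed.

(** Lies between the indicators of the half-lines ending at s and at
s + 3 kappa; the price is a Taylor constant of order kappa^-3. *)
Definition smooth_ind s kappa x := 1 - smoothstep ((x - s) / kappa).

Lemma smooth_ind01 s kappa x : 0 <= smooth_ind s kappa x <= 1.
Proof. by have := smoothstep01 ((x - s) / kappa); rewrite /smooth_ind; lra. Qed.

Lemma continuous_smooth_ind s kappa : continuous (smooth_ind s kappa).
Proof.
move=> x; apply: cvgB; first exact: cvg_cst.
apply: (continuous_comp (f := fun x => (x - s) / kappa)); last exact: continuous_smoothstep.
by apply: cvgM; [apply: cvgB => //|]; exact: cvg_cst.
Qed.

Lemma smooth_ind_ge s kappa x : 0 < kappa -> (x <= s)%R%:R <= smooth_ind s kappa x.
Proof.
move=> k0; have [xs|xs] := leP x s; last by have /andP[] := smooth_ind01 s kappa x.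
rewrite /smooth_ind smoothstep_le0 ?subr0//.
by rewrite pmulr_lle0 ?invr_gt0// subr_le0.
Qed.

Lemma smooth_ind_le s kappa x : 0 < kappa -> smooth_ind s kappa x <= (x <= s + 3 * kappa)%R%:R.
Proof.
move=> k0; have [xs|xs] := leP x (s + 3 * kappa); first by have /andP[] := smooth_ind01 s kappa x.
rewrite /smooth_ind smoothstep_ge3 ?subrr//.
by rewrite ler_pdivlMr//; lra.
Qed.

Lemma taylor3_smooth_ind s kappa : 0 < kappa -> taylor3 (2 / kappa ^+ 3) (smooth_ind s kappa).
Proof.
move=> k0 x; have [a [b H]] := taylor3_smoothstep ((x - s) / kappa).
exists (- (a / kappa)), (- (b / kappa ^+ 2)) => y.
have := H (y / kappa); rewrite normrM normfV (gtr0_norm k0).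
have -> : (x - s) / kappa + y / kappa = (x + y - s) / kappa by rewrite -mulrDl; congr (_ / _); ring.
rewrite /smooth_ind -normrN.
set p := smoothstep _; set q := smoothstep _.
have -> : 2 * (`|y| / kappa) ^+ 3 = 2 / kappa ^+ 3 * `|y| ^+ 3 by field; rewrite gt_eqF.
have <- // : - (p - q - a * (y / kappa) - b * (y / kappa) ^+ 2) =
  1 - p - (1 - q) - - (a / kappa) * y - - (b / kappa ^+ 2) * y ^+ 2.
by field; rewrite gt_eqF.
Qed.

End smoothing.

(** * Lindeberg replacement for resampled sums *)

Section lindeberg.
Context {R : realType}.
Local Notation mu := (@lebesgue_measure R).
Local Notation phi := (@normal_pdf R 0 1).
Implicit Types (x y u s kappa C tau : R) (h : R -> R).

Definition unif_mean (T : finType) (X : T -> R) : R := (\sum_t X t) / #|T|%:R.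

Section unif_mean.
Context (T : finType).
Implicit Types X Y : T -> R.

Lemma unif_mean_cst c : (0 < #|T|)%N -> unif_mean (fun _ : T => c) = c.
Proof.
move=> T0; rewrite /unif_mean sumr_const -[c *+ _]mulr_natr mulfK//.
by rewrite pnatr_eq0 -lt0n.
Qed.

Lemma unif_meanD X Y : unif_mean (fun t => X t + Y t) = unif_mean X + unif_mean Y.
Proof. by rewrite /unif_mean big_split mulrDl. Qed.

Lemma unif_meanB X Y : unif_mean (fun t => X t - Y t) = unif_mean X - unif_mean Y.
Proof. by rewrite /unif_mean sumrB mulrBl. Qed.

Lemma unif_meanZ c X : unif_mean (fun t => c * X t) = c * unif_mean X.
Proof. by rewrite /unif_mean -mulr_sumr mulrA. Qed.

Lemma le_unif_mean X Y : (forall t, X t <= Y t) -> unif_mean X <= unif_mean Y.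
Proof. by move=> XY; rewrite /unif_mean ler_wpM2r ?invr_ge0//; exact: ler_sum. Qed.

Lemma ler_norm_unif_mean X : `|unif_mean X| <= unif_mean (fun t => `|X t|).
Proof.
rewrite /unif_mean normrM [X in _ * X <= _]ger0_norm ?invr_ge0//.
by rewrite ler_wpM2r ?invr_ge0//; exact: ler_norm_sum.
Qed.

Lemma unif_mean_dist X Y B : (0 < #|T|)%N -> (forall t, `|X t - Y t| <= B) ->
  `|unif_mean X - unif_mean Y| <= B.
Proof.
move=> T0 H; rewrite -unif_meanB (le_trans (ler_norm_unif_mean _))//.
by rewrite -[leRHS](unif_mean_cst B T0); apply: le_unif_mean.
Qed.

End unif_mean.

Definition testfun h := continuous h /\ forall z, 0 <= h z <= 1.

Definition gauss_smooth (s : R) h x : R := gauss_mean (fun z => h (x + s * z)).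

Definition abs3 : R := \int[mu]_z (`|z| ^+ 3 * phi z).

Lemma abs3_ge0 : 0 <= abs3.
Proof. by apply: Rintegral_ge0 => z _; rewrite mulr_ge0 ?exprn_ge0 ?phi_ge0. Qed.

Section testfun.
Variables (h : R -> R).
Hypothesis ht : testfun h.

Lemma testfun_norm z : `|h z| <= 1.
Proof. by have /andP[? ?] := ht.2 z; rewrite ger0_norm. Qed.

Lemma measurable_testfun : measurable_fun setT h.
Proof. exact: continuous_measurable_fun ht.1. Qed.

Lemma measurable_testfun_affine x s : measurable_fun setT (fun z => h (x + s * z)).
Proof.
apply: measurableT_comp; first exact: measurable_testfun.
by apply: measurable_funD => //; exact: measurable_funM.
Qed.

Lemma integrable_testfun x s : mu.-integrable setT (fun z => (h (x + s * z) * phi z)%:E).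
Proof.
apply: (@integrable_phiM _ _ 1); first exact: measurable_testfun_affine.
by move=> z; exact: testfun_norm.
Qed.

Lemma gauss_smooth0 x : gauss_smooth 0 h x = h x.
Proof.
by rewrite /gauss_smooth; under eq_fun do rewrite mul0r addr0; rewrite gauss_mean_cst.
Qed.

(** Variances add: a Gaussian mean of a smoothed function is a smoother
function, which lets the smoothing accumulate in [lindeberg]. *)
Lemma gauss_smooth_add a b x : 0 <= a -> 0 <= b ->
  gauss_mean (fun z => gauss_smooth a h (x + b * z)) =
  gauss_smooth (Num.sqrt (a ^+ 2 + b ^+ 2)) h x.
Proof.
move=> a0 b0; rewrite /gauss_smooth -(@gauss_mean_add _ (fun y => h (x + y)))//.
- by congr gauss_mean; apply/funext => z; congr gauss_mean; apply/funext => u; rewrite -addrA [b * z + _]addrC.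
- move=> y; apply: (continuous_comp (f := fun y => x + y)); last exact: ht.1.
  by apply: cvgD => //; exact: cvg_cst.
- by move=> z; exact: ht.2.
Qed.

Lemma gauss_mean_unif_mean (T : finType) (X : T -> R) x s :
  unif_mean (fun t => gauss_smooth s h (x + X t)) =
  gauss_mean (fun z => unif_mean (fun t => h (x + s * z + X t))).
Proof.
rewrite /unif_mean /gauss_mean.
under [in RHS]eq_Rintegral do rewrite mulrAC mulr_suml.
have I t : mu.-integrable setT (fun z => (h (x + X t + s * z) * phi z)%:E) by exact: integrable_testfun.
have eI t : (fun z => (h (x + X t + s * z) * phi z)) = (fun z => h (x + s * z + X t) * phi z).
  by apply/funext => z; rewrite addrAC.
have E (r : seq T) : mu.-integrable setT (fun z => (\sum_(t <- r) (h (x + s * z + X t) * phi z))%:E) /\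
   \int[mu]_z (\sum_(t <- r) (h (x + s * z + X t) * phi z)) =
   \sum_(t <- r) gauss_smooth s h (x + X t).
  elim: r => [|t r [IH1 IH2]].
    split; first by under eq_fun do rewrite big_nil; exact: integrable0.
    rewrite big_nil; under eq_Rintegral do rewrite big_nil.
    by rewrite /Rintegral integral0.
  have It : mu.-integrable setT (fun z => (h (x + s * z + X t) * phi z)%:E).
    by have := I t; apply: eq_integrable => // z _; rewrite addrAC.
  split.
    under eq_fun do rewrite big_cons EFinD.
    exact: integrableD.
  rewrite big_cons -IH2; under eq_Rintegral do rewrite big_cons.
  by rewrite RintegralD//; congr (_ + _); rewrite /gauss_smooth /gauss_mean eI.
have [E1 E2] := E (index_enum T).
by rewrite RintegralZr// E2.
Qed.

Lemma gauss_smooth01 s x : 0 <= gauss_smooth s h x <= 1.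
Proof.
apply/andP; split.
  apply: Rintegral_ge0 => z _; rewrite mulr_ge0 ?phi_ge0//.
  by have /andP[] := ht.2 (x + s * z).
rewrite -[leRHS](gauss_mean_cst 1); apply: (@le_gauss_mean _ _ _ 1) => //.
- exact: measurable_testfun_affine.
- by move=> z; exact: testfun_norm.
- by move=> z; rewrite normr1.
- by move=> z; have /andP[] := ht.2 (x + s * z).
Qed.

Lemma measurable_gauss_smooth s : measurable_fun setT (gauss_smooth s h).
Proof.
pose F (xz : R * R) : \bar R := (h (xz.1 + s * xz.2) * phi xz.2)%:E.
have mF : measurable_fun setT F.
  apply/measurable_EFinP; apply: measurable_funM.
    apply: measurableT_comp; first exact: measurable_testfun.
    by apply: measurable_funD; [exact: measurable_fst|apply: measurable_funM].
  by apply: measurableT_comp; first exact: measurable_phi.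
have F0 xz : (0 <= F xz)%E.
  by rewrite lee_fin mulr_ge0 ?phi_ge0//; have /andP[] := ht.2 (xz.1 + s * xz.2).
rewrite /gauss_smooth /gauss_mean /Rintegral.
apply: (measurableT_comp (f := fine)) => //.
exact: (@measurable_fun_fubini_tonelli_F _ _ _ _ _ mu F mF).
Qed.

End testfun.

(** The Taylor polynomial of degree 2 of h at x has the same mean under the
uniform law on the values of X and under the Gaussian law with the same first
two moments; both remainders are cubic. *)
Lemma lindeberg_step (T : finType) (X : T -> R) h C tau x :
  (0 < #|T|)%N -> testfun h -> taylor3 C h -> 0 <= C -> 0 <= tau ->
  unif_mean X = 0 -> unif_mean (fun t => X t ^+ 2) = tau ->
  `|unif_mean (fun t => h (x + X t)) - gauss_smooth (Num.sqrt tau) h x| <=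
  C * (unif_mean (fun t => `|X t| ^+ 3) + Num.sqrt tau ^+ 3 * abs3).
Proof.
move=> T0 ht h3 C0 tau0 m1 m2.
have [a [b H]] := h3 x.
set m := h x + b * tau.
have -> : forall p q : R, p - q = (p - m) - (q - m) by move=> *; ring.
rewrite (le_trans (ler_normB _ _))// mulrDr lerD//.
  have -> : m = unif_mean (fun t => h x + a * X t + b * X t ^+ 2).
    by rewrite !unif_meanD !unif_meanZ m1 m2 unif_mean_cst// mulr0 addr0.
  rewrite -unif_meanB (le_trans (ler_norm_unif_mean _))// -unif_meanZ.
  apply: le_unif_mean => t; rewrite (le_trans _ (H (X t)))// le_eqVlt; apply/orP; left.
  by apply/eqP; congr `|_|; ring.
set s := Num.sqrt tau.
have s2 : s ^+ 2 = tau by rewrite sqr_sqrtr.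
have i0 := @integrableX_phi R 0 isT.
have i1 := @integrableX_phi R 1 isT.
have i2 := @integrableX_phi R 2 isT.
have i3 := @integrable_norm3_phi R.
have ih := integrable_testfun ht x s.
have j0 := integrableZl measurableT (h x) i0.
have j1 := integrableZl measurableT (a * s) i1.
have j2 := integrableZl measurableT (b * tau) i2.
have j01 := integrableD measurableT j0 j1.
have iq := integrableD measurableT j01 j2.
have mE : m = \int[mu]_z (h x * (z ^+ 0 * phi z) + (a * s) * (z ^+ 1 * phi z)
     + (b * tau) * (z ^+ 2 * phi z)).
  rewrite (RintegralD measurableT j01 j2) (RintegralD measurableT j0 j1).
  rewrite (RintegralZl _ measurableT i0) (RintegralZl _ measurableT i1) (RintegralZl _ measurableT i2).
  transitivity (h x * 1 + a * s * 0 + b * tau * 1).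
    by rewrite !mulr1 mulr0 addr0.
  congr (_ * _ + _ * _ + _ * _); symmetry.
  - exact: (gauss_mean_cst 1).
  - exact: gauss_mean_id.
  - exact: gauss_mean_sqr.
rewrite /gauss_smooth /gauss_mean mE -RintegralB//.
have iB := integrableB measurableT ih iq.
rewrite (le_trans (le_normr_Rintegral measurableT iB))//.
have -> : C * (s ^+ 3 * abs3) = \int[mu]_z (C * s ^+ 3 * (`|z| ^+ 3 * phi z)).
  by rewrite RintegralZl// mulrA.
apply: le_Rintegral => //.
- exact: (integrable_abse iB).
- exact: (integrableZl measurableT _ i3).
move=> z _.
have -> : h (x + s * z) * phi z - (h x * (z ^+ 0 * phi z) + a * s * (z ^+ 1 * phi z) +
      b * tau * (z ^+ 2 * phi z)) =
   (h (x + s * z) - h x - a * (s * z) - b * (s * z) ^+ 2) * phi z.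
  by rewrite -s2 expr0 expr1; ring.
rewrite normrM (ger0_norm (phi_ge0 z)).
rewrite (le_trans (ler_wpM2r (phi_ge0 z) (H (s * z))))//.
by rewrite normrM (ger0_norm (sqrtr_ge0 _)) exprMn !mulrA.
Qed.

(** The mean of h at x plus k independent draws from the values of X, as k
nested averages: the recursion along which the draws are replaced one at a
time. *)
Fixpoint resum (T : finType) (X : T -> R) (k : nat) h x : R :=
  if k is k'.+1 then unif_mean (fun t => resum X k' h (x + X t)) else h x.

Lemma resum_dist (T : finType) (X : T -> R) k (g1 g2 : R -> R) B x :
  (0 < #|T|)%N -> (forall y, `|g1 y - g2 y| <= B) ->
  `|resum X k g1 x - resum X k g2 x| <= B.
Proof.
by move=> T0 H; elim: k x => [|k IH] x //=; exact: unif_mean_dist.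
Qed.

(** The draws are replaced by Gaussian variables one at a time. The noise
accumulated so far, together with the initial one of standard deviation r, is
averaged out last, so that every step applies [lindeberg_step] to h itself and
costs the same. *)
Lemma lindeberg (T : finType) (X : T -> R) h C tau r k x :
  (0 < #|T|)%N -> testfun h -> taylor3 C h -> 0 <= C -> 0 <= tau -> 0 <= r ->
  unif_mean X = 0 -> unif_mean (fun t => X t ^+ 2) = tau ->
  `|resum X k (gauss_smooth r h) x - gauss_smooth (Num.sqrt (r ^+ 2 + k%:R * tau)) h x| <=
  k%:R * (C * (unif_mean (fun t => `|X t| ^+ 3) + Num.sqrt tau ^+ 3 * abs3)).
Proof.
move=> T0 ht h3 C0 tau0 r0 m1 m2; set B := C * _.
elim: k x => [|k IH] x /=.
  by rewrite !mul0r addr0 sqrtr_sqr (ger0_norm r0) subrr normr0.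
set s := Num.sqrt (r ^+ 2 + k%:R * tau).
have s0 : 0 <= s by exact: sqrtr_ge0.
set M := unif_mean (fun t => gauss_smooth s h (x + X t)).
have -> : forall p q : R, p - q = (p - M) + (M - q) by move=> *; ring.
rewrite -natr1 [X in _ <= X]mulrDl mul1r (le_trans (ler_normD _ _))// lerD//.
  exact: unif_mean_dist.
rewrite /M gauss_mean_unif_mean//.
have -> : Num.sqrt (r ^+ 2 + (k%:R + 1) * tau) = Num.sqrt (Num.sqrt tau ^+ 2 + s ^+ 2).
  rewrite !sqr_sqrtr ?addr_ge0 ?sqr_ge0 ?mulr_ge0//; congr Num.sqrt; ring.
rewrite -gauss_smooth_add ?sqrtr_ge0//.
have I1 : mu.-integrable setT (fun z => (unif_mean (fun t => h (x + s * z + X t)) * phi z)%:E).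
  apply: (@integrable_phiM _ _ 1).
    apply: measurable_funM => //; apply: measurable_sum => t.
    under eq_fun do rewrite addrAC.
    exact: measurable_testfun_affine.
  move=> z; rewrite (le_trans (ler_norm_unif_mean _))// -[leRHS](unif_mean_cst (T := T) 1)//.
  by apply: le_unif_mean => t; exact: testfun_norm.
have I2 : mu.-integrable setT (fun z => (gauss_smooth (Num.sqrt tau) h (x + s * z) * phi z)%:E).
  apply: (@integrable_phiM _ _ 1).
    apply: measurableT_comp; first exact: measurable_gauss_smooth.
    by apply: measurable_funD => //; exact: measurable_funM.
  move=> z; have /andP[g0 g1] := gauss_smooth01 ht (Num.sqrt tau) (x + s * z).
  by rewrite ger0_norm.
rewrite /gauss_mean -RintegralB//.
have iB := integrableB measurableT I1 I2.
rewrite (le_trans (le_normr_Rintegral measurableT iB))//.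
have -> : B = \int[mu]_z (B * phi z) by rewrite -[LHS](gauss_mean_cst B).
apply: le_Rintegral => //.
- exact: (integrable_abse iB).
- exact: (integrableZl measurableT _ (integrable_normal_pdf _ _)).
move=> z _; rewrite -mulrBl normrM (ger0_norm (phi_ge0 z)) ler_wpM2r ?phi_ge0//.
exact: lindeberg_step.
Qed.

End lindeberg.

(** * A quantitative central limit theorem for two resampled sums *)

Section resampling_clt.
Context {R : realType}.
Local Notation mu := (@lebesgue_measure R).
Local Notation phi := (@normal_pdf R 0 1).
Implicit Types (x y u s kappa C tau : R) (h : R -> R).

(** A uniformly distributed map on 'I_k amounts to k independent uniform draws;
splitting off the image of 0 yields the recursion of [resum]. *)
Lemma unif_mean_ffun (T : finType) (X : T -> R) k h x : (0 < #|T|)%N ->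
  unif_mean (fun r : {ffun 'I_k -> T} => h (x + \sum_i X (r i))) = resum X k h x.
Proof.
move=> T0; have Tn0 : #|T|%:R != 0 :> R by rewrite pnatr_eq0 -lt0n.
rewrite /unif_mean card_ffun card_ord.
elim: k x => [|k IH] x /=.
  have c1 : #|{ffun 'I_0 -> T}| = 1%N by rewrite card_ffun card_ord expn0.
  rewrite expn0 divr1 (eq_bigr (fun=> h x)); last by move=> r _; rewrite big_ord0 addr0.
  by rewrite sumr_const c1.
pose f (tr : T * {ffun 'I_k -> T}) : {ffun 'I_k.+1 -> T} :=
  [ffun i => oapp tr.2 tr.1 (unlift ord0 i)].
pose g (r : {ffun 'I_k.+1 -> T}) : T * {ffun 'I_k -> T} :=
  (r ord0, [ffun i => r (lift ord0 i)]).
have fg : cancel f g.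
  move=> [t r]; rewrite /f /g/= ffunE unlift_none/=; congr pair.
  by apply/ffunP => i; rewrite !ffunE liftK.
have gf : cancel g f.
  move=> r; apply/ffunP => i; rewrite /f /g ffunE/=.
  by case: unliftP => [j|] ->//=; rewrite ffunE.
rewrite (reindex f)/=; last by exists g => ? _; [exact: fg|exact: gf].
rewrite -(pair_bigA _ (fun t r => h (x + \sum_i X (f (t, r) i))))/=.
rewrite /unif_mean (eq_bigr (fun t => (#|T| ^ k)%:R * resum X k h (x + X t))).
  have : (#|T| ^ k)%:R != 0 :> R by rewrite natrX expf_neq0.
  rewrite -mulr_sumr expnS natrM; move: (\sum_t _) Tn0 => S.
  by move: (#|T| ^ k)%:R (#|T|%:R) => a b b0 a0; field; rewrite ?a0 ?b0.
move=> t _; rewrite -IH mulrC divfK; last by rewrite natrX expf_neq0.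
apply: eq_bigr => r _; rewrite big_ord_recl/= addrA.
congr (h (_ + _ + _)); first by rewrite /f ffunE unlift_none.
by apply: eq_bigr => i _; rewrite /f ffunE liftK.
Qed.

Lemma unif_mean_pair (A B : finType) (F : A * B -> R) :
  unif_mean F = unif_mean (fun a => unif_mean (fun b => F (a, b))).
Proof.
rewrite /unif_mean -mulr_suml card_prod natrM invfM -mulrA [_ / _]mulrC.
rewrite [_^-1 * _^-1]mulrC; congr (_ * _).
by rewrite (pair_bigA _ (fun a b => F (a, b))); apply: eq_bigr => -[].
Qed.

Definition Phi s : R := fine (normal_prob 0 1 [set z : R | z <= s]).

Let measurable_le s : measurable [set z : R | z <= s].
Proof. by rewrite -set_itvNyc; exact: measurable_itv. Qed.

Lemma PhiE s : Phi s = gauss_mean (fun z => (z <= s)%R%:R).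
Proof.
rewrite /Phi /normal_prob /gauss_mean /Rintegral [in LHS]integral_mkcond.
congr fine; apply: eq_integral => z _; rewrite patchE.
have [zs|zs] := leP z s; first by rewrite mem_set//= mul1r.
by rewrite memNset ?mul0r//= => /le_lt_trans/(_ zs); rewrite ltxx.
Qed.

Lemma measurable_ind s : measurable_fun setT (fun z : R => (z <= s)%R%:R : R).
Proof.
have -> : (fun z : R => (z <= s)%R%:R : R) = \1_[set z : R | z <= s].
  apply/funext => z; rewrite indicE; congr (nat_of_bool _)%:R.
  by apply/idP/idP; rewrite inE.
exact: measurable_indic.
Qed.

Lemma ind_norm s z : `|(z <= s)%R%:R : R| <= 1.
Proof. by case: (z <= s); rewrite ?normr1// normr0 ler01. Qed.

Lemma Phi_ge0 s : 0 <= Phi s. Proof. exact: fine_ge0. Qed.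

Lemma normal_peak1_le1 : normal_peak 1 <= 1 :> R.
Proof.
rewrite /normal_peak invf_le1; last by rewrite sqrtr_gt0 expr1n mul1r mulrn_wgt0// pi_gt0.
rewrite -{1}[1]sqrtr1 ler_sqrt expr1n mul1r; last by rewrite mulrn_wge0// pi_ge0.
by have := pi_ge2 R; rewrite mulr2n; lra.
Qed.

(** The standard normal density is at most 1. *)
Lemma Phi_lip s t : s <= t -> Phi s <= Phi t <= Phi s + (t - s).
Proof.
move=> st.
have m1 := measurable_ind s; have m2 := measurable_ind t.
have i1 := integrable_phiM m1 (ind_norm s).
have i2 := integrable_phiM m2 (ind_norm t).
apply/andP; split.
  rewrite !PhiE; apply: (le_gauss_mean m1 m2 (ind_norm s) (ind_norm t)) => z.
  by have [zs|_] := leP z s; rewrite ?(le_trans zs st)//.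
rewrite -lerBlDl !PhiE /gauss_mean -RintegralB//.
have iB := integrableB measurableT i2 i1.
pose D : set R := `]s, t].
have mD : measurable D by exact: measurable_itv.
have muD : mu D = (t - s)%:E.
  rewrite /D lebesgue_measure_itv/= lte_fin.
  have [->|nst] := eqVneq s t; first by rewrite ltxx subrr.
  by rewrite lt_neqAle nst st -EFinD.
have iD : mu.-integrable setT (fun z => (\1_D z)%:E).
  exact: integrable_indic_itv.
apply: (@le_trans _ _ (\int[mu]_z (\1_D z))); last first.
  rewrite /Rintegral integral_indic// setIT.
  by rewrite [X in fine X](_ : _ = (t - s)%:E)//; exact: muD.
apply: le_Rintegral => //.
move=> z _; rewrite -mulrBl indicE.
have H : ((z <= t)%R%:R - (z <= s)%R%:R : R) <= (z \in D)%:R.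
  rewrite /D; case: (boolP (z \in _)) => [_|zD].
    by case: (z <= t); case: (z <= s) => /=; lra.
  have [zt|_] := leP z t; have [zs|zs] := leP z s => /=; [lra| |lra|lra].
  by move: zD; rewrite notin_setE/= in_itv/= zs zt.
have p1 : phi z <= 1 := le_trans (normal_pdf_ub 0 z (oner_neq0 _)) normal_peak1_le1.
apply: le_trans (ler_wpM2r (phi_ge0 z) H) _.
by rewrite ler_piMr.
Qed.

Lemma Phi_le1 s : Phi s <= 1.
Proof.
rewrite PhiE -[leRHS](gauss_mean_cst 1); apply: (le_gauss_mean (measurable_ind s) _ (ind_norm s)) => //.
- by move=> z; rewrite normr1.
- by move=> z; case: (z <= s).
Qed.

Section clt.
Variables (S T : finType) (X : S -> R) (Y : T -> R) (k : nat) (tau1 tau2 : R).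
Hypotheses (S0 : (0 < #|S|)%N) (T0 : (0 < #|T|)%N) (tau10 : 0 <= tau1) (tau20 : 0 <= tau2).
Hypotheses (X1 : unif_mean X = 0) (X2 : unif_mean (fun t => X t ^+ 2) = tau1).
Hypotheses (Y1 : unif_mean Y = 0) (Y2 : unif_mean (fun t => Y t ^+ 2) = tau2).
Hypothesis V1 : k%:R * tau1 + k%:R * tau2 = 1.

Let W (r : {ffun 'I_k -> S} * {ffun 'I_k -> T}) :=
  \sum_i X (r.1 i) + \sum_i Y (r.2 i).

Let Lambda := k%:R * ((unif_mean (fun t => `|X t| ^+ 3) + Num.sqrt tau1 ^+ 3 * @abs3 R)
              + (unif_mean (fun t => `|Y t| ^+ 3) + Num.sqrt tau2 ^+ 3 * @abs3 R)).

(** The draws from Y are replaced first, then those from X, with the Gaussian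
noise coming from Y kept as smoothing. *)
Lemma resampled_smooth h C : testfun h -> taylor3 C h -> 0 <= C ->
  `|unif_mean (fun r => h (W r)) - gauss_mean h| <= C * Lambda.
Proof.
move=> ht h3 C0.
have -> : unif_mean (fun r => h (W r)) = resum X k (resum Y k h) 0.
  rewrite unif_mean_pair -unif_mean_ffun//; congr unif_mean; apply/funext => r1.
  by rewrite -unif_mean_ffun// add0r.
set g := gauss_smooth (Num.sqrt (k%:R * tau2)) h.
have -> : gauss_mean h = gauss_smooth (Num.sqrt (Num.sqrt (k%:R * tau2) ^+ 2 + k%:R * tau1)) h 0.
  rewrite sqr_sqrtr ?mulr_ge0// addrC V1 sqrtr1 /gauss_smooth.
  by congr gauss_mean; apply/funext => z; rewrite add0r mul1r.
have -> : forall p q : R, p - q = (p - resum X k g 0) + (resum X k g 0 - q) by move=> *; ring.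
rewrite (le_trans (ler_normD _ _))// /Lambda mulrCA mulrDr mulrDr addrC lerD//.
  by apply: lindeberg => //; exact: sqrtr_ge0.
apply: resum_dist => // y.
have := @lindeberg _ T Y h C tau2 0 k y T0 ht h3 C0 tau20 (lexx 0) Y1 Y2.
rewrite expr0n/= add0r.
by rewrite (_ : gauss_smooth 0 h = h)//; apply/funext => ?; exact: gauss_smooth0.
Qed.

(** The indicator of the half-line ending at s lies between the smooth
indicators placed at s - 3 kappa and at s: 3 kappa is the resulting error on
Phi, and 2 / kappa^3 the Taylor constant of the smooth indicator. *)
Lemma resampled_clt s kappa : 0 < kappa ->
  `|unif_mean (fun r => (W r <= s)%R%:R) - Phi s| <= 3 * kappa + 2 / kappa ^+ 3 * Lambda.
Proof.
move=> k0.
have ST0 : (0 < #|{: {ffun 'I_k -> S} * {ffun 'I_k -> T}}|)%N.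
  by rewrite card_prod !card_ffun muln_gt0 !expn_gt0 S0 T0.
have C0 : 0 <= 2 / kappa ^+ 3 by rewrite divr_ge0 ?exprn_ge0 ?ltW.
have B u : `|unif_mean (fun r => smooth_ind u kappa (W r)) - gauss_mean (smooth_ind u kappa)| <= 2 / kappa ^+ 3 * Lambda.
  apply: resampled_smooth => //; last exact: taylor3_smooth_ind.
  by split; [exact: continuous_smooth_ind|exact: smooth_ind01].
have sn u z : `|smooth_ind u kappa z| <= 1.
  by have /andP[? ?] := smooth_ind01 u kappa z; rewrite ger0_norm.
have sm u : measurable_fun setT (smooth_ind u kappa).
  by apply: continuous_measurable_fun; exact: continuous_smooth_ind.
have up u : gauss_mean (smooth_ind u kappa) <= Phi (u + 3 * kappa).
  rewrite PhiE; apply: (le_gauss_mean (sm u) (measurable_ind _) (sn u) (ind_norm _)) => z.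
  exact: smooth_ind_le.
have lo u : Phi u <= gauss_mean (smooth_ind u kappa).
  rewrite PhiE; apply: (le_gauss_mean (measurable_ind _) (sm u) (ind_norm _) (sn u)) => z.
  exact: smooth_ind_ge.
have P1 : unif_mean (fun r => (W r <= s)%R%:R) <= unif_mean (fun r => smooth_ind s kappa (W r)).
  by apply: le_unif_mean => r; exact: smooth_ind_ge.
have P2 : unif_mean (fun r => smooth_ind (s - 3 * kappa) kappa (W r)) <= unif_mean (fun r => (W r <= s)%R%:R).
  apply: le_unif_mean => r; have := @smooth_ind_le _ (s - 3 * kappa) kappa (W r) k0.
  by rewrite subrK.
have /andP[_ L1] : Phi s <= Phi (s + 3 * kappa) <= Phi s + (s + 3 * kappa - s).
  by apply: Phi_lip; lra.
have /andP[_ L2] : Phi (s - 3 * kappa) <= Phi s <= Phi (s - 3 * kappa) + (s - (s - 3 * kappa)).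
  by apply: Phi_lip; lra.
have := B s; have := B (s - 3 * kappa); have := up s; have := lo (s - 3 * kappa).
move: P1 P2 L1 L2; rewrite !ler_norml.
move: (unif_mean _) (unif_mean _) (unif_mean _) (gauss_mean _) (gauss_mean _) (Phi _) (Phi _) (Phi _) (2 / _ * _) => *.
apply/andP; split; lra.
Qed.

(** As k tau is at most 1, the third moments of the Gaussian replacements
contribute O(k^(-1/2)) only, whatever the data. *)
Lemma Lambda_le : (0 < k)%N ->
  Lambda <= k%:R * (unif_mean (fun t => `|X t| ^+ 3) + unif_mean (fun t => `|Y t| ^+ 3))
            + 2 * @abs3 R / Num.sqrt k%:R.
Proof.
move=> k0; have kR : 0 < k%:R :> R by rewrite ltr0n.
have sk : 0 < Num.sqrt k%:R :> R by rewrite sqrtr_gt0.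
have skE : Num.sqrt k%:R ^+ 2 = k%:R :> R by rewrite sqr_sqrtr// ltW.
have H tau : 0 <= tau -> k%:R * tau <= 1 -> k%:R * Num.sqrt tau ^+ 3 <= (Num.sqrt k%:R)^-1.
  move=> t0 t1; rewrite -[_^-1]mul1r ler_pdivlMr//.
  have -> : k%:R * Num.sqrt tau ^+ 3 * Num.sqrt k%:R = (Num.sqrt k%:R * Num.sqrt tau) ^+ 3.
    by rewrite -{1}skE; ring.
  rewrite -sqrtrM ?(ltW kR)// exprn_ile1 ?sqrtr_ge0//.
  by rewrite -[leRHS]sqrtr1 ler_sqrt.
have H1 : k%:R * Num.sqrt tau1 ^+ 3 <= (Num.sqrt k%:R)^-1.
  by apply: H => //; have := mulr_ge0 (ltW kR) tau20; move: V1; lra.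
have H2 : k%:R * Num.sqrt tau2 ^+ 3 <= (Num.sqrt k%:R)^-1.
  by apply: H => //; have := mulr_ge0 (ltW kR) tau10; move: V1; lra.
have a0 := @abs3_ge0 R.
have := ler_wpM2r a0 H1; have := ler_wpM2r a0 H2.
rewrite /Lambda; move: (Num.sqrt tau1 ^+ 3) (Num.sqrt tau2 ^+ 3) => a b Ha Hb.
have -> : 2 * @abs3 R / Num.sqrt k%:R = (Num.sqrt k%:R)^-1 * @abs3 R + (Num.sqrt k%:R)^-1 * @abs3 R by ring.
move: Ha Hb; rewrite !mulrDr -!mulrA; lra.
Qed.

End clt.
End resampling_clt.

(** * The two-point regression line and the bootstrap distribution *)

Section two_point_regression.
Context {R : realType}.
Variables (k : nat) (L U : R).
Hypotheses (k0 : (0 < k)%N) (LU : L != U).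
Implicit Types Y : 'I_k -> R.

Let kR : k%:R != 0 :> R. Proof. by rewrite pnatr_eq0 -lt0n. Qed.

Lemma sum_sqr_dev (Y' : 'I_k -> R) c :
  \sum_i (Y' i - c) ^+ 2 = \sum_i (Y' i - unif_mean Y') ^+ 2 + k%:R * (unif_mean Y' - c) ^+ 2.
Proof.
set m := unif_mean Y'.
rewrite (eq_bigr (fun i => (Y' i - m) ^+ 2 + ((2 * (m - c)) * (Y' i - m) + (m - c) ^+ 2))); last by move=> i _; ring.
rewrite big_split big_split/= -mulr_sumr sumrB !sumr_const card_ord.
have -> : \sum_i Y' i = m * k%:R by rewrite /m /unif_mean card_ord divfK.
by rewrite -[m *+ k]mulr_natr subrr mulr0 add0r -[_ *+ k]mulr_natl.
Qed.

(** With two abscissas, the residual sum of squares is a constant plus k times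
the squared distances of the line to the two sample means, so the least
squares line is the line through these means. *)
Lemma dtilde2E theta (Y' Y'' : 'I_k -> R) :
  let sl := (unif_mean Y'' - unif_mean Y') / (U - L) in
  dtilde2 theta L U Y' Y'' = (theta - (unif_mean Y' - sl * L)) / sl.
Proof.
move=> sl; rewrite /dtilde2; set s := _ ++ _.
set u := unif_mean Y' in sl *; set v := unif_mean Y'' in sl *.
have UL : U - L != 0 by rewrite subr_eq0 eq_sym.
have sseE b : line_sse s b = (\sum_i (Y' i - u) ^+ 2 + \sum_i (Y'' i - v) ^+ 2)
    + k%:R * ((u - (b.1 + b.2 * L)) ^+ 2 + (v - (b.1 + b.2 * U)) ^+ 2).
  rewrite /line_sse /s big_cat !big_image/= (sum_sqr_dev Y') (sum_sqr_dev Y'') -/u -/v.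
  by move: (\sum_i (Y' i - u) ^+ 2) (\sum_i (Y'' i - v) ^+ 2) (k%:R) (u) (v) (b.1) (b.2) => *; ring.
pose b0 := (u - sl * L, sl).
have b0L : u - (b0.1 + b0.2 * L) = 0 by rewrite /b0/=; move: (u) (sl) => *; ring.
have b0U : v - (b0.1 + b0.2 * U) = 0 by rewrite /b0/= /sl; field.
have min0 : [set b | forall b', line_sse s b <= line_sse s b'] b0.
  move=> b'; rewrite !sseE b0L b0U expr0n/= addr0 mulr0 addr0 lerDl.
  by rewrite mulr_ge0// addr_ge0 ?sqr_ge0.
have := getPex (ex_intro _ b0 min0); rewrite -/(least_squares_line s).
set b := least_squares_line s => /(_ b0).
rewrite !sseE b0L b0U expr0n/= addr0 mulr0 addr0 gerDl.
rewrite pmulr_rle0 ?ltr0n// => H.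
have H1 := sqr_ge0 (u - (b.1 + b.2 * L)); have H2 := sqr_ge0 (v - (b.1 + b.2 * U)).
have /eqP : (u - (b.1 + b.2 * L)) ^+ 2 = 0 by lra.
have /eqP : (v - (b.1 + b.2 * U)) ^+ 2 = 0 by lra.
rewrite !sqrf_eq0 => /eqP E2 /eqP E1.
have b2 : b.2 = sl.
  rewrite /sl; apply: (mulIf UL); rewrite divfK//.
  by rewrite mulrBr; move: E1 E2; move: (b.1) (b.2 * L) (b.2 * U) (u) (v) => *; lra.
have b1 : b.1 = u - sl * L by rewrite -b2; move/eqP: E1; rewrite subr_eq0 => /eqP ->; rewrite addrK.
by rewrite b1 b2.
Qed.

End two_point_regression.

Section bootstrap_bound.
Context {R : realType}.
Variables (k : nat) (Y' Y'' : 'I_k -> R).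
Hypothesis k0 : (0 < k)%N.

Let kR : 0 < k%:R :> R. Proof. by rewrite ltr0n. Qed.
Let sk : 0 < Num.sqrt k%:R :> R. Proof. by rewrite sqrtr_gt0. Qed.
Let I0 : (0 < #|'I_k|)%N. Proof. by rewrite card_ord. Qed.

Let sumE (Y : 'I_k -> R) : \sum_i Y i = k%:R * unif_mean Y.
Proof. by rewrite /unif_mean card_ord mulrC divfK// gt_eqF. Qed.

Definition emp_cmoment j (Y : 'I_k -> R) := unif_mean (fun i => `|Y i - unif_mean Y| ^+ j).

Local Notation u := (unif_mean Y').
Local Notation v := (unif_mean Y'').
Local Notation s1 := (emp_cmoment 2 Y').
Local Notation s2 := (emp_cmoment 2 Y'').
Local Notation M1 := (emp_cmoment 3 Y').
Local Notation M2 := (emp_cmoment 3 Y'').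

Lemma bootstrap_probE (E : pred (resampling k * resampling k)) :
  bootstrap_prob E = unif_mean (fun r => (E r)%:R) :> R.
Proof.
rewrite /bootstrap_prob /unif_mean; congr (_ / _).
by rewrite -sum1_card natr_sum big_mkcond; apply: eq_bigr => r _; rewrite unfold_in; case: (E r).
Qed.

(** The bound of [resampled_clt] and [Lambda_le] for the centred samples scaled
by c1 and c2, after division by the standard deviation of the sum. *)
Definition clt_error (c1 c2 kappa : R) : R :=
  let V := c1 ^+ 2 * s1 + c2 ^+ 2 * s2 in
  3 * kappa + 2 / kappa ^+ 3 *
    (((`|c1| ^+ 3 * (M1 / Num.sqrt k%:R) + `|c2| ^+ 3 * (M2 / Num.sqrt k%:R)) / Num.sqrt V ^+ 3
      + 2 * @abs3 R / Num.sqrt k%:R)).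

Lemma cmoment_ge0 j (Y : 'I_k -> R) : 0 <= emp_cmoment j Y.
Proof.
rewrite /emp_cmoment -[leLHS](unif_mean_cst (T := 'I_k) 0)//.
by apply: le_unif_mean => t; exact: exprn_ge0.
Qed.

Lemma resampled_linear_clt c1 c2 thr kappa :
  0 < c1 ^+ 2 * s1 + c2 ^+ 2 * s2 -> 0 < kappa ->
  `|bootstrap_prob (fun r : resampling k * resampling k =>
     c1 * (\sum_i (Y' (r.1 i) - u)) + c2 * (\sum_i (Y'' (r.2 i) - v)) <=
     thr * (Num.sqrt k%:R * Num.sqrt (c1 ^+ 2 * s1 + c2 ^+ 2 * s2))) - Phi thr|
  <= clt_error c1 c2 kappa.
Proof.
set V := c1 ^+ 2 * s1 + _ => V0 kap0.
have sV : 0 < Num.sqrt V by rewrite sqrtr_gt0.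
set w := Num.sqrt k%:R * Num.sqrt V.
have w0 : 0 < w by rewrite mulr_gt0.
have w2 : w ^+ 2 = k%:R * V by rewrite exprMn !sqr_sqrtr// ltW.
pose X i := c1 / w * (Y' i - u); pose Y i := c2 / w * (Y'' i - v).
have e (c : R) (Z : 'I_k -> R) : unif_mean (fun i => c / w * (Z i - unif_mean Z)) = 0.
  by rewrite unif_meanZ unif_meanB unif_mean_cst// subrr mulr0.
have e2 (c : R) (Z : 'I_k -> R) : unif_mean (fun i => (c / w * (Z i - unif_mean Z)) ^+ 2) = (c / w) ^+ 2 * emp_cmoment 2 Z.
  by rewrite -unif_meanZ; congr unif_mean; apply/funext => i; rewrite exprMn -normrX [X in _ = _ * X]ger0_norm ?sqr_ge0.
have e3 (c : R) (Z : 'I_k -> R) : unif_mean (fun i => `|c / w * (Z i - unif_mean Z)| ^+ 3) = (`|c| / w) ^+ 3 * emp_cmoment 3 Z.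
  by rewrite -unif_meanZ; congr unif_mean; apply/funext => i; rewrite !normrM exprMn normfV (gtr0_norm w0).
set t1 := (c1 / w) ^+ 2 * s1; set t2 := (c2 / w) ^+ 2 * s2.
have t10 : 0 <= t1 by rewrite mulr_ge0 ?sqr_ge0 ?cmoment_ge0.
have t20 : 0 <= t2 by rewrite mulr_ge0 ?sqr_ge0 ?cmoment_ge0.
have V1 : k%:R * t1 + k%:R * t2 = 1.
  rewrite /t1 /t2 !exprMn !exprVn w2.
  transitivity (V / V); last by rewrite divff ?gt_eqF.
  rewrite /V; field; rewrite gt_eqF//= gt_eqF//.
have H := @resampled_clt _ _ _ X Y k t1 t2 I0 I0 t10 t20 (e c1 Y') (e2 c1 Y') (e c2 Y'') (e2 c2 Y'') V1 thr kappa kap0.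
have HL := @Lambda_le _ _ _ X Y k t1 t2 t10 t20 V1 k0.
rewrite bootstrap_probE.
have -> : (fun r : resampling k * resampling k => (c1 * (\sum_i (Y' (r.1 i) - u)) + c2 * (\sum_i (Y'' (r.2 i) - v)) <=
     thr * w)%R%:R : R) = (fun r => (\sum_i X (r.1 i) + \sum_i Y (r.2 i) <= thr)%R%:R).
  apply/funext => r; congr (nat_of_bool _)%:R.
  rewrite /X /Y -!mulr_sumr -ler_pdivrMr//; congr (_ <= _); ring.
rewrite (le_trans H)// /clt_error lerD2l ler_wpM2l//.
  by rewrite divr_ge0 ?exprn_ge0// ltW.
rewrite (le_trans HL)// lerD2r /X /Y !e3 le_eqVlt; apply/orP; left; apply/eqP.
have w3 : w ^+ 3 = k%:R * Num.sqrt k%:R * Num.sqrt V ^+ 3.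
  by rewrite /w -{2}[k%:R](sqr_sqrtr (ltW kR)); ring.
rewrite !exprMn !exprVn w3 -/V; move: (Num.sqrt V) sV (Num.sqrt k%:R) sk (k%:R) kR (`|c1|) (`|c2|) M1 M2 => a a0 b b0 c c0 *.
by field; rewrite !gt_eqF ?sqrtr_gt0.
Qed.

Variables (theta L delta : R) (n : nat).
Hypotheses (delta0 : 0 < delta) (n0 : (0 < n)%N).
Let rho := (u - theta) / delta.
Let beta := (v - theta) / delta.
Let D := beta - rho.
Let ee := (Num.sqrt n%:R * delta)^-1.
Hypothesis D0 : 0 < D.
Hypothesis s12 : 0 < s1 + s2.

Let est (r : resampling k * resampling k) :=
  dtilde2 theta L (L + 2 * delta) (fun i => Y' (r.1 i)) (fun i => Y'' (r.2 i)).
Let est0 := dtilde2 theta L (L + 2 * delta) Y' Y''.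

Let sn : 0 < Num.sqrt n%:R :> R. Proof. by rewrite sqrtr_gt0 ltr0n. Qed.

(** The coefficients of the linear inequality of [bootstrap_event], and its
threshold in units of the standard deviation of the left-hand side. When rho
tends to - a and beta to a, both coefficients tend to - 2 a, because t D ee
vanishes in the limit. *)
Definition lin_c1 t := - (2 * beta) + t * D * ee.
Definition lin_c2 t := 2 * rho - t * D * ee.
Definition lin_thr t := t * D ^+ 2 * (Num.sqrt k%:R / Num.sqrt n%:R) /
  Num.sqrt (lin_c1 t ^+ 2 * s1 + lin_c2 t ^+ 2 * s2).

Lemma dtilde2_two_points (Z' Z'' : 'I_k -> R) : unif_mean Z' != unif_mean Z'' ->
  dtilde2 theta L (L + 2 * delta) Z' Z'' =
  L - 2 * delta * (unif_mean Z' - theta) / (unif_mean Z'' - unif_mean Z').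
Proof.
move=> zz; rewrite dtilde2E//; last by rewrite -subr_eq0 opprD addrA subrr sub0r oppr_eq0 mulf_neq0// gt_eqF.
have d0 : delta != 0 by rewrite gt_eqF.
have zz' : unif_mean Z'' - unif_mean Z' != 0 by rewrite subr_eq0 eq_sym.
have -> : L + 2 * delta - L = 2 * delta by ring.
move: (unif_mean Z') (unif_mean Z'') zz' => a b ab; by field; rewrite d0 ab.
Qed.

(** Each estimate is L minus 2 delta times the first mean minus theta over the
difference of the two means. Clearing the two positive denominators leaves an
inequality that is affine in the resampled means, so that the nonlinear ratio
is compared with a number without any linearisation error. *)
Lemma bootstrap_event t (r : resampling k * resampling k) :
  unif_mean (fun i => Y' (r.1 i)) < unif_mean (fun i => Y'' (r.2 i)) ->
  (Num.sqrt n%:R * (est r - est0) <= t) =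
  (lin_c1 t * (\sum_i (Y' (r.1 i) - u)) + lin_c2 t * (\sum_i (Y'' (r.2 i) - v)) <=
    t * D ^+ 2 * k%:R / Num.sqrt n%:R).
Proof.
move=> us_vs.
set us := unif_mean _ in us_vs; set vs := unif_mean _ in us_vs.
have uv : u < v.
  have : 0 < D * delta by rewrite mulr_gt0.
  by rewrite /D /beta /rho -mulrBl divfK ?gt_eqF//; lra.
rewrite /est /est0 !dtilde2_two_points ?lt_eqF// -/us -/vs.
have -> : \sum_i (Y' (r.1 i) - u) = k%:R * (us - u).
  by rewrite sumrB sumE sumr_const card_ord -[u *+ k]mulr_natl -mulrBr.
have -> : \sum_i (Y'' (r.2 i) - v) = k%:R * (vs - v).
  by rewrite sumrB sumE sumr_const card_ord -[v *+ k]mulr_natl -mulrBr.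
rewrite -subr_le0 -[in RHS]subr_le0.
have n1 : Num.sqrt n%:R != 0 :> R by rewrite gt_eqF.
have d1 : delta != 0 by rewrite gt_eqF.
have k1 : k%:R != 0 :> R by rewrite gt_eqF.
have vu : v - u != 0 by rewrite subr_eq0 gt_eqF.
have vus : vs - us != 0 by rewrite subr_eq0 gt_eqF.
have pos : 0 < k%:R * (v - u) * (vs - us) / (delta ^+ 2 * Num.sqrt n%:R).
  by rewrite divr_gt0 ?mulr_gt0 ?exprn_gt0 ?subr_gt0.
rewrite -(pmulr_rle0 _ pos); congr (_ <= 0).
rewrite /lin_c1 /lin_c2 /D /beta /rho /ee; field.
by rewrite n1 d1 vu vus.
Qed.

(** The event differs from its linear form only when the resampled means are in
the wrong order; this is again a linear event, with coefficients -1 and 1, and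
the last two terms bound its probability. *)
Lemma bootstrap_cdf_bound t kappa : 0 < kappa ->
  0 < lin_c1 t ^+ 2 * s1 + lin_c2 t ^+ 2 * s2 ->
  `|bootstrap_prob (fun r => Num.sqrt n%:R * (est r - est0) <= t) - Phi (lin_thr t)| <=
  clt_error (lin_c1 t) (lin_c2 t) kappa + clt_error (-1) 1 kappa
  + Phi (- (Num.sqrt k%:R * delta * D / Num.sqrt (s1 + s2))).
Proof.
move=> kap0 V0.
have H1 := resampled_linear_clt (lin_thr t) V0 kap0.
have V0' : 0 < (-1) ^+ 2 * s1 + 1 ^+ 2 * s2 by rewrite sqrrN expr1n !mul1r.
have H2 := resampled_linear_clt (- (Num.sqrt k%:R * delta * D / Num.sqrt (s1 + s2))) V0' kap0.
have e12 : (-1) ^+ 2 * s1 + 1 ^+ 2 * s2 = s1 + s2 by rewrite sqrrN expr1n !mul1r.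
rewrite e12 in H2.
rewrite bootstrap_probE in H1; rewrite bootstrap_probE in H2; rewrite bootstrap_probE.
set P1 := unif_mean _ in H1; set P2 := unif_mean _ in H2; set P0 := unif_mean _.
have sV : 0 < Num.sqrt (lin_c1 t ^+ 2 * s1 + lin_c2 t ^+ 2 * s2) by rewrite sqrtr_gt0.
have ss : 0 < Num.sqrt (s1 + s2) by rewrite sqrtr_gt0.
have thrE : lin_thr t * (Num.sqrt k%:R * Num.sqrt (lin_c1 t ^+ 2 * s1 + lin_c2 t ^+ 2 * s2)) = t * D ^+ 2 * k%:R / Num.sqrt n%:R.
  rewrite /lin_thr -[in RHS](sqr_sqrtr (ltW kR)).
  by field; rewrite !gt_eqF.
have thrE2 : - (Num.sqrt k%:R * delta * D / Num.sqrt (s1 + s2)) * (Num.sqrt k%:R * Num.sqrt (s1 + s2)) = - (k%:R * (delta * D)).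
  rewrite -[in RHS](sqr_sqrtr (ltW kR)).
  by field; rewrite !gt_eqF.
have dD : delta * D = v - u by rewrite /D /beta /rho; field; rewrite gt_eqF.
have P01 : `|P0 - P1| <= P2.
  rewrite -unif_meanB (le_trans (ler_norm_unif_mean _))//; apply: le_unif_mean => r.
  rewrite thrE thrE2 dD.
  have [us_vs|vs_us] := ltP (unif_mean (fun i => Y' (r.1 i))) (unif_mean (fun i => Y'' (r.2 i))).
    by rewrite bootstrap_event// subrr normr0.
  have -> : -1 * (\sum_i (Y' (r.1 i) - u)) + 1 * (\sum_i (Y'' (r.2 i) - v)) <= - (k%:R * (v - u)).
    rewrite !sumrB !sumr_const card_ord -[u *+ k]mulr_natl -[v *+ k]mulr_natl.
    move: vs_us; rewrite {1 2}/unif_mean card_ord ler_pM2r ?invr_gt0//.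
    by move: (\sum_i Y' _) (\sum_i Y'' _) (k%:R) u v => *; lra.
  by case: (_ <= t); case: (_ <= _ / _); rewrite /= ?subrr ?normr0 ?subr0 ?sub0r ?normrN ?normr1.
move: P01 H1 H2; rewrite !ler_norml => /andP[? ?] /andP[? ?] /andP[? ?].
by apply/andP; split; lra.
Qed.

End bootstrap_bound.

(** * The limit of the bootstrap distribution function *)

Section Phi_tails.
Context {R : realType}.
Implicit Types x : R.

Let chebyshev (h : R -> R) x : 0 < x -> measurable_fun setT h ->
  (forall z, `|h z| <= 1) -> (forall z, h z <= (x ^+ 2)^-1 * z ^+ 2) ->
  gauss_mean h <= (x ^+ 2)^-1.
Proof.
move=> x0 mh h1 hx.
have i2 := @integrableX_phi R 2 isT.
have -> : (x ^+ 2)^-1 = \int[lebesgue_measure]_z ((x ^+ 2)^-1 * (z ^+ 2 * normal_pdf 0 1 z)).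
  rewrite RintegralZl//.
  by rewrite -[X in _ = _ * X]/(gauss_mean (fun z => z ^+ 2)) gauss_mean_sqr mulr1.
apply: le_Rintegral => //.
- exact: integrable_phiM mh h1.
- exact: (integrableZl measurableT _ i2).
- by move=> z _; rewrite mulrA ler_wpM2r ?phi_ge0.
Qed.

Lemma Phi_tail x : 0 < x -> Phi (- x) <= (x ^+ 2)^-1.
Proof.
move=> x0; rewrite PhiE; apply: chebyshev => //; [exact: measurable_ind|exact: ind_norm|].
move=> z; have [zx|_] := leP z (- x); last by rewrite mulr_ge0 ?sqr_ge0// invr_ge0 sqr_ge0.
rewrite ler_pdivlMl ?exprn_gt0// mulr1 -[leRHS]sqrrN; apply: lerXn2r; rewrite ?nnegrE; lra.
Qed.

Lemma Phi_tail_right x : 0 < x -> 1 - Phi x <= (x ^+ 2)^-1.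
Proof.
move=> x0; have mi := measurable_ind x.
have -> : 1 - Phi x = gauss_mean (fun z => 1 - (z <= x)%R%:R).
  have i1 := integrable_phiM mi (ind_norm x).
  have i0 := @integrable_normal_pdf R 0 1.
  rewrite PhiE -[X in X - _](gauss_mean_cst 1) /gauss_mean.
  under [in RHS]eq_Rintegral do rewrite mulrBl mul1r.
  under eq_Rintegral do rewrite mul1r.
  by rewrite RintegralB.
apply: chebyshev => //; first exact: measurable_funB.
  by move=> z; case: (z <= x); rewrite ?subrr ?normr0 ?subr0 ?normr1.
move=> z; have [_|zx] := leP z x; first by rewrite subrr mulr_ge0 ?sqr_ge0// invr_ge0 sqr_ge0.
rewrite subr0 ler_pdivlMl ?exprn_gt0// mulr1; apply: lerXn2r; rewrite ?nnegrE; lra.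
Qed.

Lemma Phi_dist x y : `|Phi x - Phi y| <= `|x - y|.
Proof.
wlog xy : x y / x <= y.
  by move=> H; have [/H//|/ltW/H] := leP x y; rewrite distrC [X in _ <= X -> _]distrC.
have /andP[H1 H2] := Phi_lip xy.
by rewrite distrC [leRHS]distrC !ger0_norm ?subr_ge0//; lra.
Qed.

End Phi_tails.

Section polya.
Context {R : realType} (S : Type) (F : set_system S) {FF : Filter F}.

(** Between neighbours of a finite grid both functions are monotone and the
limit moves by at most e / 3; to the left and to the right of the grid, which
covers [-A, A], the limit is within e / 3 of 0 or 1. *)
Lemma polya (G : S -> R -> R) (c : R) : 0 < c ->
  (forall s t, 0 <= G s t <= 1) ->
  (forall s t t', t <= t' -> G s t <= G s t') ->
  (forall t, G s t @[s --> F] --> Phi (c * t)) ->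
  forall eps, 0 < eps -> \forall s \near F, forall t, `|G s t - Phi (c * t)| <= eps.
Proof.
move=> c0 G01 Gm Gc e e0.
pose eps := e / 3.
have eps0 : 0 < eps by rewrite divr_gt0.
(* As c A = 1 / eps + 1, the tails beyond c A are at most eps. *)
pose A := (c * eps)^-1 + c^-1.
pose h := eps / c.
have h0 : 0 < h by rewrite divr_gt0.
have A0 : 0 < A by rewrite addr_gt0// invr_gt0// mulr_gt0.
pose N := (Num.truncn (2 * A / h)).+1.
pose g (i : 'I_N.+1) := - A + (i : nat)%:R * h.
have nr : \forall s \near F, forall i : 'I_N.+1, `|G s (g i) - Phi (c * g i)| <= eps.
  apply: filter_forall => i.
  have /cvgrPdist_le /(_ eps eps0) := Gc (g i).
  by apply: filterS => s; rewrite distrC.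
have cA : 1 + eps <= eps * (c * A).
  have -> : eps * (c * A) = 1 + eps; last by [].
  by rewrite /A; field; rewrite !gt_eqF.
have tail : ((c * A) ^+ 2)^-1 <= eps.
  have cA0 : 0 < c * A by rewrite mulr_gt0.
  have cA1 : 1 <= c * A.
    rewrite /A mulrDr divff ?gt_eqF// lerDr mulr_ge0// ?invr_ge0 ?ltW// mulr_gt0//.
  rewrite -[leLHS]mul1r ler_pdivrMr ?exprn_gt0//.
  have H : eps * (c * A) <= eps * (c * A) * (c * A).
    by rewrite ler_peMr// ltW// mulr_gt0.
  have -> : eps * (c * A) ^+ 2 = eps * (c * A) * (c * A) by ring.
  move: H cA eps0; move: (eps * (c * A)) (_ * (c * A)) => *; lra.
have tl : Phi (- (c * A)) <= eps by apply: le_trans tail; apply: Phi_tail; rewrite mulr_gt0.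
have tr : 1 - Phi (c * A) <= eps by apply: le_trans tail; apply: Phi_tail_right; rewrite mulr_gt0.
have NhA : A <= g ord_max.
  have : 2 * A / h < N%:R by rewrite /N; exact: truncnS_gt.
  by rewrite ltr_pdivrMr// /g/=; lra.
apply: filterS nr => s nr t.
have /andP[G0 G1] := G01 s t.
have P0 := Phi_ge0 (c * t); have P1 := Phi_le1 (c * t).
have mono x y : x <= y -> Phi (c * x) <= Phi (c * y).
  by move=> xy; have /andP[] := Phi_lip (ler_wpM2l (ltW c0) xy).
have [tA|At] := leP t (- A).
  have g0 : g ord0 = - A by rewrite /g/= mul0r addr0.
  have := nr ord0; rewrite g0 ler_norml => /andP[_ H].
  have := mono _ _ tA; have := Gm s _ _ tA; move: tl; rewrite -mulrN => H1 H2 H3.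
  by rewrite ler_norml; move: H; rewrite /eps in H1 * => H; apply/andP; split; lra.
have [tA|At'] := leP (g ord_max) t.
  have := nr ord_max; rewrite ler_norml => /andP[H _].
  have := mono _ _ tA; have := Gm s _ _ tA; have := mono _ _ NhA => H1 H2 H3.
  by rewrite ler_norml; rewrite /eps in tr H; apply/andP; split; lra.
pose i := Num.truncn ((t + A) / h).
have tA0 : 0 <= (t + A) / h by rewrite divr_ge0 ?ltW//; lra.
have /andP[i1 i2] := truncn_itv tA0.
have iN : (i < N)%N.
  rewrite -(ltr_nat R); apply: le_lt_trans i1 _.
  by rewrite ltr_pdivrMr//; move: At'; rewrite /g/=; lra.
have iN1 : (i.+1 < N.+1)%N by [].
have iN0 : (i < N.+1)%N by rewrite ltnW.
have lo : g (Ordinal iN0) <= t.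
  by move: i1; rewrite ler_pdivlMr// /g/=; lra.
have hi : t <= g (Ordinal iN1).
  by move: i2; rewrite ltr_pdivrMr// /g/=; lra.
have gap : g (Ordinal iN1) = g (Ordinal iN0) + h by rewrite /g/= -natr1; ring.
have := nr (Ordinal iN0); have := nr (Ordinal iN1); rewrite !ler_norml => /andP[_ U] /andP[Lw _].
have m1 := Gm s _ _ lo; have m2 := Gm s _ _ hi.
have /andP[_ l1] := Phi_lip (ler_wpM2l (ltW c0) hi).
have /andP[_ l2] := Phi_lip (ler_wpM2l (ltW c0) lo).
have ch : c * h = eps by rewrite /h mulrC divfK// gt_eqF.
have l1' : Phi (c * g (Ordinal iN1)) <= Phi (c * t) + eps.
  apply: le_trans l1 _; rewrite lerD2l -mulrBr -ch ler_wpM2l ?(ltW c0)//; move: lo hi gap; move: (g (Ordinal iN1)) (g (Ordinal iN0)) (h) => *; lra.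
have l2' : Phi (c * t) <= Phi (c * g (Ordinal iN0)) + eps.
  apply: le_trans l2 _; rewrite lerD2l -mulrBr -ch ler_wpM2l ?(ltW c0)//; move: lo hi gap; move: (g (Ordinal iN1)) (g (Ordinal iN0)) (h) => *; lra.
move: U Lw m1 m2 l1' l2'; rewrite /eps.
move: (G _ _) (G _ _) (G _ _) (Phi _) (Phi _) (Phi _) => *; apply/andP; split; lra.
Qed.

End polya.

Section bootstrap_limit.
Context {R : realType} (S : Type) (F : set_system S) {FF : Filter F}.
Variables (theta a r0 sigma : R) (k n : S -> nat) (Y' Y'' : forall s, 'I_(k s) -> R)
  (L delta : S -> R).
Hypotheses (a0 : 0 < a) (r00 : 0 < r0) (sigma0 : 0 < sigma).

Let rho s := (unif_mean (@Y' s) - theta) / delta s.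
Let beta s := (unif_mean (@Y'' s) - theta) / delta s.
Let s1 s := emp_cmoment 2 (@Y' s).
Let s2 s := emp_cmoment 2 (@Y'' s).
Let M1 s := emp_cmoment 3 (@Y' s).
Let M2 s := emp_cmoment 3 (@Y'' s).
Let isk s := (Num.sqrt (k s)%:R : R)^-1.

Hypotheses (k0 : \forall s \near F, (0 < k s)%N) (n0 : \forall s \near F, (0 < n s)%N)
  (d0 : \forall s \near F, 0 < delta s).
Hypotheses (rho_cvg : rho s @[s --> F] --> - a) (beta_cvg : beta s @[s --> F] --> a).
Hypotheses (s1_cvg : s1 s @[s --> F] --> sigma ^+ 2) (s2_cvg : s2 s @[s --> F] --> sigma ^+ 2).
Hypotheses (M1_cvg : M1 s * isk s @[s --> F] --> (0 : R)) (M2_cvg : M2 s * isk s @[s --> F] --> (0 : R)).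
Hypotheses (isk_cvg : isk s @[s --> F] --> (0 : R)).
Hypotheses (ee_cvg : (Num.sqrt (n s)%:R * delta s)^-1 @[s --> F] --> (0 : R)).
Hypotheses (kn_cvg : Num.sqrt (k s)%:R / Num.sqrt (n s)%:R @[s --> F] --> r0).

Let D s := beta s - rho s.
Let D_cvg : D s @[s --> F] --> 2 * a.
Proof.
have -> : 2 * a = a - - a by ring.
exact: cvgB.
Qed.

Let sigma2 : 0 < sigma ^+ 2. Proof. by rewrite exprn_gt0. Qed.

Let err (c1 c2 V kap : S -> R) s : R := 3 * kap s + 2 / kap s ^+ 3 *
  ((`|c1 s| ^+ 3 * (M1 s * isk s) + `|c2 s| ^+ 3 * (M2 s * isk s)) / Num.sqrt (V s) ^+ 3
      + 2 * @abs3 R * isk s).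

Let err_cvg (c1 c2 V : S -> R) (l1 l2 lV kap : R) : 0 < kap -> 0 < lV ->
  c1 s @[s --> F] --> l1 -> c2 s @[s --> F] --> l2 -> V s @[s --> F] --> lV ->
  err c1 c2 V (fun=> kap) s @[s --> F] --> 3 * kap.
Proof.
move=> kap0 lV0 C1 C2 CV.
have sq : Num.sqrt (V s) @[s --> F] --> Num.sqrt lV.
  by apply: (cvg_comp _ _ CV); exact: sqrt_continuous.
have cube (f : S -> R) (l : R) : f s @[s --> F] --> l -> f s ^+ 3 @[s --> F] --> l ^+ 3.
  by move=> H; apply: (cvg_comp _ (fun x => x ^+ 3) H); exact: exprn_continuous.
have : err c1 c2 V (fun=> kap) s @[s --> F] --> 3 * kap + 2 / kap ^+ 3 *
   ((`|l1| ^+ 3 * 0 + `|l2| ^+ 3 * 0) / Num.sqrt lV ^+ 3 + 2 * @abs3 R * 0).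
  apply: cvgD; first exact: cvg_cst.
  apply: cvgM; first exact: cvg_cst.
  apply: cvgD; last by apply: cvgM => //; exact: cvg_cst.
  apply: cvgM; last first.
    apply: cvgV; last exact: cube.
    by rewrite expf_neq0// gt_eqF// sqrtr_gt0.
  by apply: cvgD; apply: cvgM => //; apply: cube; exact: cvg_norm.
by rewrite !(mulr0, addr0, mul0r).
Qed.

(** For a fixed kappa the bound of [bootstrap_cdf_bound] tends to 6 kappa: the
third moments are negligible against sqrt k, and the resampled means are in the
right order because sqrt k delta D tends to infinity. The thresholds [lin_thr]
converge because the empirical variances and the rescaled means do. *)
Lemma bootstrap_cvg t :
  bootstrap_prob (fun r : resampling (k s) * resampling (k s) =>
    Num.sqrt (n s)%:R * (dtilde2 theta (L s) (L s + 2 * delta s) (fun i => @Y' s (r.1 i)) (fun i => @Y'' s (r.2 i))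
       - dtilde2 theta (L s) (L s + 2 * delta s) (@Y' s) (@Y'' s)) <= t) @[s --> F]
  --> Phi (a * r0 * Num.sqrt 2 / sigma * t).
Proof.
pose ee s := (Num.sqrt (n s)%:R * delta s)^-1.
pose c1 s := - (2 * beta s) + t * D s * ee s.
pose c2 s := 2 * rho s - t * D s * ee s.
pose V s := c1 s ^+ 2 * s1 s + c2 s ^+ 2 * s2 s.
have tDe : t * D s * ee s @[s --> F] --> (0 : R).
  rewrite -[X in _ --> X](mulr0 (t * (2 * a))); apply: cvgM => //.
  by apply: cvgM => //; exact: cvg_cst.
have c1_cvg : c1 s @[s --> F] --> - (2 * a).
  rewrite -[X in _ --> X]addr0; apply: cvgD => //; apply: cvgN; apply: cvgM => //; exact: cvg_cst.
have c2_cvg : c2 s @[s --> F] --> - (2 * a).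
  rewrite -[X in _ --> X]subr0 -mulrN; apply: cvgB => //; apply: cvgM => //; exact: cvg_cst.
have sqr (f : S -> R) (l : R) : f s @[s --> F] --> l -> f s ^+ 2 @[s --> F] --> l ^+ 2.
  by move=> H; apply: (cvg_comp _ (fun x => x ^+ 2) H); exact: exprn_continuous.
have V_cvg : V s @[s --> F] --> 2 * (2 * a * sigma) ^+ 2.
  have -> : 2 * (2 * a * sigma) ^+ 2 = (- (2 * a)) ^+ 2 * sigma ^+ 2 + (- (2 * a)) ^+ 2 * sigma ^+ 2 by ring.
  by apply: cvgD; apply: cvgM => //; exact: sqr.
have lV0 : 0 < 2 * (2 * a * sigma) ^+ 2 by rewrite !(mulr_gt0, exprn_gt0).
have W_cvg : s1 s + s2 s @[s --> F] --> 2 * sigma ^+ 2.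
  by rewrite [2 * _]mulr_natl mulr2n; exact: cvgD.
have lW0 : 0 < 2 * sigma ^+ 2 by rewrite mulr_gt0.
have sqV : Num.sqrt (V s) @[s --> F] --> Num.sqrt 2 * (2 * a * sigma).
  have -> : Num.sqrt 2 * (2 * a * sigma) = Num.sqrt (2 * (2 * a * sigma) ^+ 2).
    by rewrite sqrtrM// sqrtr_sqr gtr0_norm// !mulr_gt0.
  by apply: (cvg_comp _ _ V_cvg); exact: sqrt_continuous.
have sqW : Num.sqrt (s1 s + s2 s) @[s --> F] --> Num.sqrt (2 * sigma ^+ 2).
  by apply: (cvg_comp _ _ W_cvg); exact: sqrt_continuous.
pose thr s := t * D s ^+ 2 * (Num.sqrt (k s)%:R / Num.sqrt (n s)%:R) / Num.sqrt (V s).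
have s20 : 0 < Num.sqrt 2 :> R by rewrite sqrtr_gt0.
have thr_cvg : thr s @[s --> F] --> a * r0 * Num.sqrt 2 / sigma * t.
  have -> : a * r0 * Num.sqrt 2 / sigma * t = t * (2 * a) ^+ 2 * r0 / (Num.sqrt 2 * (2 * a * sigma)).
    have e2 : Num.sqrt 2 ^+ 2 = 2 :> R by rewrite sqr_sqrtr.
    transitivity (t * a * r0 * Num.sqrt 2 ^+ 2 / (Num.sqrt 2 * sigma)).
      by field; rewrite !gt_eqF.
    by rewrite e2; field; rewrite !gt_eqF.
  apply: cvgM; last by apply: cvgV => //; rewrite gt_eqF// !mulr_gt0.
  by apply: cvgM => //; apply: cvgM; [exact: cvg_cst|exact: sqr].
pose q s := Num.sqrt (k s)%:R * delta s * D s / Num.sqrt (s1 s + s2 s).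
(* The inverse of q, written with convergent factors. *)
pose iq s := ee s * Num.sqrt (s1 s + s2 s) / (Num.sqrt (k s)%:R / Num.sqrt (n s)%:R * D s).
have iq_cvg : iq s ^+ 2 @[s --> F] --> (0 : R).
  have : iq s @[s --> F] --> 0 * Num.sqrt (2 * sigma ^+ 2) / (r0 * (2 * a)).
    apply: cvgM; first exact: cvgM.
    apply: cvgV; last exact: cvgM.
    by rewrite gt_eqF// !mulr_gt0.
  by move=> /sqr; rewrite !mul0r expr0n.
apply/cvgrPdist_le => eps eps0.
pose kap := eps / 16.
have kap0 : 0 < kap by rewrite divr_gt0.
have E1 := err_cvg kap0 lV0 c1_cvg c2_cvg V_cvg.
have E2 : err (fun=> -1) (fun=> 1) (fun s => s1 s + s2 s) (fun=> kap) s @[s --> F] --> 3 * kap.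
  by apply: (err_cvg kap0 lW0 _ _ W_cvg); exact: cvg_cst.
near=> s.
have k0s : (0 < k s)%N by near: s.
have n0s : (0 < n s)%N by near: s.
have d0s : 0 < delta s by near: s.
have D0s : 0 < D s by near: s; apply: (cvgr_gt _ D_cvg); rewrite mulr_gt0.
have V0s : 0 < V s by near: s; exact: (cvgr_gt _ V_cvg).
have W0s : 0 < s1 s + s2 s by near: s; exact: (cvgr_gt _ W_cvg).
have E1s : err c1 c2 V (fun=> kap) s <= 4 * kap.
  near: s; apply: (cvgr_le _ E1); lra.
have E2s : err (fun=> -1) (fun=> 1) (fun s => s1 s + s2 s) (fun=> kap) s <= 4 * kap.
  near: s; apply: (cvgr_le _ E2); lra.
have iqs : iq s ^+ 2 <= kap by near: s; exact: (cvgr_le _ iq_cvg).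
have thrs : `|a * r0 * Num.sqrt 2 / sigma * t - thr s| <= kap.
  by near: s; move/cvgrPdist_le : thr_cvg; exact.
have sk : 0 < Num.sqrt (k s)%:R :> R by rewrite sqrtr_gt0 ltr0n.
have sn : 0 < Num.sqrt (n s)%:R :> R by rewrite sqrtr_gt0 ltr0n.
have sW : 0 < Num.sqrt (s1 s + s2 s) by rewrite sqrtr_gt0.
have q0 : 0 < q s by rewrite /q divr_gt0// !mulr_gt0.
have qE : (q s ^+ 2)^-1 = iq s ^+ 2.
  by rewrite -exprVn /q /iq /ee; congr (_ ^+ 2); field; rewrite !gt_eqF.
have Pq : Phi (- q s) <= kap by rewrite (le_trans (Phi_tail q0))// qE.
have := @bootstrap_cdf_bound R (k s) (@Y' s) (@Y'' s) k0s theta (L s) (delta s) (n s) d0s n0s D0s W0s t kap kap0 V0s.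
set P0 := bootstrap_prob _.
have -> : clt_error (@Y' s) (@Y'' s) (lin_c1 (@Y' s) (@Y'' s) theta (delta s) (n s) t)
    (lin_c2 (@Y' s) (@Y'' s) theta (delta s) (n s) t) kap = err c1 c2 V (fun=> kap) s by [].
have -> : clt_error (@Y' s) (@Y'' s) (-1) 1 kap =
   err (fun=> -1) (fun=> 1) (fun s => s1 s + s2 s) (fun=> kap) s.
  by rewrite /clt_error /err sqrrN expr1n !mul1r.
rewrite -/(q s) -/(thr s) => H.
have H2 := le_trans (Phi_dist _ _) thrs.
rewrite -/P0; have -> : forall x y : R, x - y = (x - Phi (thr s)) - (y - Phi (thr s)) by move=> *; ring.
rewrite (le_trans (ler_normB _ _))//.
apply: (le_trans (lerD H2 H)).
have e16 : 16 * kap = eps by rewrite /kap; field.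
have arith (x1 x2 x3 : R) : x1 <= 4 * kap -> x2 <= 4 * kap -> x3 <= kap ->
  kap + (x1 + x2 + x3) <= eps by lra.
exact: arith.
Unshelve. all: by end_near. Qed.

End bootstrap_limit.

(** * Isotonic least squares *)

Section isotonic_fit.
Context {R : realType}.
Implicit Types (v w Y : nat -> R).

Let continuous_sum (T : topologicalType) (I : Type) (r : seq I) (f : I -> T -> R) :
  (forall i, continuous (f i)) -> continuous (fun x => \sum_(i <- r) f i x).
Proof.
move=> cf; elim: r => [|i r IH].
  have -> : (fun x => \sum_(i <- [::]) f i x) = cst 0 by apply/funext => x; rewrite big_nil.
  exact: cst_continuous.
have -> : (fun x => \sum_(i <- i :: r) f i x) = (fun x => f i x + \sum_(i <- r) f i x).
  by apply/funext => x; rewrite big_cons.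
by move=> x; apply: cvgD; [exact: cf|exact: IH].
Qed.

(** Monotone sequences in a large box form a compact set, on which the residual
sum of squares attains its minimum; a monotone sequence outside the box does
worse than the zero sequence. *)
Lemma isotonic_fit_exists m Y : exists v, is_isotonic_fit m Y v.
Proof.
case: m => [|m]; first by exists (fun=> 0); split => [i j|w _]; rewrite ?ltn0 ?andbF// !big_ord0.
pose S := \sum_(i < m.+1) Y i ^+ 2.
(* |Y i| and |Y i - w i| are at most S + 1 as soon as w does no worse than 0. *)
pose B := 2 * S + 2.
have S0 : 0 <= S by apply: sumr_ge0 => i _; exact: sqr_ge0.
pose box := [set M : 'rV[R]_m.+1 | forall i, (`[- B, B] : set R) (M ord0 i)].
have cbox : compact box.
  by apply: (@rV_compact R m.+1 (fun=> `[- B, B])) => i; exact: segment_compact.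
pose A := box `&` \bigcap_(ij in [set ij : 'I_m.+1 * 'I_m.+1 | (ij.1 <= ij.2)%N])
  [set M : 'rV[R]_m.+1 | M ord0 ij.1 <= M ord0 ij.2].
have coordc i : continuous (fun M : 'rV[R]_m.+1 => M ord0 i : R).
  exact: (@coord_continuous R 1 m.+1 ord0 i).
have cA : compact A.
  rewrite /A; apply: compact_closedI => //.
  apply: closed_bigI => ij _.
  rewrite [X in closed X](_ : _ = (fun M : 'rV[R]_m.+1 => M ord0 ij.2 - M ord0 ij.1) @^-1` [set y | 0 <= y]); last first.
    by apply/seteqP; split => M /=; rewrite subr_ge0.
  apply: closed_comp; last exact: closed_ge.
  by move=> M _; exact: (continuousB (@coordc ij.2 M) (@coordc ij.1 M)).
pose F (M : 'rV[R]_m.+1) := \sum_(i < m.+1) (Y i - M ord0 i) ^+ 2.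
have cF : continuous F.
  apply: continuous_sum => i M.
  apply: (@continuous_comp _ _ _ (fun M : 'rV[R]_m.+1 => Y i - M ord0 i) (fun x : R => x ^+ 2)); last exact: exprn_continuous.
  exact: (continuousB (@cst_continuous _ _ (Y i) M) (@coordc i M)).
have A0 : A 0.
  split=> [i|ij _] /=; last by rewrite !mxE.
  by rewrite mxE in_itv/=; apply/andP; split; rewrite /B; lra.
have [M MA Mmin] : exists2 c, c \in A & forall t, t \in A -> F c <= F t.
  by apply: compact_EVT_min => //; [exists 0|exact: continuous_subspaceT].
have {MA} [_ Mmon] : A M by rewrite inE in MA.
pose v i := M ord0 (inord i).
have Fv : \sum_(i < m.+1) (Y i - v i) ^+ 2 = F M.
  by apply: eq_bigr => i _; rewrite /v inord_val.
exists v; split.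
  move=> i j /andP[ij jm]; apply: (Mmon (inord i, inord j)) => /=.
  by rewrite !inordK//; exact: leq_ltn_trans jm.
move=> w wmon; rewrite Fv.
have F0 : F 0 = S by apply: eq_bigr => i _; rewrite mxE subr0.
have [Sw|wS] := leP S (\sum_(i < m.+1) (Y i - w i) ^+ 2).
  by apply: le_trans Sw; rewrite -F0; apply: Mmin; rewrite inE.
pose W : 'rV[R]_m.+1 := \row_i w i.
have -> : \sum_(i < m.+1) (Y i - w i) ^+ 2 = F W by apply: eq_bigr => i _; rewrite mxE.
apply: Mmin; rewrite inE; split => [i|[i j] /= ij]; last by rewrite !mxE; apply: wmon; rewrite ij/=.
have sq (x : R) : x ^+ 2 <= S -> `|x| <= S + 1.
  move=> xS; rewrite -ler_sqr ?nnegrE ?normr_ge0; [|lra..].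
  rewrite real_normK ?num_real//; apply: (le_trans xS).
  have -> : (S + 1) ^+ 2 = S ^+ 2 + 2 * S + 1 by ring.
  by have := sqr_ge0 S; lra.
have H1 : `|Y i| <= S + 1.
  by apply: sq; rewrite /S (bigD1 i)//= lerDl sumr_ge0// => j _; exact: sqr_ge0.
have H2 : `|Y i - w i| <= S + 1.
  apply: sq; apply: le_trans (ltW wS); rewrite [leRHS](bigD1 i)//= lerDl sumr_ge0// => j _; exact: sqr_ge0.
rewrite /= mxE in_itv/=; move: H1 H2; rewrite !ler_norml /B => /andP[? ?] /andP[? ?].
by apply/andP; split; lra.
Qed.

Lemma isotonic_fitP m Y : is_isotonic_fit m Y (isotonic_fit m Y).
Proof. have [v vP] := isotonic_fit_exists m Y; exact: getPex (ex_intro _ v vP). Qed.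

Lemma sum_nat_widen m i j (g : nat -> R) : (j < m)%N ->
  \sum_(l < m | (i <= l <= j)%N) g l = \sum_(i <= l < j.+1) g l.
Proof.
move=> jm; rewrite -(big_mkord (fun l => i <= l <= j)%N g).
by rewrite [RHS](big_nat_widenl i 0)// [RHS](big_nat_widen _ _ m).
Qed.

(** The residual sum of squares has a nonnegative derivative along the indicator
of a block, taken with the sign e, when small steps preserve monotonicity. *)
Lemma isotonic_fit_block m Y v i j e s0 : is_isotonic_fit m Y v -> (i <= j < m)%N ->
  e ^+ 2 = 1 -> 0 < s0 ->
  (forall s, 0 < s <= s0 -> nondecreasing_upto m (fun l => v l + e * s * (i <= l <= j)%N%:R)) ->
  e * \sum_(i <= l < j.+1) (Y l - v l) <= 0.
Proof.
move=> [vmon vmin] /andP[ij jm] e2 s00 H.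
rewrite -(sum_nat_widen i _ jm).
set c := e * _; rewrite leNgt; apply/negP => c0.
pose N : R := \sum_(l < m | (i <= l <= j)%N) 1.
have N0 : 0 < N.
  rewrite /N (bigD1 (Ordinal jm))/= ?ij ?leqnn//.
  by rewrite ltr_pwDl// sumr_ge0.
pose s := Num.min s0 (c / N).
have s1 : 0 < s by rewrite lt_min s00 divr_gt0.
have ss0 : s <= s0 by rewrite ge_min lexx.
have sN : s * N <= c by rewrite -ler_pdivlMr// ge_min lexx orbT.
have := vmin _ (H s _); rewrite s1 ss0 => /(_ isT).
have -> : \sum_(l < m) (Y l - (v l + e * s * (i <= l <= j)%N%:R)) ^+ 2 =
  \sum_(l < m) (Y l - v l) ^+ 2 + (s ^+ 2 * N - 2 * s * c).
  transitivity (\sum_(l < m) ((Y l - v l) ^+ 2 +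
    (if (i <= l <= j)%N then s ^+ 2 * 1 - (2 * s * e) * (Y l - v l) else 0))).
    apply: eq_bigr => l _; case: ifP => _ /=; last by rewrite mulr0 !addr0.
    have -> : s ^+ 2 * 1 = e ^+ 2 * s ^+ 2 by rewrite e2 mulr1 mul1r.
    ring.
  by rewrite big_split/= -big_mkcond/= sumrB -!mulr_sumr /c /N !mulrA.
rewrite lerDl => H1.
have : s * (s * N - c) <= 0 by rewrite pmulr_rle0// subr_le0.
have : 0 < s * c by rewrite mulr_gt0.
move: H1; have -> : s ^+ 2 * N - 2 * s * c = s * (s * N - c) - s * c by ring.
by move: (s * (_ - _)) (s * c) => *; lra.
Qed.

(** Let j be the last index where the fit is below theta. The fit jumps right
after j, unless j is the last index of all, so a block ending at j can be
raised a little without breaking monotonicity; by the first order condition its sum of responses is at most its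
sum of fitted values, which is below theta times its length. *)
Lemma isotonic_fit_lt m Y k theta : (k < m)%N -> isotonic_fit m Y k < theta ->
  exists2 j, (k <= j < m)%N & forall i, (i <= k)%N -> \sum_(i <= l < j.+1) (Y l - theta) < 0.
Proof.
move=> km vk; have vP := isotonic_fitP m Y; move: vP vk; set v := isotonic_fit m Y => vP vk.
have [vmon _] := vP.
pose p j := (j < m)%N && (v j < theta).
have pb j : p j -> (j <= m)%N by case/andP => /ltnW.
have [j /andP[jm vj] jmax] := ex_maxnP (ex_intro p k (introT andP (conj km vk))) pb.
have kj : (k <= j)%N by apply: jmax; rewrite /p km vk.
exists j; first by rewrite kj jm.
move=> i ik; have ij : (i <= j)%N := leq_trans ik kj.
pose s0 := if (j.+1 < m)%N then v j.+1 - v j else 1.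
have s00 : 0 < s0.
  rewrite /s0; case: ifPn => // j1m; rewrite subr_gt0 (lt_le_trans vj)// leNgt.
  by apply/negP => vj1; have := jmax j.+1; rewrite /p j1m vj1 ltnn => /(_ isT).
have : 1 * \sum_(i <= l < j.+1) (Y l - v l) <= 0.
  apply: (@isotonic_fit_block m Y v i j 1 s0) => //; rewrite ?ij ?jm ?expr1n//.
  move=> s /andP[s1 s2] a b /andP[ab bm]; rewrite !mul1r.
  have vab := vmon a b (introT andP (conj ab bm)).
  have [bj|jb] := leqP b j.
    apply: lerD => //; rewrite ler_wpM2l ?(ltW s1)// ler_nat.
    case/boolP: (i <= a <= j)%N => // /andP[ia _].
    by rewrite (leq_trans ia ab).
  rewrite andbF mulr0 addr0.
  have [aj|ja] := leqP a j; last by rewrite andbF mulr0 addr0.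
  have j1m : (j.+1 < m)%N by apply: leq_ltn_trans bm.
  rewrite /s0 j1m in s2.
  have := vmon a j; rewrite aj jm => /(_ isT) vaj.
  have := vmon j.+1 b; rewrite jb bm => /(_ isT) vjb.
  have : s * ((i <= a)%N && true)%:R <= s by rewrite ler_piMr ?(ltW s1)// lern1 leq_b1.
  lra.
rewrite mul1r sumrB subr_le0 => YV.
rewrite sumrB subr_lt0 (le_lt_trans YV)//.
apply: ltr_sum_nat => // l /andP[il]; rewrite ltnS => lj.
by apply: le_lt_trans vj; apply: vmon; rewrite lj jm.
Qed.

(** The mirror image: i is the first index where the fit reaches theta, and the
blocks starting at i can be lowered. *)
Lemma isotonic_fit_ge m Y k theta : (k < m)%N -> theta <= isotonic_fit m Y k ->
  exists2 i, (i <= k)%N & forall j, (k <= j < m)%N -> 0 <= \sum_(i <= l < j.+1) (Y l - theta).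
Proof.
move=> km vk; have vP := isotonic_fitP m Y; move: vP vk; set v := isotonic_fit m Y => vP vk.
have [vmon _] := vP.
have [i vi imin] := ex_minnP (ex_intro (fun i => theta <= v i) k vk).
have ik : (i <= k)%N by exact: imin.
exists i => // j /andP[kj jm]; have ij := leq_trans ik kj.
have im := leq_ltn_trans ij jm.
pose s0 := if (0 < i)%N then v i - v i.-1 else 1.
have s00 : 0 < s0.
  rewrite /s0; case: ifPn => // i0; rewrite subr_gt0 (lt_le_trans _ vi)// ltNge.
  by apply/negP => vi1; have := imin _ vi1; case: (i) i0 => // i'; rewrite /= ltnn.
have : (-1) * \sum_(i <= l < j.+1) (Y l - v l) <= 0.
  apply: (@isotonic_fit_block m Y v i j (-1) s0) => //; rewrite ?ij ?jm ?sqrrN ?expr1n//.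
  move=> s /andP[s1 s2] a b /andP[ab bm]; rewrite !mulN1r !mulNr.
  have vab := vmon a b (introT andP (conj ab bm)).
  have [ia|ai] := leqP i a.
    apply: lerD => //; rewrite lerN2 ler_wpM2l ?(ltW s1)// ler_nat.
    case/boolP: (i <= b <= j)%N => // /andP[_ bj].
    by rewrite (leq_trans ab bj).
  rewrite mulr0 subr0.
  have [ib|bi] := leqP i b; last by rewrite mulr0 subr0.
  have i0 : (0 < i)%N by apply: leq_ltn_trans ai.
  rewrite /s0 i0 in s2.
  have := vmon a i.-1; rewrite -ltnS prednK// ai/= => /(_ (ltnW im)) vai.
  have := vmon i b; rewrite ib bm => /(_ isT) vib.
  have : s * (true && (b <= j)%N)%:R <= s by rewrite ler_piMr ?(ltW s1)// lern1 leq_b1.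
  rewrite /=; lra.
rewrite mulN1r oppr_le0 sumrB subr_ge0 => YV.
rewrite sumrB subr_ge0 (le_trans _ YV)//.
apply: ler_sum_nat => l /andP[il]; rewrite ltnS => lj.
by apply: (le_trans vi); apply: vmon; rewrite il (leq_ltn_trans lj jm).
Qed.

(** The conclusions of [isotonic_fit_lt] and [isotonic_fit_ge] exclude each
other, hence a criterion made of finitely many linear inequalities between the
responses. *)
Lemma isotonic_fit_geP m Y k theta : (k < m)%N ->
  (theta <= isotonic_fit m Y k) =
  [exists i : 'I_m, (i <= k)%N && [forall j : 'I_m, (k <= j)%N ==> (0 <= \sum_(i <= l < j.+1) (Y l - theta))]].
Proof.
move=> km; apply/idP/existsP.
  move=> /(isotonic_fit_ge km)[i ik H]; exists (Ordinal (leq_ltn_trans ik km)).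
  rewrite ik/=; apply/forallP => j; apply/implyP => kj; apply: H; rewrite kj/=; exact: ltn_ord.
move=> [i /andP[ik /forallP H]]; rewrite leNgt; apply/negP => /(isotonic_fit_lt km)[j /andP[kj jm]].
move=> /(_ _ ik); apply/negP; rewrite -leNgt.
exact: (implyP (H (Ordinal jm))).
Qed.

End isotonic_fit.

(** * Convergence in probability as convergence along a filter *)

Section measurable_comparison.
Context {R : realType} d {Omega : measurableType d}.
Implicit Types X : Omega -> R.

Lemma measurable_le_cst X (c : R) : measurable_fun setT X -> measurable [set w | X w <= c].
Proof.
move=> mX; rewrite -[X in measurable X]setTI.
rewrite (_ : [set w | X w <= c] = X @^-1` `]-oo, c]); first exact: mX.
by apply/seteqP; split => w /=; rewrite in_itv.
Qed.

Lemma measurable_ge_cst X (c : R) : measurable_fun setT X -> measurable [set w | c <= X w].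
Proof.
move=> mX; rewrite -[X in measurable X]setTI.
rewrite (_ : [set w | c <= X w] = X @^-1` `[c, +oo[); first exact: mX.
by apply/seteqP; split => w /=; rewrite in_itv/= andbT.
Qed.

Lemma measurable_gt_cst X (c : R) : measurable_fun setT X -> measurable [set w | c < X w].
Proof.
move=> mX; rewrite (_ : [set w | c < X w] = ~` [set w | X w <= c]).
  by apply: measurableC; exact: measurable_le_cst.
by apply/seteqP; split => w /=; rewrite ltNge => /negP.
Qed.

End measurable_comparison.

Section in_probability.
Context {R : realType} d {Omega : measurableType d} (P : probability Omega R).

(** Convergence of X n w along this filter of pairs (n, w) is convergence in
probability, with the exceptional events enclosed in measurable ones. Being a
filter, it gives access to the usual calculus of limits. *)
Definition prob_filter : set_system (nat * Omega) :=
  [set S | exists B : nat -> set Omega,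
    [/\ forall n, measurable (B n), P (B n) @[n --> \oo] --> 0%E &
        \forall n \near \oo, forall w, ~ B n w -> S (n, w)]].

Lemma prob_filter_near (S : nat -> Prop) : (\forall n \near \oo, S n) ->
  \forall nw \near prob_filter, S nw.1.
Proof.
move=> SN; exists (fun=> set0); split => //; last by apply: filterS SN.
by under eq_fun do rewrite measure0; exact: cvg_cst.
Qed.

Global Instance prob_filter_filter : Filter prob_filter.
Proof.
split.
- exists (fun=> set0); split=> //; last exact: nearW.
  by under eq_fun do rewrite measure0; exact: cvg_cst.
- move=> S T [B [mB PB BS]] [C [mC PC CT]]; exists (fun n => B n `|` C n); split.
  + by move=> n; exact: measurableU.
  + apply: (squeeze_cvge (f := cst 0%E) (h := (fun n => P (B n) + P (C n))%E)); last 2 first.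
    * exact: cvg_cst.
    * by rewrite -[X in _ --> X](adde0 0%E); apply: cvgeD.
    * by apply: nearW => n; rewrite measure_ge0/=; exact: measureU2.
  + by apply: filterS2 BS CT => n HS HT w /not_orP[Bw Cw]; split; [exact: HS|exact: HT].
- move=> S T ST [B [mB PB BS]]; exists B; split => //.
  by apply: filterS BS => n H w /H; exact: ST.
Unshelve. all: by end_near. Qed.

Lemma cvg_prob_filter_fst (T : Type) (F : set_system T) (u : nat -> T) :
  u n @[n --> \oo] --> F -> u nw.1 @[nw --> prob_filter] --> F.
Proof. by move=> uF A /uF; exact: prob_filter_near. Qed.

Lemma prob_filter_cvg_in_probability (X : nat -> Omega -> R) (l : R) :
  (forall a, 0 < a -> \forall n \near \oo, measurable [set w | a < `|X n w - l|]) ->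
  X nw.1 nw.2 @[nw --> prob_filter] --> l -> cvg_in_probability P X l.
Proof.
move=> mX /cvgrPdist_le Xl a a0.
have [B [mB PB BS]] := Xl a a0.
apply: (squeeze_cvge (f := cst 0%E) (h := fun n => P (B n))) => //; last exact: cvg_cst.
near=> n; rewrite measure_ge0/=.
have BSn : forall w, ~ B n w -> `|l - X n w| <= a by near: n; exact: BS.
apply: le_measure; rewrite ?inE//; first by near: n; exact: mX.
move=> w /= aw; apply: contrapT => /BSn.
by rewrite distrC leNgt aw.
Unshelve. all: by end_near. Qed.

Lemma markov_ge0 (X : Omega -> R) (c : R) : measurable_fun setT X ->
  P.-integrable setT (EFin \o X) -> (forall w, 0 <= X w) -> 0 < c ->
  (P [set w | (c <= X w)%R] <= ((\int[P]_w X w) / c)%R%:E)%E.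
Proof.
move=> mX iX X0 c0.
have mA : measurable [set w | c <= X w] by exact: measurable_ge_cst.
rewrite EFinM -lee_pdivrMr//; last by rewrite invr_gt0.
rewrite invrK /Rintegral fineK; last exact: integrable_fin_num.
rewrite muleC -integral_cst// [leLHS]integral_mkcond.
apply: ge0_le_integral => //.
- by move=> w _; rewrite patchE; case: ifP; rewrite lee_fin// ltW.
- apply/(measurable_restrictT _ mA).1; exact: measurable_cst.
- by apply/measurable_EFinP.
- move=> w _; rewrite patchE; case: ifP; rewrite lee_fin//.
  by rewrite inE.
Qed.

(** Markov's inequality. *)
Lemma cvg_prob_filter_mean0 (X : nat -> Omega -> R) :
  (forall n, measurable_fun setT (X n)) ->
  (\forall n \near \oo, P.-integrable setT (EFin \o X n)) ->
  (forall n w, 0 <= X n w) ->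
  \int[P]_w X n w @[n --> \oo] --> (0 : R) ->
  X nw.1 nw.2 @[nw --> prob_filter] --> (0 : R).
Proof.
move=> mX iX X0 EX; apply/cvgrPdist_le => e e0.
exists (fun n => [set w | e <= X n w]); split.
- by move=> n; exact: measurable_ge_cst.
- apply: (squeeze_cvge (f := cst 0%E) (h := fun n => ((\int[P]_w X n w) / e)%R%:E)).
  + near=> n; rewrite measure_ge0/=; apply: markov_ge0 => //.
    by near: n.
  + exact: cvg_cst.
  + apply/fine_cvgP; split; first exact: nearW.
    by rewrite -[X in _ --> X](mul0r e^-1); apply: cvgM => //; exact: cvg_cst.
- near=> n => w /= /negP; rewrite -ltNge => Xe.
  by rewrite sub0r normrN ger0_norm// ltW.
Unshelve. all: by end_near. Qed.

End in_probability.

Section independence.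
Context {R : realType} d {Omega : measurableType d} (P : probability Omega R).

Definition rv_pair (X Y : {RV P >-> R}) (w : Omega) : R * R := (X w, Y w).

Lemma measurable_rv_pair (X Y : {RV P >-> R}) : measurable_fun setT (rv_pair X Y).
Proof. exact: measurable_fun_pair. Qed.

HB.instance Definition _ (X Y : {RV P >-> R}) :=
  isMeasurableFun.Build _ _ _ _ (rv_pair X Y) (measurable_rv_pair X Y).

Definition pair_independent (X Y : {RV P >-> R}) := forall A B : set R,
  measurable A -> measurable B ->
  (P (X @^-1` A `&` Y @^-1` B) = P (X @^-1` A) * P (Y @^-1` B))%E.

Lemma pair_independent_distribution (X Y : {RV P >-> R}) : pair_independent X Y ->
  forall C, measurable C ->
  (distribution P X \x distribution P Y)%E C = distribution P (rv_pair X Y) C.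
Proof.
move=> XY C mC; exact: product_measure_unique.
Qed.

(** Fubini's theorem for the product of the two laws, which is the law of the
pair. *)
Lemma pair_independent_mean (X Y : {RV P >-> R}) (phi psi : R -> R) :
  pair_independent X Y -> measurable_fun setT phi -> measurable_fun setT psi ->
  P.-integrable setT (fun w => (phi (X w))%:E) ->
  P.-integrable setT (fun w => (psi (Y w))%:E) ->
  P.-integrable setT (fun w => (phi (X w) * psi (Y w))%:E) /\
  \int[P]_w (phi (X w) * psi (Y w)) = \int[P]_w phi (X w) * \int[P]_w psi (Y w).
Proof.
move=> XY mphi mpsi iX iY.
pose mu := distribution P X; pose nu := distribution P Y.
pose g (z : R * R) : \bar R := (phi z.1 * psi z.2)%:E.
have mg : measurable_fun setT g.
  apply/measurable_EFinP; apply: measurable_funM.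
    by apply: measurableT_comp => //; exact: measurable_fst.
  by apply: measurableT_comp => //; exact: measurable_snd.
have mE (h : R -> R) : measurable_fun setT h -> measurable_fun setT (fun x => (h x)%:E : \bar R).
  by move=> mh; apply/measurable_EFinP.
have iphi : mu.-integrable setT (fun x => (phi x)%:E).
  apply/integrableP; split; first exact: mE.
  rewrite /mu ge0_integral_distribution//; last by apply: measurableT_comp => //; exact: mE.
  by have /integrableP[] := iX.
have ipsi : nu.-integrable setT (fun x => (psi x)%:E).
  apply/integrableP; split; first exact: mE.
  rewrite /nu ge0_integral_distribution//; last by apply: measurableT_comp => //; exact: mE.
  by have /integrableP[] := iY.
have npsi : (\int[nu]_y `|(psi y)%:E| \is a fin_num)%E.
  exact: (integrable_fin_num measurableT (integrable_abse ipsi)).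
have ig : (mu \x nu)%E.-integrable setT g.
  apply/integrable12ltyP => //.
  have I x : (\int[nu]_y `|g (x, y)| = `|(phi x)%:E| * \int[nu]_y `|(psi y)%:E|)%E.
    rewrite -ge0_integralZl//; last by apply: measurableT_comp => //; exact: mE.
    by apply: eq_integral => y _; rewrite /g/= normrM EFinM.
  under eq_integral do rewrite I.
  rewrite -(fineK npsi) ge0_integralZr//.
  - by rewrite -(fineK (integrable_fin_num measurableT (integrable_abse iphi))) -EFinM ltry.
  - by apply: measurableT_comp => //; exact: mE.
  - by rewrite lee_fin fine_ge0// integral_ge0.
have eqm C : measurable C -> C `<=` setT -> (mu \x nu)%E C = distribution P (rv_pair X Y) C.
  by move=> mC _; exact: pair_independent_distribution.
have iXY : P.-integrable setT (g \o rv_pair X Y).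
  apply/integrableP; split; first exact: measurableT_comp.
  have := ge0_integral_distribution (P := P) (rv_pair X Y) (f := abse \o g).
  move=> /(_ _ _)/= <- //; last exact: measurableT_comp.
  rewrite -(eq_measure_integral _ eqm).
  by have /integrableP[] := ig.
split; first exact: iXY.
rewrite /Rintegral -fineM; [|exact: (integrable_fin_num measurableT iX)|exact: (integrable_fin_num measurableT iY)].
congr fine.
transitivity (\int[distribution P (rv_pair X Y)]_z g z)%E.
  by rewrite integral_distribution.
rewrite -(eq_measure_integral _ eqm) -integral12_prod_meas1//.
transitivity (\int[mu]_x ((phi x)%:E * \int[nu]_y (psi y)%:E))%E.
  apply: eq_integral => x _; rewrite /fubini_F /g/=.
  by under eq_integral do rewrite EFinM; rewrite integralZl.
have fpsi := integrable_fin_num measurableT ipsi.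
rewrite -(fineK fpsi) integralZr// fineK//.
by rewrite /mu /nu !integral_distribution//; exact: mE.
Qed.

End independence.

(** * A maximal inequality for orthogonal variables *)

Lemma expn_up_log_le m : (0 < m)%N -> (2 ^ up_log 2 m <= m.*2)%N.
Proof.
case: m => [|[|m]]// _.
have /up_log_bounds : (1 < 2)%N by [].
move=> /(_ m.+2 isT)/andP[H _].
have k0 : (0 < up_log 2 m.+2)%N by rewrite up_log_gt0.
by rewrite -(prednK k0) expnS mul2n leq_double ltnW.
Qed.

Section orthogonal_sums.
Context {R : realType} d {Omega : measurableType d} (P : probability Omega R).
Implicit Types (X : Omega -> R).

Lemma Rintegral_sum (I : Type) (r : seq I) (f : I -> Omega -> R) :
  (forall i, P.-integrable setT (fun w => (f i w)%:E)) ->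
  P.-integrable setT (fun w => (\sum_(i <- r) f i w)%:E) /\
  \int[P]_w (\sum_(i <- r) f i w) = \sum_(i <- r) \int[P]_w f i w.
Proof.
move=> fi; elim: r => [|i r [IH1 IH2]].
  split; first by under eq_fun do rewrite big_nil; exact: integrable0.
  by rewrite big_nil; under eq_Rintegral do rewrite big_nil; rewrite /Rintegral integral0.
split; first by under eq_fun do rewrite big_cons EFinD; exact: integrableD.
rewrite big_cons -IH2 -(RintegralD measurableT (fi i) IH1).
by apply: eq_Rintegral => w _; rewrite big_cons.
Qed.

(** The second moments are only bounded above by s2, which allows some of the
variables to be 0. *)
Definition orthogonal_rvs (u : nat -> Omega -> R) (s2 : R) :=
  [/\ forall i, measurable_fun setT (u i),
      forall i j, P.-integrable setT (fun w => (u i w * u j w)%:E),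
      forall i j, i != j -> \int[P]_w (u i w * u j w) = 0 &
      forall i, \int[P]_w (u i w * u i w) <= s2].

Definition psum (u : nat -> Omega -> R) a N w : R := \sum_(l < N) u (a + l)%N w.

Section orth.
Variables (u : nat -> Omega -> R) (s2 : R).
Hypothesis uo : orthogonal_rvs u s2.

Lemma measurable_psum a N : measurable_fun setT (psum u a N).
Proof. by apply: measurable_sum => l; have [mu _ _ _] := uo. Qed.

Lemma psum_sqr a N : P.-integrable setT (fun w => (psum u a N w ^+ 2)%:E) /\
  \int[P]_w (psum u a N w ^+ 2) <= N%:R * s2.
Proof.
have [mu iu ort var] := uo.
have E : (fun w => psum u a N w ^+ 2) =
    (fun w => \sum_(i < N) \sum_(j < N) (u (a + i)%N w * u (a + j)%N w)).
  by apply/funext => w; rewrite /psum expr2 mulr_suml; apply: eq_bigr => i _; rewrite mulr_sumr.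
have H (i : 'I_N) := Rintegral_sum (index_enum 'I_N) (fun j : 'I_N => iu (a + i)%N (a + j)%N).
have [H1 H2] := Rintegral_sum (index_enum 'I_N) (fun i => (H i).1).
split; first by under eq_fun do rewrite (congr1 (@^~ _) E).
rewrite E H2 (eq_bigr (fun i : 'I_N => \int[P]_w (u (a + i)%N w * u (a + i)%N w))); last first.
  move=> i _; rewrite (H i).2 (bigD1 i)//= big1 ?addr0// => j ji.
  by rewrite ort// eqn_add2l eq_sym.
rewrite -[N in leRHS]card_ord -sumr_const mulr_suml; apply: ler_sum => i _.
by rewrite mul1r.
Qed.

(** A pathwise bound on the squares of all partial sums of length at most 2^k
that start at a, by binary splitting. A sum that reaches into the second half
is x + y with x the sum of the first half, and
(x + y)^2 <= (1 + K) x^2 + (1 + 1/K) y^2; the choice K = k'.+1 keeps the mean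
of the bound of order k^2 2^k. *)
Fixpoint dyadic_bound (k a : nat) w : R :=
  if k is k'.+1 then
    dyadic_bound k' a w + (1 + (k'.+1%:R)^-1) * dyadic_bound k' (a + 2 ^ k')%N w
    + k'.+2%:R * psum u a (2 ^ k') w ^+ 2
  else u a w ^+ 2.

Lemma dyadic_bound_ge0 k a w : 0 <= dyadic_bound k a w.
Proof.
elim: k a => [|k IH] a /=; first exact: sqr_ge0.
have q0 : 0 <= 1 + (k.+1%:R)^-1 :> R by rewrite addr_ge0 ?invr_ge0.
by apply: addr_ge0; [apply: addr_ge0; [exact: IH|exact: mulr_ge0]|rewrite mulr_ge0// sqr_ge0].
Qed.

Lemma psumD a M N w : psum u a (M + N) w = psum u a M w + psum u (a + M) N w.
Proof.
rewrite /psum big_split_ord/=; congr (_ + _); apply: eq_bigr => l _.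
by rewrite addnA.
Qed.

Lemma dyadic_boundP k a j w : (j <= 2 ^ k)%N -> psum u a j w ^+ 2 <= dyadic_bound k a w.
Proof.
elim: k a j => [|k IH] a j /=.
  rewrite expn0; case: j => [|[|]]// _; first by rewrite /psum big_ord0 expr0n sqr_ge0.
  by rewrite /psum big_ord1 addn0.
have K0 : 0 < k.+1%:R :> R by [].
have q0 : 0 <= 1 + (k.+1%:R)^-1 :> R by rewrite addr_ge0 ?invr_ge0.
have [j1 _|j1 j2] := leqP j (2 ^ k).
  apply: (le_trans (IH _ _ j1)); rewrite -addrA lerDl; apply: addr_ge0.
    exact: (mulr_ge0 q0 (dyadic_bound_ge0 _ _ _)).
  by apply: mulr_ge0 => //; exact: sqr_ge0.
have je : j = (2 ^ k + (j - 2 ^ k))%N by rewrite subnKC// ltnW.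
rewrite je psumD; set x := psum u a _ w; set y := psum u _ _ w.
have yb : y ^+ 2 <= dyadic_bound k (a + 2 ^ k) w.
  by apply: IH; rewrite leq_subLR addnn -mul2n -expnS.
apply: (@le_trans _ _ ((1 + (k.+1%:R)^-1) * y ^+ 2 + k.+2%:R * x ^+ 2)); last first.
  rewrite lerD2r -[leLHS]add0r; apply: lerD; first exact: dyadic_bound_ge0.
  by rewrite ler_wpM2l.
have : 0 <= (k.+1%:R * x - y) ^+ 2 / k.+1%:R by rewrite divr_ge0 ?sqr_ge0.
have -> : (k.+1%:R * x - y) ^+ 2 / k.+1%:R = k.+1%:R * x ^+ 2 - 2 * (x * y) + (k.+1%:R)^-1 * y ^+ 2.
  by field; rewrite gt_eqF.
rewrite -[k.+2%:R]natr1; move: (k.+1%:R) => K.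
have -> : (x + y) ^+ 2 = x ^+ 2 + 2 * (x * y) + y ^+ 2 by ring.
rewrite !mulrDl !mul1r; move: (K^-1 * _) (K * _) (x * y) => *; lra.
Qed.

Lemma dyadic_bound_mean k a : [/\ measurable_fun setT (dyadic_bound k a),
   P.-integrable setT (EFin \o dyadic_bound k a) &
   \int[P]_w dyadic_bound k a w <= (k.+1%:R ^+ 2 * 2 ^+ k) * s2].
Proof.
have [mu iu ort var] := uo.
elim: k a => [|k IH] a /=.
  split.
  - by apply: measurable_funX; exact: mu.
  - by apply: eq_integrable (iu a a) => // w _ /=; rewrite expr2.
  - by rewrite expr1n expr0 !mul1r; under eq_Rintegral do rewrite expr2; exact: var.
have [m1 i1 e1] := IH a; have [m2 i2 e2] := IH (a + 2 ^ k)%N.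
have [i3 e3] := psum_sqr a (2 ^ k).
have i2' : P.-integrable setT (fun w => ((1 + (k.+1%:R)^-1) * dyadic_bound k (a + 2 ^ k) w)%:E).
  exact: (integrableZl measurableT _ i2).
have i3' : P.-integrable setT (fun w => (k.+2%:R * psum u a (2 ^ k) w ^+ 2)%:E).
  exact: (integrableZl measurableT _ i3).
have i12 : P.-integrable setT (fun w => (dyadic_bound k a w + (1 + (k.+1%:R)^-1) * dyadic_bound k (a + 2 ^ k) w)%:E).
  exact: (integrableD measurableT i1 i2').
split.
- apply: measurable_funD; last first.
    by apply: measurable_funM => //; apply: measurable_funX; exact: measurable_psum.
  by apply: measurable_funD => //; exact: measurable_funM.
- exact: (integrableD measurableT i12 i3').
rewrite RintegralD// RintegralD// !RintegralZl//.
have K0 : 0 < k.+1%:R :> R by [].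
have q0 : 0 <= 1 + (k.+1%:R)^-1 :> R by rewrite addr_ge0 ?invr_ge0.
have k2 : 0 <= k.+2%:R :> R by [].
have s20 : 0 <= s2.
  by apply: le_trans (var 0%N); apply: Rintegral_ge0 => w _; rewrite -expr2 sqr_ge0.
apply: (le_trans (lerD (lerD e1 (ler_wpM2l q0 e2)) (ler_wpM2l k2 e3))).
rewrite -[k.+2%:R]natr1 natrX (exprS 2 k); move: (k.+1%:R) K0 (2 ^+ k) (exprn_ge0 k (@ler0n R 2)) => K K0 T T0.
have -> : K ^+ 2 * T * s2 + (1 + K^-1) * (K ^+ 2 * T * s2) + (K + 1) * (T * s2) =
  (K ^+ 2 + (K + 1) ^+ 2) * (T * s2) by field; rewrite gt_eqF.
have -> : (K + 1) ^+ 2 * (2 * T) * s2 = (2 * (K + 1) ^+ 2) * (T * s2) by ring.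
rewrite ler_wpM2r ?mulr_ge0//.
have -> : (K + 1) ^+ 2 = K ^+ 2 + 2 * K + 1 by ring.
by move: (K ^+ 2) => *; lra.
Qed.

(** Markov's inequality for [dyadic_bound] at each scale 2^k between N0 and
2 m. A sum of length M is covered by the scale 2^k with M <= 2^k <= 2 M, where
c M is at least c 2^k / 2, hence the threshold c^2 4^k / 4; the probability at
scale k is of order k^2 / (c^2 2^k). *)
Lemma dyadic_maximal c N0 m : 0 < c -> (0 < N0)%N ->
  exists B, [/\ measurable B,
    (P B <= (4 * (up_log 2 m).+1%:R ^+ 3 * s2 / (c ^+ 2 * N0%:R))%:E)%E &
    forall w, ~ B w -> forall M, (N0 <= M <= m)%N -> `|psum u 0 M w| < c * M%:R].
Proof.
move=> c0 N00; set K := (up_log 2 m).+1.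
have s20 : 0 <= s2.
  have [_ _ _ var] := uo.
  by apply: le_trans (var 0%N); apply: Rintegral_ge0 => w _; rewrite -expr2 sqr_ge0.
have t0 k : 0 < c ^+ 2 * 4 ^+ k / 4 by rewrite divr_gt0// mulr_gt0 ?exprn_gt0.
pose B k := if (N0 <= 2 ^ k)%N then [set w | c ^+ 2 * 4 ^+ k / 4 <= dyadic_bound k 0 w] else set0.
have mB k : measurable (B k).
  rewrite /B; case: ifP => // _; have [mk _ _] := dyadic_bound_mean k 0.
  exact: measurable_ge_cst.
pose b : R := 4 * K%:R ^+ 2 * s2 / (c ^+ 2 * N0%:R).
have N0R : 0 < N0%:R :> R by rewrite ltr0n.
have b0 : 0 <= b.
  apply: divr_ge0; first by rewrite mulr_ge0// mulr_ge0// exprn_ge0.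
  by rewrite ltW// mulr_gt0// exprn_gt0.
have PB k : (k < K)%N -> (P (B k) <= b%:E)%E.
  move=> kK; rewrite /B; case: ifP => Nk; last by rewrite measure0 lee_fin.
  have [mk ik ek] := dyadic_bound_mean k 0.
  apply: (le_trans (markov_ge0 mk ik (dyadic_bound_ge0 k 0) (t0 k))).
  rewrite lee_fin ler_pdivrMr//.
  have Nk' : N0%:R <= 2 ^+ k :> R by rewrite -natrX ler_nat.
  have kK' : k.+1%:R ^+ 2 <= K%:R ^+ 2 :> R by rewrite lerXn2r ?nnegrE// ler_nat.
  apply: (le_trans ek).
  have -> : b * (c ^+ 2 * 4 ^+ k / 4) = (K%:R ^+ 2 * 2 ^+ k * s2) * (2 ^+ k / N0%:R).
    rewrite /b (_ : 4 ^+ k = 2 ^+ k * 2 ^+ k :> R); last by rewrite -exprMn -natrM.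
    by field; rewrite !gt_eqF.
  apply: (@le_trans _ _ (K%:R ^+ 2 * 2 ^+ k * s2)).
    by rewrite ler_wpM2r// ler_wpM2r// exprn_ge0.
  rewrite ler_peMr//; last by rewrite ler_pdivlMr// mul1r.
  by rewrite mulr_ge0// mulr_ge0// exprn_ge0.
exists (\big[setU/set0]_(k < K) B k); split.
- by apply: bigsetU_measurable => k _; exact: mB.
- apply: (@le_trans _ _ (\sum_(k < K) P (B k))%E).
    apply: (@le_trans _ _ (\sum_(k < K) P (B k))%E) => //.
    exact: Boole_inequality.
  apply: (@le_trans _ _ (\sum_(k < K) b%:E)%E); first by apply: lee_sum => k _; exact: PB.
  rewrite sumEFin lee_fin sumr_const card_ord -[b *+ K]mulr_natl /b.
  by rewrite le_eqVlt; apply/orP; left; apply/eqP; rewrite exprSr; ring.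
move=> w nB M /andP[NM Mm]; rewrite ltNge; apply/negP => cM; apply: nB.
pose k := up_log 2 M.
have M0 : (0 < M)%N := leq_trans N00 NM.
have Mk : (M <= 2 ^ k)%N by exact: up_logP.
have kM : (2 ^ k <= M.*2)%N by exact: expn_up_log_le.
have kK : (k < K)%N by rewrite /k ltnS leq_up_log.
rewrite -bigcup_mkord; exists k => //; rewrite /B (leq_trans NM Mk)/=.
apply: le_trans (dyadic_boundP 0 w Mk).
rewrite -[psum _ _ _ _ ^+ 2]real_normK ?num_real//.
apply: (@le_trans _ _ ((c * M%:R) ^+ 2)); last first.
  by rewrite lerXn2r ?nnegrE// mulr_ge0// ltW.
rewrite exprMn -mulrA ler_wpM2l ?sqr_ge0// ler_pdivrMr//.
have -> : 4 ^+ k = (2 ^+ k) ^+ 2 :> R by rewrite expr2 -exprMn -natrM.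
have -> : M%:R ^+ 2 * 4 = (M.*2%:R) ^+ 2 :> R by rewrite -mul2n natrM; ring.
by rewrite lerXn2r ?nnegrE ?exprn_ge0// -natrX ler_nat.
Qed.

End orth.
End orthogonal_sums.

(** * Independent copies of the error *)

Section iid_errors.
Context {R : realType} d {Omega : measurableType d} (P : probability Omega R).

Lemma mutually_independent_pair (I : choiceType) (D : set I) (X : I -> {RV P >-> R}) k k' :
  mutually_independent D X -> D k -> D k' -> k != k' -> pair_independent (X k) (X k').
Proof.
move=> indep Dk Dk' kk' A B mA mB.
pose F i := if i == k then A else B.
have Fk : F k = A by rewrite /F eqxx.
have Fk' : F k' = B by rewrite /F eq_sym (negbTE kk').
have := indep [fset k; k']%fset F.
rewrite big_fsetU1/= ?inE// big_seq_fset1 Fk Fk'.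
have -> : \bigcap_(i in [set` [fset k; k']%fset]) (X i @^-1` F i) = X k @^-1` A `&` X k' @^-1` B.
  apply/seteqP; split => w /=.
    by move=> H; split; [rewrite -Fk|rewrite -Fk']; apply: H; rewrite /= !inE eqxx ?orbT.
  move=> [HA HB] i; rewrite /= !inE => /orP[/eqP ->|/eqP ->]; first by rewrite Fk.
  by rewrite Fk'.
apply.
- by move=> i; rewrite /= !inE => /orP[/eqP ->|/eqP ->].
- by move=> i _; rewrite /F; case: ifP.
Qed.

Lemma eq_distribution_mean (X Y : {RV P >-> R}) (phi : R -> R) :
  (forall A, measurable A -> distribution P X A = distribution P Y A) ->
  measurable_fun setT phi ->
  P.-integrable setT (fun w => (phi (Y w))%:E) ->
  P.-integrable setT (fun w => (phi (X w))%:E) /\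
  \int[P]_w phi (X w) = \int[P]_w phi (Y w).
Proof.
move=> XY mphi iY.
have mE : measurable_fun setT (fun x => (phi x)%:E : \bar R) by apply/measurable_EFinP.
have mA : measurable_fun setT (abse \o (fun x => (phi x)%:E)).
  by apply: (measurableT_comp _ mE).
have eqm C : measurable C -> C `<=` setT -> distribution P X C = distribution P Y C.
  by move=> mC _; exact: XY.
have iX : P.-integrable setT (fun w => (phi (X w))%:E).
  apply/integrableP; split; first by apply: (measurableT_comp mE).
  have := ge0_integral_distribution (P := P) X (f := abse \o (fun x => (phi x)%:E)).
  move=> /(_ mA _)/= <- //.
  rewrite (eq_measure_integral _ eqm) ge0_integral_distribution//.
  by have /integrableP[] := iY.
split=> //; rewrite /Rintegral; congr fine.
have := integral_distribution (P := P) mE iX; rewrite /= => <-.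
have := integral_distribution (P := P) mE iY; rewrite /= => <-.
exact: eq_measure_integral.
Qed.

Section rows.
Variables (I : choiceType) (D : set I) (X : I -> {RV P >-> R}) (eps : {RV P >-> R}).
Hypothesis iidX : iid_copies eps D X.
Variables (phi : R -> R).
Hypotheses (mphi : measurable_fun setT phi).
Hypotheses (iphi : P.-integrable setT (fun w => (phi (eps w))%:E)).
Hypotheses (iphi2 : P.-integrable setT (fun w => (phi (eps w) ^+ 2)%:E)).
Hypotheses (phi0 : \int[P]_w phi (eps w) = 0).

(** A row of errors enumerated by f and completed by zeros: the enumeration can
run forwards or backwards from any position, and past the end of the row. *)
Definition padded (f : nat -> option I) (l : nat) (w : Omega) : R :=
  if f l is Some k then phi (X k w) else 0.

Lemma orthogonal_padded (f : nat -> option I) :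
  (forall l k, f l = Some k -> D k) ->
  (forall l l' k, f l = Some k -> f l' = Some k -> l = l') ->
  orthogonal_rvs P (padded f) (\int[P]_w (phi (eps w) ^+ 2)).
Proof.
move=> fD finj.
have [indep idd] := iidX.
have iX k : D k -> P.-integrable setT (fun w => (phi (X k w))%:E) /\ \int[P]_w phi (X k w) = 0.
  move=> Dk; have [? E] := eq_distribution_mean (fun A => @idd k A Dk) mphi iphi.
  by split => //; rewrite E.
have iX2 k : D k -> P.-integrable setT (fun w => (phi (X k w) * phi (X k w))%:E) /\
    \int[P]_w (phi (X k w) * phi (X k w)) = \int[P]_w (phi (eps w) ^+ 2).
  move=> Dk.
  exact: (@eq_distribution_mean (X k) eps (fun x => phi x * phi x) (fun A => @idd k A Dk) (measurable_funM mphi mphi) iphi2).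
have pad k k' : D k -> D k' -> k != k' ->
   P.-integrable setT (fun w => (phi (X k w) * phi (X k' w))%:E) /\ \int[P]_w (phi (X k w) * phi (X k' w)) = 0.
  move=> Dk Dk' kk'.
  have pik := mutually_independent_pair indep Dk Dk' kk'.
  have [H1 H2] := pair_independent_mean pik mphi mphi (iX k Dk).1 (iX k' Dk').1.
  by split => //; rewrite H2 (iX k Dk).2 mul0r.
have i0 : P.-integrable setT (fun=> (0 : R)%:E) by exact: integrable0.
split.
- move=> l; rewrite /padded; case: (f l) => [k|]; last exact: measurable_cst.
  exact: measurableT_comp.
- move=> i j; rewrite /padded; case fi : (f i) => [k|]; last first.
    by under eq_fun do rewrite mul0r.
  case fj : (f j) => [k'|]; last by under eq_fun do rewrite mulr0.
  have [kk'|kk'] := eqVneq k k'; last exact: (pad k k' (fD _ _ fi) (fD _ _ fj) kk').1.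
  by rewrite -kk'; exact: (iX2 k (fD _ _ fi)).1.
- move=> i j ij; rewrite /padded.
  have r0 : \int[P]_w (0 : R) = 0 by rewrite /Rintegral integral0.
  case fi : (f i) => [k|]; last by under eq_Rintegral do rewrite mul0r.
  case fj : (f j) => [k'|]; last by under eq_Rintegral do rewrite mulr0.
  apply: (pad k k' (fD _ _ fi) (fD _ _ fj) _).2.
  by apply: contra_neq ij => kk'; apply: finj fi _; rewrite kk'.
- move=> i; rewrite /padded; case fi : (f i) => [k|].
    by rewrite (iX2 k (fD _ _ fi)).2.
  under eq_Rintegral do rewrite mul0r.
  rewrite {1}/Rintegral integral0; apply: Rintegral_ge0 => w _; exact: sqr_ge0.
Qed.

End rows.

Section moments.
Variables (eps : {RV P >-> R}) (sigma : R).
Hypotheses (heps_mean : ('E_P[eps] = 0)%E)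
    (heps_var : ('V_P[eps] = (sigma ^+ 2)%:E)%E)
    (hA5 : ('E_P[fun w => (eps w ^+ 6)%R] < +oo)%E).

Lemma integrable_epsX k : (k <= 6)%N -> P.-integrable setT (fun w => (eps w ^+ k)%:E).
Proof.
move=> k6.
have e6 w : 0 <= eps w ^+ 6 by rewrite -[6%N]/(2 * 3)%N exprM exprn_ge0// sqr_ge0.
have meps j : measurable_fun setT (fun w => (eps w ^+ j)%:E : \bar R).
  by apply/measurable_EFinP; apply: measurable_funX.
have i6 : P.-integrable setT (fun w => (eps w ^+ 6)%:E).
  apply/integrableP; split => //.
  under eq_integral do rewrite gee0_abs ?lee_fin//.
  by move: hA5; rewrite unlock.
have i1 : P.-integrable setT (fun w => (1 + eps w ^+ 6)%:E).
  have i0 : P.-integrable setT (cst (1 : R)%:E) by exact: finite_measure_integrable_cst.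
  exact: (integrableD measurableT i0 i6).
apply: le_integrable i1 => // w _.
rewrite /= lee_fin [leRHS]ger0_norm ?addr_ge0// normrX.
have [e1|e1] := leP `|eps w| 1.
  by rewrite (le_trans (exprn_ile1 _ _ e1))// lerDl.
rewrite (le_trans (ler_weXn2l (ltW e1) k6))//.
by rewrite -normrX ger0_norm ?lerDr.
Qed.

Lemma eps_mean0 : \int[P]_w eps w = 0.
Proof. by move: heps_mean; rewrite unlock /Rintegral => ->. Qed.

Lemma eps_mean_sqr : \int[P]_w (eps w ^+ 2) = sigma ^+ 2.
Proof.
move: heps_var; rewrite /variance unlock heps_mean /= => H.
rewrite /Rintegral (_ : (\int[P]_w (eps w ^+ 2)%:E)%E = (sigma ^+ 2)%:E)// -H unlock.
by apply: eq_integral => w _; rewrite /= !fctE/= subr0 expr2.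
Qed.

End moments.

End iid_errors.

(** * Excursions of the noise when the isotonic estimate is off *)

Section excursions.
Context {R : realType}.
Variables (m : nat) (x Y : nat -> R) (f : R -> R) (d0 : R).
Hypotheses (x01 : forall i, (i < m)%N -> 0 <= x i <= 1).
Hypotheses (xinc : forall i j, (i < j < m)%N -> x i < x j).
Hypothesis (fmon : {in `[0, 1] &, {homo f : s t / s <= t}}).
Hypothesis (d01 : 0 <= d0 <= 1).

Definition design_count (t : R) : nat := #|[pred i : 'I_m | x i <= t]|.

Lemma design_count_le t : (design_count t <= m)%N.
Proof. by rewrite -[leqRHS]card_ord; exact: max_card. Qed.

Let widen_inj k (km : (k <= m)%N) : injective (widen_ord km).
Proof. by move=> i j /(congr1 val)/= /val_inj. Qed.

(** The design is sorted, so the points up to t come first. *)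
Lemma design_countP t l : (l < m)%N -> (l < design_count t)%N = (x l <= t).
Proof.
move=> lm; apply/idP/idP => [lc|xt].
  rewrite leNgt; apply/negP => tx.
  have : (design_count t <= l)%N.
    rewrite /design_count -[leqRHS](card_ord l).
    rewrite -(fintype.card_image (@widen_inj _ (ltnW lm))).
    apply: subset_leq_card; apply/fintype.subsetP => i; rewrite inE => xi.
    have il : (i < l)%N.
      rewrite ltnNge; apply/negP => li; move: xi; apply/negP; rewrite -ltNge.
      move: li; rewrite leq_eqVlt => /orP[/eqP <-//|li].
      by apply: (lt_trans tx); apply: xinc; rewrite li ltn_ord.
    by apply/fintype.imageP; exists (Ordinal il) => //; exact/val_inj.
  by rewrite leqNgt lc.
rewrite /design_count -[X in (X <= _)%N](card_ord l.+1).
rewrite -(fintype.card_image (@widen_inj _ lm)).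
apply: subset_leq_card; apply/fintype.subsetP => i /fintype.imageP[j _ ->]; rewrite inE/=.
have := ltn_ord j; rewrite ltnS leq_eqVlt => /orP[/eqP ->//|jl].
by apply: (le_trans (ltW _) xt); apply: xinc; rewrite jl.
Qed.

Lemma design_count_mono s t : s <= t -> (design_count s <= design_count t)%N.
Proof.
move=> st; apply: subset_leq_card; apply/fintype.subsetP => i; rewrite !inE => xs.
exact: le_trans xs st.
Qed.

Lemma isotonic_fit_mono i j : (i <= j < m)%N -> isotonic_fit m Y i <= isotonic_fit m Y j.
Proof. by have [H _] := isotonic_fitP m Y; exact: H. Qed.

Lemma dhat1_gt t theta : 0 <= t <= 1 -> t < dhat1 m x Y theta ->
  isotonic_fit m Y (design_count t).-1 < theta.
Proof.
move=> t01 td; rewrite ltNge; apply/negP => tS; move: td; apply/negP; rewrite -leNgt /dhat1.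
set S := [set _ | _].
have St : S t by split.
rewrite asboolT; last by exists t.
by apply: ge_inf => //; exists 0 => s [/andP[]].
Qed.

Lemma dhat1_lt t theta : t <= 1 -> (0 < m)%N -> dhat1 m x Y theta < t ->
  theta <= isotonic_fit m Y (design_count t).-1.
Proof.
move=> t1 m0; rewrite /dhat1; set S := [set _ | _].
case: asboolP => [S0 It|_ /lt_le_trans/(_ t1)]; last by rewrite ltxx.
have [s Ss st] := inf_lt S0 It.
have [_ /le_trans] := Ss; apply; rewrite /isotonic_regression -/(design_count s).
apply: isotonic_fit_mono; apply/andP; split.
  by rewrite -!subn1 leq_sub2r// design_count_mono// ltW.
by have := design_count_le t; case: (design_count t).
Qed.

Let fmon' s t : 0 <= s <= 1 -> 0 <= t <= 1 -> s <= t -> f s <= f t.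
Proof. by move=> s01 t01; apply: fmon; rewrite inE/= in_itv. Qed.

Lemma le_f_design s l : (l < m)%N -> 0 <= s <= 1 -> s <= x l -> f s <= f (x l).
Proof. by move=> lm s01 sx; apply: fmon' => //; exact: x01. Qed.

Lemma ge_f_design s l : (l < m)%N -> 0 <= s <= 1 -> x l <= s -> f (x l) <= f s.
Proof. by move=> lm s01 sx; apply: fmon' => //; exact: x01. Qed.

Let eps l := Y l - f (x l).

(** If the estimate exceeds t2, the fit at the last design point up to t2 is
below f d0, and by [isotonic_fit_lt] so is the mean response over some block
that starts right after d0 and reaches at least t2. There the signal
f (x l) - f d0 is nonnegative, and at least f t1 - f d0 beyond t1, that is on
a quarter of the block; the noise has to compensate for it. *)
Lemma excursion_right t1 t2 : d0 <= t1 <= t2 -> t2 <= 1 ->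
  let j0 := design_count d0 in let j1 := design_count t1 in let j2 := design_count t2 in
  (j0 < j2)%N -> (j2 - j0 <= 4 * (j2 - j1))%N ->
  t2 < dhat1 m x Y (f d0) ->
  exists2 M, (j2 - j0 <= M <= m)%N &
   (f t1 - f d0) / 4 * M%:R <= `|\sum_(l < M) (if (j0 + l < m)%N then eps (j0 + l) else 0)|.
Proof.
move=> /andP[d0t1 t12] t21 j0 j1 j2 j02 j012 td.
have /andP[d00 d011] := d01.
have t101 : 0 <= t1 <= 1 by apply/andP; split; [exact: le_trans d0t1|exact: le_trans t21].
have t201 : 0 <= t2 <= 1 by rewrite t21 andbT; apply: le_trans t12; case/andP: t101.
have kap0 : 0 <= f t1 - f d0 by rewrite subr_ge0; exact: fmon'.
have j01 : (j0 <= j1)%N by exact: design_count_mono.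
have j12 : (j1 <= j2)%N by exact: design_count_mono.
have j2m : (j2 <= m)%N by exact: design_count_le.
have j2p : (0 < j2)%N by exact: leq_ltn_trans j02.
have km : (j2.-1 < m)%N by rewrite prednK.
have [J /andP[kJ Jm] HJ] := isotonic_fit_lt km (dhat1_gt t201 td).
have j0k : (j0 <= j2.-1)%N by rewrite -ltnS prednK.
have HS := HJ _ j0k.
have j2J : (j2 <= J.+1)%N by rewrite -(prednK j2p) ltnS.
exists (J.+1 - j0)%N; first by rewrite leq_sub2r//= (leq_trans (leq_subr _ _)).
have -> : \sum_(l < J.+1 - j0) (if (j0 + l < m)%N then eps (j0 + l) else 0) = \sum_(j0 <= l < J.+1) eps l.
  transitivity (\sum_(0 + j0 <= l < J.+1) eps l); last by rewrite add0n.
  rewrite big_addn big_mkord; apply: eq_bigr => l _.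
  by rewrite addnC ifT//; have := ltn_ord l; move: Jm; clear; lia.
have Hsum : (f t1 - f d0) * (J.+1 - j1)%N%:R <= \sum_(j0 <= l < J.+1) (f (x l) - f d0).
  rewrite (@big_cat_nat _ _ _ j1)//=; last exact: leq_trans j12 j2J.
  rewrite -[leLHS]add0r; apply: lerD.
    rewrite big_nat; apply: sumr_ge0 => l /andP[l0 l1]; rewrite subr_ge0.
    have lm : (l < m)%N by apply: leq_trans l1 _; exact: leq_trans j12 j2m.
    by apply: le_f_design => //; rewrite ltW// ltNge -design_countP// -leqNgt.
  rewrite mulr_natr -sumr_const_nat; apply: ler_sum_nat => l /andP[l1 lJ].
  have lm : (l < m)%N by exact: leq_trans lJ Jm.
  by rewrite lerD2r; apply: le_f_design => //; rewrite ltW// ltNge -design_countP// -leqNgt.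
move: HS; have -> : \sum_(j0 <= l < J.+1) (Y l - f d0) =
   \sum_(j0 <= l < J.+1) (f (x l) - f d0) + \sum_(j0 <= l < J.+1) eps l.
  by rewrite -big_split/=; apply: eq_bigr => l _; rewrite /eps; ring.
move=> H; rewrite -normrN; apply: le_trans (ler_norm _).
have : (f t1 - f d0) / 4 * (J.+1 - j0)%N%:R <= (f t1 - f d0) * (J.+1 - j1)%N%:R.
  rewrite -mulrA ler_wpM2l// ler_pdivrMl// -natrM ler_nat.
  by move: j012 j2J j12 j01; clear; lia.
by move: Hsum H; move: (\sum_(_ <= _ < _) _) (\sum_(_ <= _ < _) _) (_ * _) (_ * _) => *; lra.
Qed.

(** The mirror image, with the noise summed backwards from d0. *)
Lemma excursion_left t1 t2 : t2 <= t1 <= d0 -> 0 <= t2 ->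
  let j0 := design_count d0 in let j1 := design_count t1 in let j2 := design_count t2 in
  (j2 < j0)%N -> (j0 - j2 <= 4 * (j1 - j2))%N ->
  dhat1 m x Y (f d0) < t2 ->
  exists2 M, (j0 - j2 <= M <= m)%N &
   (f d0 - f t1) / 4 * M%:R <= `|\sum_(l < M) (if (l < j0)%N then eps (j0 - l.+1) else 0)|.
Proof.
move=> /andP[t21 t1d] t20 j0 j1 j2 j20 j012 td.
have /andP[d00 d011] := d01.
have t101 : 0 <= t1 <= 1 by apply/andP; split; [exact: le_trans t21|exact: le_trans d011].
have kap0 : 0 <= f d0 - f t1 by rewrite subr_ge0; exact: fmon'.
have j01 : (j1 <= j0)%N by exact: design_count_mono.
have j12 : (j2 <= j1)%N by exact: design_count_mono.
have j0m : (j0 <= m)%N by exact: design_count_le.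
have j0p : (0 < j0)%N by exact: leq_ltn_trans j20.
have m0 : (0 < m)%N by exact: leq_trans j0m.
have km : (j2.-1 < m)%N by apply: leq_ltn_trans (leq_pred _) _; exact: leq_trans j20 j0m.
have t2le1 : t2 <= 1 by apply: le_trans t21 _; case/andP: t101.
have [i ik Hi] := isotonic_fit_ge km (dhat1_lt t2le1 m0 td).
have ij2 : (i <= j2)%N by apply: leq_trans ik (leq_pred _).
have := Hi j0.-1; rewrite prednK// j0m andbT => /(_ _)H.
have {}H : 0 <= \sum_(i <= l < j0) (Y l - f d0).
  by apply: H; rewrite -!subn1 leq_sub2r// ltnW.
have ij0 : (i <= j0)%N by apply: leq_trans ij2 (ltnW j20).
exists (j0 - i)%N; first by rewrite leq_sub2l//= (leq_trans (leq_subr _ _)).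
have -> : \sum_(l < j0 - i) (if (l < j0)%N then eps (j0 - l.+1) else 0) = \sum_(i <= l < j0) eps l.
  transitivity (\sum_(0 + i <= l < j0) eps l); last by rewrite add0n.
  rewrite big_addn big_mkord (reindex_inj rev_ord_inj)/=; apply: eq_bigr => l _.
  have lj := ltn_ord l; rewrite ifT; last by move: lj; clear; lia.
  by congr eps; move: lj; clear; lia.
have Hsum : \sum_(i <= l < j0) (f (x l) - f d0) <= - ((f d0 - f t1) * (j1 - i)%N%:R).
  rewrite (@big_cat_nat _ _ _ j1)//=; last exact: leq_trans ij2 j12.
  rewrite -[leRHS]addr0; apply: lerD; last first.
    rewrite big_nat -oppr_ge0 -sumrN; apply: sumr_ge0 => l /andP[l0 l1]; rewrite opprB subr_ge0.
    have lm : (l < m)%N by exact: leq_trans l1 j0m.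
    by apply: ge_f_design => //; rewrite -design_countP.
  rewrite mulr_natr -sumr_const_nat -sumrN; apply: ler_sum_nat => l /andP[l1 lJ].
  have lm : (l < m)%N by apply: leq_trans lJ _; exact: leq_trans j01 j0m.
  by rewrite opprB lerD2r; apply: ge_f_design => //; rewrite -design_countP.
move: H; have -> : \sum_(i <= l < j0) (Y l - f d0) =
   \sum_(i <= l < j0) (f (x l) - f d0) + \sum_(i <= l < j0) eps l.
  by rewrite -big_split/=; apply: eq_bigr => l _; rewrite /eps; ring.
move=> H; apply: le_trans (ler_norm _).
have : (f d0 - f t1) / 4 * (j0 - i)%N%:R <= (f d0 - f t1) * (j1 - i)%N%:R.
  rewrite -mulrA ler_wpM2l// ler_pdivrMl// -natrM ler_nat.
  by move: j012 ij2 j12 j01; clear; lia.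
by move: Hsum H; move: (\sum_(_ <= _ < _) _) (\sum_(_ <= _ < _) _) (_ * _) (_ * _) => *; lra.
Qed.

End excursions.

(** * Asymptotics of the half-width and of the design *)

Section power_asymptotics.
Context {R : realType}.

Lemma cvg_natpowR_N (a : R) : 0 < a -> (m%:R : R) `^ (- a) @[m --> \oo] --> (0 : R).
Proof.
move=> a0; apply/cvgrPdist_le => eps eps0; near=> m.
have m1 : eps `^ (- a^-1) <= m%:R by near: m; exact: nbhs_infty_ger.
have m0 : 0 < m%:R :> R by apply: lt_le_trans m1; exact: powR_gt0.
rewrite sub0r normrN ger0_norm ?powR_ge0//.
have : (eps `^ (- a^-1)) `^ a <= m%:R `^ a.
  by apply: ge0_ler_powR; rewrite ?nnegrE ?powR_ge0// ltW.
rewrite -powRrM mulNr mulVf ?gt_eqF// powR_inv1 ?(ltW eps0)// => H.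
rewrite powRN -[eps]invrK lef_pV2// posrE ?powR_gt0// invr_gt0//.
Unshelve. all: by end_near. Qed.

(** ln y <= y^s / s for y > 0, applied to y = 2 m. *)
Lemma up_log_powR (s : R) : 0 < s -> exists2 C : R, 0 < C &
  forall m, (0 < m)%N -> (up_log 2 m).+1%:R <= C * m%:R `^ s.
Proof.
move=> s0; have ln2 : 0 < ln 2 :> R by rewrite ln_gt0// ltr1n.
exists (1 + 2 `^ s / (s * ln 2)); first by rewrite ltr_pwDl// divr_ge0 ?powR_ge0// mulr_ge0// ltW.
move=> m m0.
have m1 : 1 <= m%:R `^ s :> R by rewrite -[leLHS](powRr0 m%:R) ler_powR// ?ler1n// ltW.
have kM := expn_up_log_le m0.
rewrite mulrDl mul1r -natr1 addrC lerD//.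
have y0 : 0 < m.*2%:R :> R by rewrite ltr0n double_gt0.
have : (up_log 2 m)%:R * ln 2 <= (m.*2%:R) `^ s / s.
  rewrite mulr_natl -lnXn// -natrX; apply: (@le_trans _ _ (ln m.*2%:R)).
    by rewrite ler_ln ?posrE// ?ltr0n ?expn_gt0// ler_nat.
  rewrite ler_pdivlMr// mulrC -ln_powR ltW// ln_sublinear// powR_gt0//.
rewrite -ler_pdivlMr// => /le_trans; apply.
rewrite -muln2 natrM mulrC powRM// invfM !mulrA.
by rewrite le_eqVlt; apply/orP; left; apply/eqP; ring.
Qed.

Variables (gamma K : R).
Hypotheses (hK : 0 < K) (hgamma : 0 < gamma < 3^-1).

Definition halfwidth (m : nat) : R := K * m%:R `^ (- gamma).

Lemma halfwidth_gt0 m : (0 < m)%N -> 0 < halfwidth m.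
Proof. by move=> m0; rewrite mulr_gt0// powR_gt0// ltr0n. Qed.

Lemma cvg_halfwidth : halfwidth m @[m --> \oo] --> (0 : R).
Proof.
have /andP[g0 _] := hgamma.
by rewrite -[X in _ --> X](mulr0 K); apply: cvgM; [exact: cvg_cst|exact: cvg_natpowR_N].
Qed.

Let powRinvM (x a b : R) : 0 < x -> x `^ a / x `^ b = x `^ (a - b).
Proof. by move=> x0; rewrite powRB// (gt_eqF x0) implybT. Qed.

Lemma cvg_cuberoot_halfwidth : (m%:R : R) `^ (- 3^-1) / halfwidth m @[m --> \oo] --> (0 : R).
Proof.
have /andP[_ g3] := hgamma.
have H : K^-1 * m%:R `^ (- (3^-1 - gamma)) @[m --> \oo] --> (0 : R).
  by rewrite -[X in _ --> X](mulr0 K^-1); apply: cvgM; [exact: cvg_cst|apply: cvg_natpowR_N; rewrite subr_gt0].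
apply: cvg_trans H; apply: near_eq_cvg; near=> m.
have m0 : 0 < m%:R :> R by rewrite ltr0n; near: m; exists 1%N.
by rewrite /halfwidth invfM mulrCA powRinvM// opprK opprB addrC.
Unshelve. all: by end_near. Qed.

Lemma cvg_sqrt_halfwidth : (Num.sqrt (m%:R : R) * halfwidth m)^-1 @[m --> \oo] --> (0 : R).
Proof.
have /andP[g0 g3] := hgamma.
have H : K^-1 * m%:R `^ (- (2^-1 - gamma)) @[m --> \oo] --> (0 : R).
  rewrite -[X in _ --> X](mulr0 K^-1); apply: cvgM; [exact: cvg_cst|apply: cvg_natpowR_N]; lra.
apply: cvg_trans H; apply: near_eq_cvg; near=> m.
have m0 : 0 < m%:R :> R by rewrite ltr0n; near: m; exists 1%N.
rewrite /halfwidth -powR12_sqrt ?(ltW m0)// !invfM mulrCA -powRN powRinvM//.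
by congr (_ * _ `^ _); ring.
Unshelve. all: by end_near. Qed.

(** m delta^3 grows like m^(1 - 3 gamma), with a positive exponent since
gamma < 1/3; half of this power absorbs the logarithms. *)
Lemma cvg_log_halfwidth :
  (up_log 2 m).+1%:R ^+ 3 / (m%:R * halfwidth m ^+ 3) @[m --> \oo] --> (0 : R).
Proof.
have /andP[g0 g3] := hgamma.
pose s := (1 - 3 * gamma) / 6.
have s0 : 0 < s by rewrite /s; lra.
have [C C0 HC] := up_log_powR s0.
have H : C ^+ 3 / K ^+ 3 * m%:R `^ (- (3 * s)) @[m --> \oo] --> (0 : R).
  rewrite -[X in _ --> X](mulr0 (C ^+ 3 / K ^+ 3)); apply: cvgM; [exact: cvg_cst|].
  by apply: cvg_natpowR_N; rewrite mulr_gt0.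
apply: (squeeze_cvgr _ (cvg_cst (0 : R)) H).
near=> m.
have m0 : (0 < m)%N by near: m; exists 1%N.
have mR : 0 < m%:R :> R by rewrite ltr0n.
have d0 := halfwidth_gt0 m0.
apply/andP; split; first by rewrite divr_ge0// ?exprn_ge0// mulr_ge0// exprn_ge0// ltW.
rewrite ler_pdivrMr; last by rewrite mulr_gt0// exprn_gt0.
have -> : C ^+ 3 / K ^+ 3 * m%:R `^ (- (3 * s)) * (m%:R * halfwidth m ^+ 3) = (C * m%:R `^ s) ^+ 3.
  have pw3 b : (m%:R `^ b) ^+ 3 = m%:R `^ (b * 3) :> R.
    by rewrite -powR_mulrn ?powR_ge0// -powRrM.
  have m1 : m%:R = m%:R `^ 1 :> R by rewrite powRr1// ltW.
  rewrite /halfwidth !exprMn !pw3.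
  have pD a b : m%:R `^ a * m%:R `^ b = m%:R `^ (a + b) :> R.
    by rewrite powRD// (gt_eqF mR) implybT.
  transitivity (C ^+ 3 * (m%:R `^ (- (3 * s)) * (m%:R `^ 1 * m%:R `^ (- gamma * 3)))).
    rewrite -m1; move: (m%:R `^ (- (3 * s))) (m%:R `^ (- gamma * 3)) (m%:R) => a1 a2 a3.
    by field; rewrite gt_eqF.
  by rewrite !pD; congr (_ * _ `^ _); rewrite /s; field.
by rewrite lerXn2r ?nnegrE ?HC// mulr_ge0 ?powR_ge0// ltW.
Unshelve. all: by end_near. Qed.

End power_asymptotics.

Section difference_quotient.
Context {R : realType} (S : Type) (F : set_system S) {FF : Filter F}.

(** Differentiability at a single point suffices for steps s delta that vanish
while s converges; the steps may be random, as F is arbitrary. *)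
Lemma cvg_scaled_diff (h : R -> R) (x a c : R) (s delta : S -> R) :
  is_derive x 1 h a -> delta y @[y --> F] --> (0 : R) ->
  (\forall y \near F, 0 < delta y) -> s y @[y --> F] --> c ->
  (h (x + s y * delta y) - h x) / delta y @[y --> F] --> c * a.
Proof.
move=> [dh ha] d0 dpos sc.
have key : forall e, 0 < e -> \forall y \near (0 : R), `|h (x + y) - h x - a * y| <= e * `|y|.
  move=> e e0.
  have : t^-1 *: (h (t *: 1 + x) - h x) @[t --> (0 : R)^'] --> a by rewrite -ha; exact: dh.
  move=> /cvgrPdist_le/(_ e e0); rewrite near_withinE; apply: filterS => y H.
  have [->|y0] := eqVneq y 0; first by rewrite addr0 subrr mulr0 subr0 normr0 mulr0.
  have := H y0; rewrite /GRing.scale/= mulr1 [y + x]addrC => H1.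
  have -> : h (x + y) - h x - a * y = - (a - y^-1 * (h (x + y) - h x)) * y by field.
  by rewrite normrM normrN ler_wpM2r.
have sd0 : s y * delta y @[y --> F] --> (0 : R) by rewrite -[X in _ --> X](mulr0 c); exact: cvgM.
have sa : s y * a @[y --> F] --> c * a by apply: cvgM => //; exact: cvg_cst.
apply/cvgrPdist_le => e e0.
pose e' := e / 2 / (`|c| + 1).
have c1 : 0 < `|c| + 1 by rewrite ltr_wpDl.
have e'0 : 0 < e' by rewrite !divr_gt0.
have e2 : 0 < e / 2 by rewrite divr_gt0.
near=> y.
have dy : 0 < delta y by near: y.
have H1 : `|h (x + s y * delta y) - h x - a * (s y * delta y)| <= e' * `|s y * delta y|.
  by near: y; exact: (sd0 _ (key _ e'0)).
have H2 : `|c * a - s y * a| <= e / 2 by near: y; move/cvgrPdist_le : sa; exact.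
have H3 : `|s y| <= `|c| + 1.
  by near: y; apply: (cvgr_le _ (cvg_norm sc)); rewrite ltrDl.
have -> : c * a - (h (x + s y * delta y) - h x) / delta y =
   (c * a - s y * a) - (h (x + s y * delta y) - h x - a * (s y * delta y)) / delta y.
  by field; rewrite gt_eqF.
rewrite (le_trans (ler_normB _ _))// [leRHS](splitr e) lerD//.
rewrite normrM normfV (gtr0_norm dy) ler_pdivrMr// (le_trans H1)//.
rewrite normrM (gtr0_norm dy) mulrA ler_wpM2r ?(ltW dy)//.
by rewrite -ler_pdivlMl// /e' invfM invrK mulrC mulrA divff ?mul1r ?gt_eqF.
Unshelve. all: by end_near. Qed.

End difference_quotient.

Section design_asymptotics.
Context {R : realType}.
Variables (d0 gamma K : R) (x : nat -> nat -> R).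
Hypotheses (hd0 : 0 < d0 < 1) (hK : 0 < K) (hgamma : 0 < gamma < 3^-1).
Hypothesis hA1 : assumption_A1 d0 x.

Local Notation delta := (halfwidth gamma K).
Local Notation cnt m := (design_count m (x m)).

Lemma density_df01 (G g : R -> R) t : has_density G g -> 0 <= G t <= 1.
Proof.
move=> [mg g0 g1 GE]; rewrite -!lee_fin GE; apply/andP; split.
  by apply: integral_ge0 => s _; rewrite lee_fin.
rewrite -g1; apply: ge0_subset_integral => //.
  exact/measurable_EFinP.
by move=> s _; rewrite lee_fin.
Qed.

(** The empirical distribution function is within o(m^(-1/3)) of G, hence
within o(delta), and G is differentiable at d0. *)
Lemma design_count_cvg : exists2 g0 : R, 0 < g0 &
  forall c : R, ((cnt m (d0 + c * delta m))%:R - (cnt m d0)%:R) / (m%:R * delta m)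
    @[m --> \oo] --> c * g0.
Proof.
have [G [g [dens dG gpos so]]] := hA1.
exists (g d0) => // c.
have /andP[d00 d01] := hd0.
have d0I : 0 <= d0 <= 1 by rewrite !ltW.
pose r m := sup [set `|empirical_df m (x m) t - G t| | t in `[0, 1]].
have rP m t : 0 <= t <= 1 -> `|empirical_df m (x m) t - G t| <= r m.
  move=> t01; apply: ub_le_sup; last by exists t => //=; rewrite in_itv.
  exists 2 => _ [s _ <-]; rewrite (le_trans (ler_normB _ _))//.
  have /andP[G0 G1] := density_df01 s dens.
  rewrite (ger0_norm G0) -[2]/(1 + 1) lerD//.
  rewrite /empirical_df ger0_norm ?divr_ge0//.
  case: m => [|m]; first by rewrite invr0 mulr0.
  by rewrite ler_pdivrMr ?ltr0n// mul1r ler_nat -[leqRHS]card_ord max_card.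
have r0 m : 0 <= r m by apply: le_trans (rP m d0 d0I).
have rd : r m / delta m @[m --> \oo] --> (0 : R).
  have H := cvg_cuberoot_halfwidth K hgamma.
  have /eqoP rH := so.
  apply: (squeeze_cvgr _ (cvg_cst (0 : R)) H).
  have := rH 1 ltr01; apply: filterS2 (nbhs_infty_gt 0) => m m0.
  rewrite mul1r [leRHS]ger0_norm ?powR_ge0// -/(r m) (ger0_norm (r0 m)) => rm.
  have dm := halfwidth_gt0 gamma hK m0.
  by rewrite divr_ge0 ?(ltW dm)//= ler_wpM2r// invr_ge0 ltW.
have dd := cvg_halfwidth K hgamma.
have dpos : \forall m \near \oo, 0 < delta m.
  by apply: filterS (nbhs_infty_gt 0) => m; exact: halfwidth_gt0.
have cd0 : d0 + c * delta m @[m --> \oo] --> d0.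
  rewrite -[X in _ --> X]addr0; apply: cvgD; first exact: cvg_cst.
  by rewrite -[X in _ --> X](mulr0 c); apply: cvgM => //; exact: cvg_cst.
have GD : (G (d0 + c * delta m) - G d0) / delta m @[m --> \oo] --> c * g d0.
  by apply: (cvg_scaled_diff dG dd dpos); exact: cvg_cst.
have er : 2 * (r m / delta m) @[m --> \oo] --> (0 : R).
  by rewrite -[X in _ --> X](mulr0 2); apply: cvgM => //; exact: cvg_cst.
apply/cvgrPdist_le => e e0.
have e2 : 0 < e / 2 by rewrite divr_gt0.
near=> m.
have m0 : (0 < m)%N by near: m; exact: nbhs_infty_gt.
have mR : 0 < m%:R :> R by rewrite ltr0n.
have dm : 0 < delta m by near: m.
have t0 : 0 <= d0 + c * delta m by near: m; exact: (cvgr_ge _ cd0).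
have t1 : d0 + c * delta m <= 1 by near: m; exact: (cvgr_le _ cd0).
have GDm : `|c * g d0 - (G (d0 + c * delta m) - G d0) / delta m| <= e / 2.
  by near: m; move/cvgrPdist_le : GD; exact.
have erm : 2 * (r m / delta m) <= e / 2 by near: m; exact: (cvgr_le _ er).
set t := d0 + c * delta m in t0 t1 GDm *.
have cntE s : (cnt m s)%:R = m%:R * empirical_df m (x m) s.
  by rewrite /empirical_df mulrC divfK ?gt_eqF.
rewrite !cntE -mulrBr.
set A := empirical_df _ _ t; set B := empirical_df _ _ d0.
have HA : `|A - G t| <= r m by apply: rP; rewrite t0.
have HB : `|B - G d0| <= r m by exact: rP.
have -> : c * g d0 - m%:R * (A - B) / (m%:R * delta m) =
   (c * g d0 - (G t - G d0) / delta m) - ((A - G t) - (B - G d0)) / delta m.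
  by field; rewrite !gt_eqF.
rewrite (le_trans (ler_normB _ _))// [leRHS](splitr e) lerD//.
apply: le_trans erm; rewrite normrM normfV (gtr0_norm dm) mulrA ler_wpM2r ?invr_ge0 ?(ltW dm)//.
by rewrite (le_trans (ler_normB _ _))// mulr_natl mulr2n lerD.
Unshelve. all: by end_near. Qed.

End design_asymptotics.

(** * The rate of the first stage *)

Section budget.
Context {R : realType} (p : R).
Hypothesis hp : 0 < p < 1.
Local Notation n1 := (budget1 p).
Local Notation n2 := (budget2 p).

Lemma budget_bounds n : [/\ (n1 n <= n)%N, n%:R * p - 1 <= (n1 n)%:R :> R,
  (n1 n)%:R <= n%:R * p + 1 :> R & (n2 n).*2 = (n - n1 n)%N].
Proof.
have /andP[p0 p1] := hp.
have np0 : 0 <= n%:R * p by rewrite mulr_ge0// ltW.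
have /andP[k1 k2] := truncn_itv np0.
set k := Num.truncn (n%:R * p) in k1 k2 *.
have kn : (k <= n)%N.
  by rewrite -(ler_nat R) (le_trans k1)// ler_piMr// ltW.
rewrite -natr1 in k2.
rewrite /budget2 /budget1 -/k; case: ifPn => [odk|evk].
  have kn' : (k < n)%N by rewrite -subn_gt0; case: (n - k)%N odk.
  split=> //; rewrite -?natr1; [lra|lra|].
  rewrite -[RHS]odd_double_half (_ : odd _ = false) ?add0n//.
  by rewrite subnS; case: (n - k)%N odk => //= j /negbTE.
split=> //; [lra|lra|].
by rewrite -[RHS]odd_double_half (negbTE evk).
Qed.

Lemma budget1_cvg : n1 n @[n --> \oo] --> \oo.
Proof.
have /andP[p0 p1] := hp.
apply/cvgnyPge => A; near=> n.
rewrite -(ler_nat R); have [_ H _ _] := budget_bounds n.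
apply: le_trans H; rewrite lerBrDr -ler_pdivrMr//.
by near: n; exact: nbhs_infty_ger.
Unshelve. all: by end_near. Qed.

Lemma budget2_ratio : (n2 n)%:R / n%:R @[n --> \oo] --> ((1 - p) / 2 : R).
Proof.
have inv0 : (n%:R : R)^-1 @[n --> \oo] --> (0 : R).
  by apply/gtr0_cvgV0; [apply: filterS (nbhs_infty_gt 0) => n n0; rewrite ltr0n|exact: cvgr_idn].
apply/cvgrPdist_le => e e0; near=> n.
have n0 : (0 < n)%N by near: n; exact: nbhs_infty_gt.
have nR : 0 < n%:R :> R by rewrite ltr0n.
have [H0 H1 H2 H3] := budget_bounds n.
have E : (n2 n)%:R * 2 = n%:R - (n1 n)%:R :> R.
  by rewrite -natrM muln2 H3 natrB.
have en : n%:R^-1 <= e by near: n; apply: (cvgr_le _ inv0).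
apply: le_trans en; rewrite -[leRHS]div1r ler_pdivlMr//.
rewrite -[X in _ * X](gtr0_norm nR) -normrM mulrBl divfK ?gt_eqF//.
have -> : (1 - p) / 2 * n%:R - (n2 n)%:R = ((n1 n)%:R - n%:R * p) / 2.
  have -> : (n2 n)%:R = (n%:R - (n1 n)%:R) / 2 :> R by rewrite -E mulfK.
  by field.
by rewrite ler_norml; apply/andP; split; lra.
Unshelve. all: by end_near. Qed.

Lemma sqrt_budget2_ratio :
  Num.sqrt (n2 n)%:R / Num.sqrt n%:R @[n --> \oo] --> (Num.sqrt ((1 - p) / 2) : R).
Proof.
have H : Num.sqrt ((n2 n)%:R / n%:R : R) @[n --> \oo] --> Num.sqrt ((1 - p) / 2 : R).
  by apply: (cvg_comp _ _ budget2_ratio); exact: sqrt_continuous.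
apply: cvg_trans H; apply: near_eq_cvg; apply: nearW => n.
by rewrite sqrtrM// sqrtrV.
Qed.

Lemma budget2_gt0 : \forall n \near \oo, (0 < n2 n)%N.
Proof.
have /andP[p0 p1] := hp.
have : \forall n \near \oo, 0 < (n2 n)%:R / n%:R :> R.
  by apply: (cvgr_gt _ budget2_ratio); rewrite divr_gt0// subr_gt0.
by apply: filterS => n; case: (n2 n) => //; rewrite mul0r ltxx.
Qed.

Lemma budget2_inv : (n2 n)%:R^-1 @[n --> \oo] --> (0 : R).
Proof.
have /andP[p0 p1] := hp.
have inv0 : (n%:R : R)^-1 @[n --> \oo] --> (0 : R).
  by apply/gtr0_cvgV0; [apply: filterS (nbhs_infty_gt 0) => n n0; rewrite ltr0n|exact: cvgr_idn].
have r0 : (1 - p) / 2 != 0 by rewrite gt_eqF// divr_gt0// subr_gt0.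
have : n%:R^-1 / ((n2 n)%:R / n%:R) @[n --> \oo] --> (0 / ((1 - p) / 2) : R).
  by apply: cvgM => //; apply: cvgV => //; exact: budget2_ratio.
rewrite mul0r => H; apply: cvg_trans H; apply: near_eq_cvg.
apply: filterS (nbhs_infty_gt 0) => n n0.
by rewrite invf_div mulrA mulVf ?mul1r// pnatr_eq0 -lt0n.
Qed.

Lemma sqrt_budget2_inv : (Num.sqrt (n2 n)%:R)^-1 @[n --> \oo] --> (0 : R).
Proof.
rewrite -[X in _ --> X]sqrtr0.
have H : Num.sqrt ((n2 n)%:R^-1 : R) @[n --> \oo] --> Num.sqrt (0 : R).
  by apply: (cvg_comp _ _ budget2_inv); exact: sqrt_continuous.
by under eq_fun do rewrite -sqrtrV//.
Qed.

End budget.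

(** The exceptional events may be produced for each n separately. *)
Lemma prob_filter_intro {R : realType} d {Omega : measurableType d} (P : probability Omega R)
    (S : nat -> Omega -> Prop) (b : nat -> R) :
  b n @[n --> \oo] --> (0 : R) ->
  (\forall n \near \oo, exists B, [/\ measurable B, (P B <= (b n)%:E)%E & forall w, ~ B w -> S n w]) ->
  \forall nw \near prob_filter P, S nw.1 nw.2.
Proof.
move=> b0 H.
pose Q n B := [/\ measurable B, (P B <= (b n)%:E)%E & forall w, ~ B w -> S n w].
pose B n := if pselect (exists B, Q n B) is left h then projT1 (cid h) else set0.
have BQ n : (exists B, Q n B) -> Q n (B n).
  by move=> h; rewrite /B; case: pselect => // h'; exact: projT2 (cid h').
have mB n : measurable (B n).
  by rewrite /B; case: pselect => // h; have [] := projT2 (cid h).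
exists B; split => //.
- apply: (squeeze_cvge (f := cst 0%E) (h := fun n => (b n)%:E)).
  + by apply: filterS H => n /BQ[_ ? _]; rewrite measure_ge0.
  + exact: cvg_cst.
  + by apply/fine_cvgP; split; first exact: nearW.
- by apply: filterS H => n /BQ[].
Qed.

Section stage1_rate.
Context {R : realType} d {Omega : measurableType d} (P : probability Omega R).
Variables (f : R -> R) (d0 p gamma K sigma : R) (x : nat -> nat -> R)
    (eps : {RV P >-> R}) (e e' e'' : nat -> nat -> {RV P >-> R}).
Hypotheses (hd0 : 0 < d0 < 1) (hp : 0 < p < 1) (hK : 0 < K)
    (hgamma : 0 < gamma < 3^-1)
    (fmon : {in `[0, 1] &, {homo f : x y / x <= y}}) (a : R) (a0 : 0 < a) (df : is_derive d0 1 f a)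
    (hx : is_design x) (hA1 : assumption_A1 d0 x)
    (heps_mean : ('E_P[eps] = 0)%E) (heps_var : ('V_P[eps] = (sigma ^+ 2)%:E)%E)
    (hA5 : ('E_P[fun w => (eps w ^+ 6)%R] < +oo)%E)
    (herr : iid_copies eps pooled_dom (pooled e e' e'')).
Local Notation n1 := (budget1 p).
Local Notation delta := (halfwidth gamma K).
Local Notation cnt m := (design_count m (x m)).

Lemma orthogonal_errors (g : nat -> option pooled_index) :
  (forall l k, g l = Some k -> pooled_dom k) ->
  (forall l l' k, g l = Some k -> g l' = Some k -> l = l') ->
  orthogonal_rvs P (padded (pooled e e' e'') id g) (sigma ^+ 2).
Proof.
move=> gD ginj; rewrite -(eps_mean_sqr heps_mean heps_var).
apply: (@orthogonal_padded _ _ _ P _ _ _ eps herr id) => //.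
- exact: (integrable_epsX hA5 (isT : (1 <= 6)%N)).
- exact: (integrable_epsX hA5 (isT : (2 <= 6)%N)).
- exact: eps_mean0.
Qed.

(** An excursion of height c1 delta M over M >= c2 n1 delta terms has, by
[dyadic_maximal], a probability of order log^3 n1 / (n1 delta^3), which
vanishes by [cvg_log_halfwidth]. *)
Lemma no_excursion (c1 c2 : R) (N0 : nat -> nat) (g : nat -> nat -> option pooled_index)
    (S : nat -> Omega -> Prop) : 0 < c1 -> 0 < c2 ->
  (forall n l k, g n l = Some k -> pooled_dom k) ->
  (forall n l l' k, g n l = Some k -> g n l' = Some k -> l = l') ->
  (\forall n \near \oo, c2 * ((n1 n)%:R * delta (n1 n)) <= (N0 n)%:R) ->
  (\forall n \near \oo, forall w, ~ S n w ->
    exists2 M, (N0 n <= M <= n1 n)%N &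
    c1 * delta (n1 n) * M%:R <= `|psum (padded (pooled e e' e'') id (g n)) 0 M w|) ->
  \forall nw \near prob_filter P, S nw.1 nw.2.
Proof.
move=> c10 c20 gD ginj HN HS.
pose C := 4 * sigma ^+ 2 / (c1 ^+ 2 * c2).
pose bb m := C * ((up_log 2 m).+1%:R ^+ 3 / (m%:R * delta m ^+ 3)).
have bb0 : bb m @[m --> \oo] --> (0 : R).
  rewrite -[X in _ --> X](mulr0 C); apply: cvgM; first exact: cvg_cst.
  exact: cvg_log_halfwidth.
have b0 : bb (n1 n) @[n --> \oo] --> (0 : R) by apply: (cvg_comp _ _ (budget1_cvg hp)).
apply: (prob_filter_intro b0); near=> n.
have m0 : (0 < n1 n)%N.
  near: n; have := budget1_cvg hp => /cvgnyPgt; exact.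
have mR : 0 < (n1 n)%:R :> R by rewrite ltr0n.
have dm : 0 < delta (n1 n) by exact: halfwidth_gt0.
have Nn : c2 * ((n1 n)%:R * delta (n1 n)) <= (N0 n)%:R by near: n.
have Sn : forall w, ~ S n w -> exists2 M, (N0 n <= M <= n1 n)%N &
    c1 * delta (n1 n) * M%:R <= `|psum (padded (pooled e e' e'') id (g n)) 0 M w|.
  by near: n.
have cm0 : 0 < c2 * ((n1 n)%:R * delta (n1 n)) by rewrite mulr_gt0// mulr_gt0.
have NR : 0 < (N0 n)%:R :> R by apply: lt_le_trans Nn.
have N00 : (0 < N0 n)%N by rewrite -(ltr0n R).
have c0 : 0 < c1 * delta (n1 n) by rewrite mulr_gt0.
have [B [mB PB HB]] := dyadic_maximal (orthogonal_errors (@gD n) (@ginj n)) (n1 n) c0 N00.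
exists B; split => //.
  apply: (le_trans PB); rewrite lee_fin /bb /C.
  set U := (up_log 2 (n1 n)).+1%:R ^+ 3.
  have U0 : 0 <= 4 * U * sigma ^+ 2 by rewrite mulr_ge0 ?sqr_ge0// mulr_ge0// exprn_ge0.
  have -> : 4 * sigma ^+ 2 / (c1 ^+ 2 * c2) * (U / ((n1 n)%:R * delta (n1 n) ^+ 3)) =
     4 * U * sigma ^+ 2 / ((c1 * delta (n1 n)) ^+ 2 * (c2 * ((n1 n)%:R * delta (n1 n)))).
    by field; rewrite !gt_eqF.
  have q2 : 0 < (c1 * delta (n1 n)) ^+ 2 by rewrite exprn_gt0.
  rewrite ler_wpM2l// lef_pV2 ?posrE; [|exact: mulr_gt0|exact: mulr_gt0].
  by rewrite ler_wpM2l// ltW.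
move=> w nB; apply: contrapT => /Sn[M NM].
by rewrite leNgt HB.
Unshelve. all: by end_near. Qed.

Local Notation dl n := (delta (n1 n)).
Local Notation md n := ((n1 n)%:R * dl n).
Local Notation j0 n := (cnt (n1 n) d0).
Local Notation J n c := (cnt (n1 n) (d0 + c * dl n)).

Let design01 m i : (i < m)%N -> 0 <= x m i <= 1. Proof. exact: hx.1. Qed.
Let design_inc m i j : (i < j < m)%N -> x m i < x m j. Proof. exact: hx.2. Qed.
Let d01 : 0 <= d0 <= 1. Proof. by have /andP[? ?] := hd0; rewrite !ltW. Qed.

Let dd : dl n @[n --> \oo] --> (0 : R).
Proof. by apply: (cvg_comp _ _ (budget1_cvg hp)); exact: cvg_halfwidth. Qed.

Let dpos : \forall n \near \oo, 0 < dl n.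
Proof.
have := budget1_cvg hp => /cvgnyPgt /(_ 0%N); apply: filterS => n m0.
exact: halfwidth_gt0.
Qed.

Let fdiff c : (f (d0 + c * dl n) - f d0) / dl n @[n --> \oo] --> c * a.
Proof. by apply: (cvg_scaled_diff df dd dpos); exact: cvg_cst. Qed.

Let cd0 c : d0 + c * dl n @[n --> \oo] --> d0.
Proof.
rewrite -[X in _ --> X]addr0; apply: cvgD; first exact: cvg_cst.
by rewrite -[X in _ --> X](mulr0 c); apply: cvgM; [exact: cvg_cst|exact: dd].
Qed.

Let psum_id (g : nat -> nat -> option pooled_index) n M w : psum (padded (pooled e e' e'') id (g n)) 0 M w =
  \sum_(l < M) (if g n l is Some k then pooled e e' e'' k w else 0).
Proof. by apply: eq_bigr => l _; rewrite add0n. Qed.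

(** What happens between d0 and d0 + s eta delta, on the right for s = 1 and on
the left for s = -1. With g0 the density at d0, A and B are close to
eta g0 n1 delta and to a half of it, and the signal at the middle is close to
a eta delta / 2; the bounds are weaker by constant factors. *)
Lemma stage1_window (s eta : R) : s ^+ 2 = 1 -> 0 < eta ->
  exists2 c, 0 < c & \forall n \near \oo,
    let A := s * ((J n (s * eta))%:R - (j0 n)%:R) in
    let B := s * ((J n (s * (eta / 2)))%:R - (j0 n)%:R) in
    [/\ (0 < n1 n)%N, c * md n <= A /\ A <= 4 * (A - B),
        a * (eta / 4) * dl n <= s * (f (d0 + s * (eta / 2) * dl n) - f d0) &
        0 <= d0 + s * eta * dl n <= 1].
Proof.
move=> s2 eta0; have [g0 g00 Hc] := design_count_cvg hd0 hK hgamma hA1.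
have ss t : s * (s * t) = t by rewrite mulrA -expr2 s2 mul1r.
have H c : s * ((J n (s * c))%:R - (j0 n)%:R) / md n @[n --> \oo] --> c * g0.
  rewrite -[X in _ --> X]ss [s * (c * g0)]mulrA; under eq_fun do rewrite -mulrA.
  by apply: cvgM; [exact: cvg_cst|exact: (cvg_comp _ _ (budget1_cvg hp) (Hc _))].
have H1 := H (eta / 2); have H2 := H eta.
have F : s * (f (d0 + s * (eta / 2) * dl n) - f d0) / dl n @[n --> \oo] --> eta / 2 * a.
  rewrite -[X in _ --> X]ss [s * (_ * a)]mulrA; under eq_fun do rewrite -mulrA.
  by apply: cvgM; [exact: cvg_cst|exact: fdiff].
have eg : 0 < eta * g0 by rewrite mulr_gt0.
have ae : 0 < a * eta by rewrite mulr_gt0.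
exists (eta * g0 / 2); first by rewrite divr_gt0.
near=> n.
have m0 : (0 < n1 n)%N by near: n; have := budget1_cvg hp => /cvgnyPgt; exact.
have dm : 0 < dl n by exact: halfwidth_gt0.
have md0 : 0 < md n by rewrite mulr_gt0 ?ltr0n.
have A1 : (9 / 10) * (eta * g0) * md n <= s * ((J n (s * eta))%:R - (j0 n)%:R).
  rewrite -ler_pdivlMr//; near: n; apply: (cvgr_ge _ H2); lra.
have B1 : s * ((J n (s * (eta / 2)))%:R - (j0 n)%:R) <= (6 / 10) * (eta * g0) * md n.
  rewrite -ler_pdivrMr//; near: n; apply: (cvgr_le _ H1); lra.
have X0 := mulr_gt0 eg md0.
have E c : c * (eta * g0) * md n = c * (eta * g0 * md n) by rewrite !mulrA.
rewrite !E in A1 B1; split => //.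
- by rewrite [eta * g0 / 2]mulrC E; split; lra.
- rewrite -ler_pdivlMr//; near: n; apply: (cvgr_ge _ F); lra.
- apply/andP; split; near: n; [apply: (cvgr_ge _ (cd0 (s * eta)))|apply: (cvgr_le _ (cd0 (s * eta)))];
    by have /andP[] := hd0.
Unshelve. all: by end_near. Qed.

(** The outer half of the interval from d0 to d0 + eta delta holds a quarter of
its design points, and the signal there is of order delta: if the estimate lies
further right, [excursion_right] exhibits an excursion of the kind that
[no_excursion] excludes. *)
Lemma stage1_upper eta : 0 < eta ->
  \forall nw \near prob_filter P,
    stage1_estimate f d0 p x e nw.1 nw.2 <= d0 + eta * delta (n1 nw.1).
Proof.
move=> eta0; have [c2 c20 W] := stage1_window (expr1n _ 2) eta0.
pose window n := [/\ (0 < n1 n)%N, c2 * md n <= (J n eta)%:R - (j0 n)%:R /\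
     (J n eta)%:R - (j0 n)%:R <= 4 * ((J n eta)%:R - (j0 n)%:R - ((J n (eta / 2))%:R - (j0 n)%:R)) :> R,
     a * (eta / 4) * dl n <= f (d0 + eta / 2 * dl n) - f d0 & 0 <= d0 + eta * dl n <= 1].
have {}W : \forall n \near \oo, window n by apply: filterS W => n; rewrite !mul1r.
pose g n l : option pooled_index := if (j0 n + l < n1 n)%N then Some (inl (inl (n, j0 n + l)%N)) else None.
(* The slope a eta / 4 of the window, divided by the 4 of the excursion lemma. *)
have c10 : 0 < a * eta / 16 by rewrite divr_gt0// mulr_gt0.
apply: (@no_excursion (a * eta / 16) c2 (fun n => J n eta - j0 n)%N g
  (fun n w => stage1_estimate f d0 p x e n w <= d0 + eta * dl n)) => //.
- move=> n l k; rewrite /g; case: ifP => // lm [<-] /=.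
  by have [? _ _ _] := budget_bounds hp n; apply: leq_trans lm _.
- by move=> n l l' k; rewrite /g; case: ifP => // _ [<-]; case: ifP => // _ [] /addnI.
- apply: filterS W => n -[m0 [A1 _] _ _]; apply: (le_trans A1).
  by rewrite lerBlDr -natrD ler_nat addnC -leq_subLR.
near=> n => w /negP; rewrite -ltNge => td.
have [m0 [A1 A4] fk /andP[_ t21]] : window n by near: n.
have dm : 0 < dl n by exact: halfwidth_gt0.
have A0 : 0 < (J n eta)%:R - (j0 n)%:R :> R.
  by apply: lt_le_trans A1; rewrite mulr_gt0// mulr_gt0// ltr0n.
have ed : 0 < eta * dl n by rewrite mulr_gt0.
have t12 : d0 <= d0 + eta / 2 * dl n <= d0 + eta * dl n by apply/andP; split; lra.
have j02 : (j0 n < J n eta)%N by rewrite -(ltr_nat R) -subr_gt0.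
have j12 : (J n (eta / 2) <= J n eta)%N by apply: design_count_mono; case/andP: t12.
have j012 : (J n eta - j0 n <= 4 * (J n eta - J n (eta / 2)))%N.
  by rewrite -(ler_nat R) natrM !natrB ?(ltnW j02)//; lra.
have [M NM HM] := excursion_right (@design01 (n1 n)) (@design_inc (n1 n)) fmon d01 t12 t21 j02 j012 td.
exists M => //; rewrite psum_id.
rewrite (eq_bigr (fun l : 'I_M => if (j0 n + l < n1 n)%N
  then stage1_response f p x e n w (j0 n + l) - f (x (n1 n) (j0 n + l)%N) else 0)).
  by apply: le_trans HM; rewrite ler_wpM2r//; lra.
move=> l _; rewrite /g; case: ifP => //= _.
by rewrite /stage1_response addrAC subrr add0r.
Unshelve. all: by end_near. Qed.

(** The mirror image. *)
Lemma stage1_lower eta : 0 < eta ->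
  \forall nw \near prob_filter P,
    d0 - eta * delta (n1 nw.1) <= stage1_estimate f d0 p x e nw.1 nw.2.
Proof.
move=> eta0; have [c2 c20 W] := stage1_window (etrans (sqrrN 1) (expr1n _ 2)) eta0.
pose window n := [/\ (0 < n1 n)%N, c2 * md n <= (j0 n)%:R - (J n (- eta))%:R /\
     (j0 n)%:R - (J n (- eta))%:R <= 4 * ((j0 n)%:R - (J n (- eta))%:R + ((J n (- (eta / 2)))%:R - (j0 n)%:R)) :> R,
     a * (eta / 4) * dl n <= f d0 - f (d0 + - (eta / 2) * dl n) & 0 <= d0 + - eta * dl n <= 1].
have {}W : \forall n \near \oo, window n.
  by apply: filterS W => n; rewrite !mulN1r !opprB.
pose g n l : option pooled_index := if (l < j0 n)%N then Some (inl (inl (n, j0 n - l.+1)%N)) else None.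
(* The slope a eta / 4 of the window, divided by the 4 of the excursion lemma. *)
have c10 : 0 < a * eta / 16 by rewrite divr_gt0// mulr_gt0.
apply: (@no_excursion (a * eta / 16) c2 (fun n => j0 n - J n (- eta))%N g
  (fun n w => d0 - eta * dl n <= stage1_estimate f d0 p x e n w)) => //.
- move=> n l k; rewrite /g; case: ifP => // lm [<-] /=.
  have [H _ _ _] := budget_bounds hp n; apply: leq_trans H.
  have := design_count_le (n1 n) (x (n1 n)) d0; move: lm; clear; lia.
- move=> n l l' k; rewrite /g; case: ifP => // lm [<-]; case: ifP => // lm' [].
  by move: lm lm'; clear; lia.
- apply: filterS W => n -[m0 [A1 _] _ _]; apply: (le_trans A1).
  by rewrite lerBlDr -natrD ler_nat addnC -leq_subLR.
near=> n => w /negP; rewrite -ltNge => td.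
have [m0 [A1 A4] fk /andP[t20 _]] : window n by near: n.
have dm : 0 < dl n by exact: halfwidth_gt0.
have A0 : 0 < (j0 n)%:R - (J n (- eta))%:R :> R.
  by apply: lt_le_trans A1; rewrite mulr_gt0// mulr_gt0// ltr0n.
have ed : 0 < eta * dl n by rewrite mulr_gt0.
have t12 : d0 + - eta * dl n <= d0 + - (eta / 2) * dl n <= d0 by apply/andP; split; lra.
have {}td : stage1_estimate f d0 p x e n w < d0 + - eta * dl n by rewrite mulNr.
have j02 : (J n (- eta) < j0 n)%N by rewrite -(ltr_nat R) -subr_gt0.
have j12 : (J n (- eta) <= J n (- (eta / 2)))%N by apply: design_count_mono; case/andP: t12.
have j012 : (j0 n - J n (- eta) <= 4 * (J n (- (eta / 2)) - J n (- eta)))%N.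
  by rewrite -(ler_nat R) natrM !natrB ?(ltnW j02)//; lra.
have [M NM HM] := excursion_left (@design01 (n1 n)) (@design_inc (n1 n)) fmon d01 t12 t20 j02 j012 td.
exists M => //; rewrite psum_id.
rewrite (eq_bigr (fun l : 'I_M => if (l < j0 n)%N
  then stage1_response f p x e n w (j0 n - l.+1) - f (x (n1 n) (j0 n - l.+1)%N) else 0)).
  by apply: le_trans HM; rewrite ler_wpM2r//; lra.
move=> l _; rewrite /g; case: ifP => //= _.
by rewrite /stage1_response addrAC subrr add0r.
Unshelve. all: by end_near. Qed.

Lemma stage1_rate :
  (stage1_estimate f d0 p x e nw.1 nw.2 - d0) / delta (n1 nw.1) @[nw --> prob_filter P] --> (0 : R).
Proof.
apply/cvgrPdist_le => eta eta0.
have U := stage1_upper eta0; have L := stage1_lower eta0.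
have D := prob_filter_near P dpos.
apply: filterS3 U L D => -[n w] /= U L D.
rewrite sub0r normrN normrM normfV (gtr0_norm D) ler_pdivrMr// ler_norml.
by apply/andP; split; lra.
Qed.

End stage1_rate.

(** * The second-stage samples *)

Section row_statistics.
Context {R : realType} d {Omega : measurableType d} (P : probability Omega R).
Variables (p gamma K sigma : R) (eps : {RV P >-> R}) (e e' e'' : nat -> nat -> {RV P >-> R}).
Hypotheses (hp : 0 < p < 1) (hK : 0 < K) (hgamma : 0 < gamma < 3^-1)
    (heps_mean : ('E_P[eps] = 0)%E) (heps_var : ('V_P[eps] = (sigma ^+ 2)%:E)%E)
    (hA5 : ('E_P[fun w => (eps w ^+ 6)%R] < +oo)%E)
    (herr : iid_copies eps pooled_dom (pooled e e' e'')).
Variables (iota : nat -> nat -> pooled_index).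
Hypotheses (iota_inj : forall n i j, iota n i = iota n j -> i = j)
  (iota_dom : forall n i, (i < n)%N -> pooled_dom (iota n i)).
Local Notation er n i := (pooled e e' e'' (iota n i)).
Local Notation k := (budget2 p).
Local Notation delta n := (halfwidth gamma K (budget1 p n)).

Definition row_mean (phi : R -> R) n w : R := unif_mean (fun i : 'I_(k n) => phi (er n i w)).

Let kn n : (k n <= n)%N.
Proof.
have [_ _ _ H] := budget_bounds hp n.
by rewrite -leq_double H (leq_trans (leq_subr _ _))// -addnn leq_addr.
Qed.

Let k0 : \forall n \near \oo, (0 < k n)%N. Proof. exact: (budget2_gt0 hp). Qed.

(** The summands are centred and orthogonal, so the second moment of the mean is
of order 1 / k. *)
Lemma row_mean_cvg0 (phi : R -> R) (c : nat -> R) : measurable_fun setT phi ->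
  P.-integrable setT (fun w => (phi (eps w))%:E) ->
  P.-integrable setT (fun w => (phi (eps w) ^+ 2)%:E) ->
  \int[P]_w phi (eps w) = 0 ->
  c n ^+ 2 / (k n)%:R @[n --> \oo] --> (0 : R) ->
  c nw.1 * row_mean phi nw.1 nw.2 @[nw --> prob_filter P] --> (0 : R).
Proof.
move=> mphi iphi iphi2 phi0 ck.
pose g n l := if (l < k n)%N then Some (iota n l) else None.
have gD n l j : g n l = Some j -> pooled_dom j.
  by rewrite /g; case: ifP => // lk [<-]; apply: iota_dom; exact: leq_trans (kn n).
have ginj n l l' j : g n l = Some j -> g n l' = Some j -> l = l'.
  by rewrite /g; case: ifP => // _ [<-]; case: ifP => // _ [] /iota_inj.
have orth n := orthogonal_padded herr mphi iphi iphi2 phi0 (@gD n) (@ginj n).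
set s2 := \int[P]_w _ in orth.
have E n w : row_mean phi n w = psum (padded (pooled e e' e'') phi (g n)) 0 (k n) w / (k n)%:R.
  rewrite /row_mean /unif_mean card_ord; congr (_ / _); apply: eq_bigr => i _.
  by rewrite /padded add0n /g ltn_ord.
pose X n w := (c n * row_mean phi n w) ^+ 2.
have EX n w : X n w = (c n / (k n)%:R) ^+ 2 * psum (padded (pooled e e' e'') phi (g n)) 0 (k n) w ^+ 2.
  by rewrite /X E; ring.
have XE n : X n = fun w => (c n / (k n)%:R) ^+ 2 * psum (padded (pooled e e' e'') phi (g n)) 0 (k n) w ^+ 2.
  exact/funext.
have H : X nw.1 nw.2 @[nw --> prob_filter P] --> (0 : R).
  apply: cvg_prob_filter_mean0.
  - move=> n; rewrite XE.
    by apply: measurable_funM => //; apply: measurable_funX; exact: (measurable_psum (orth n)).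
  - apply: nearW => n; rewrite XE.
    exact: (integrableZl measurableT _ (psum_sqr (orth n) 0 (k n)).1).
  - by move=> n w; exact: sqr_ge0.
  - have ub : c n ^+ 2 / (k n)%:R * s2 @[n --> \oo] --> (0 : R).
      by rewrite -[X in _ --> X](mul0r s2); apply: cvgM => //; exact: cvg_cst.
    apply: (squeeze_cvgr _ (cvg_cst (0 : R)) ub).
    apply: filterS k0 => n kn0; apply/andP; split.
      by apply: Rintegral_ge0 => w _; exact: sqr_ge0.
    have [i1 i2] := psum_sqr (orth n) 0 (k n).
    under eq_Rintegral do rewrite EX.
    rewrite RintegralZl// (le_trans (ler_wpM2l (sqr_ge0 _) i2))//.
    rewrite le_eqVlt; apply/orP; left; apply/eqP.
    by field; rewrite pnatr_eq0 -lt0n.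
apply/cvgrPdist_le => eta eta0.
have eta2 : 0 < eta ^+ 2 by rewrite exprn_gt0.
have : \forall nw \near prob_filter P, X nw.1 nw.2 <= eta ^+ 2 by exact: (cvgr_le _ H).
apply: filterS => -[n w]/= H1.
rewrite sub0r normrN -ler_sqr ?nnegrE ?normr_ge0 ?(ltW eta0)//.
by rewrite real_normK ?num_real.
Qed.

(** Markov's inequality: all terms are nonnegative, and c times the row mean has
expectation c times that of phi. *)
Lemma row_mean_ge0_cvg0 (phi : R -> R) (c : nat -> R) : measurable_fun setT phi ->
  (forall t, 0 <= phi t) -> (forall n, 0 <= c n) ->
  P.-integrable setT (fun w => (phi (eps w))%:E) ->
  c n @[n --> \oo] --> (0 : R) ->
  c nw.1 * row_mean phi nw.1 nw.2 @[nw --> prob_filter P] --> (0 : R).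
Proof.
move=> mphi phi0 c0 iphi cc.
have [_ idd] := herr.
pose X n w := c n * row_mean phi n w.
have XE n w : X n w = (c n / (k n)%:R) * \sum_(i < k n) phi (er n i w).
  by rewrite /X /row_mean /unif_mean card_ord; ring.
have I n (i : 'I_(k n)) : P.-integrable setT (fun w => (phi (er n i w))%:E) /\
     \int[P]_w phi (er n i w) = \int[P]_w phi (eps w).
  apply: eq_distribution_mean => // A mA; apply: idd => //.
  by apply: iota_dom; exact: leq_trans (ltn_ord i) (kn n).
have IS n := Rintegral_sum (index_enum 'I_(k n)) (fun i => (I n i).1).
have iX n : P.-integrable setT (fun w => (X n w)%:E).
  rewrite (_ : (fun w => (X n w)%:E) = (fun w => ((c n / (k n)%:R) * \sum_(i < k n) phi (er n i w))%:E)); last first.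
    by apply/funext => w; rewrite XE.
  exact: (integrableZl measurableT _ (IS n).1).
have X0 n w : 0 <= X n w.
  by rewrite XE mulr_ge0 ?sumr_ge0// divr_ge0.
apply: (cvg_prob_filter_mean0 (X := X)) => //.
- by move=> n; apply/measurable_EFinP; exact: measurable_int (iX n).
- by apply: nearW => n; exact: iX.
- have ub : c n * \int[P]_w phi (eps w) @[n --> \oo] --> (0 : R).
    by rewrite -[X in _ --> X](mul0r (\int[P]_w phi (eps w))); apply: cvgM => //; exact: cvg_cst.
  apply: cvg_trans ub; apply: near_eq_cvg; apply: filterS k0 => n kn0.
  under [RHS]eq_Rintegral do rewrite XE.
  rewrite RintegralZl; [|exact: measurableT|exact: (IS n).1].
  rewrite (IS n).2 (eq_bigr (fun=> \int[P]_w phi (eps w))); last by move=> i _; exact: (I n i).2.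
  rewrite sumr_const card_ord -[_ *+ _]mulr_natl.
  by field; rewrite pnatr_eq0 -lt0n.
Qed.

Lemma cvg_sqrtn_halfwidth : (Num.sqrt (n%:R : R) * delta n)^-1 @[n --> \oo] --> (0 : R).
Proof.
have H : (Num.sqrt ((budget1 p n)%:R : R) * delta n)^-1 @[n --> \oo] --> (0 : R).
  exact: (cvg_comp _ _ (budget1_cvg hp) (cvg_sqrt_halfwidth K hgamma)).
apply: (squeeze_cvgr _ (cvg_cst (0 : R)) H).
have := budget1_cvg hp => /cvgnyPgt /(_ 0%N); apply: filterS => n m0.
have dm := halfwidth_gt0 gamma hK m0.
have [bn _ _ _] := budget_bounds hp n.
have s1 : 0 < Num.sqrt (budget1 p n)%:R :> R by rewrite sqrtr_gt0 ltr0n.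
have sn : 0 < Num.sqrt n%:R :> R by rewrite sqrtr_gt0 ltr0n (leq_trans m0).
rewrite invr_ge0 mulr_ge0 ?(ltW sn) ?(ltW dm)//=.
rewrite lef_pV2 ?posrE; [|exact: mulr_gt0|exact: mulr_gt0].
by rewrite ler_wpM2r ?(ltW dm)// ler_wsqrtr// ler_nat.
Qed.

Lemma cvg_halfwidth_budget2 : (delta n)^-1 ^+ 2 / (k n)%:R @[n --> \oo] --> (0 : R).
Proof.
have /andP[p0 p1] := hp.
have r0 : (1 - p) / 2 != 0 by rewrite gt_eqF// divr_gt0// subr_gt0.
have H : (Num.sqrt (n%:R : R) * delta n)^-1 ^+ 2 / ((k n)%:R / n%:R) @[n --> \oo] --> (0 ^+ 2 / ((1 - p) / 2) : R).
  apply: cvgM.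
    by apply: (cvg_comp _ (fun t => t ^+ 2) cvg_sqrtn_halfwidth); exact: exprn_continuous.
  by apply: cvgV => //; exact: budget2_ratio.
rewrite expr0n/= mul0r in H; apply: cvg_trans H; apply: near_eq_cvg.
apply: filterS2 k0 (nbhs_infty_gt 0) => n kn0 n0.
have nR : 0 < n%:R :> R by rewrite ltr0n.
have kR : 0 < (k n)%:R :> R by rewrite ltr0n.
rewrite !exprVn exprMn sqr_sqrtr ?(ltW nR)//.
by move: (delta n) => D; rewrite !invfM invrK [_ * n%:R]mulrC mulrACA mulVf ?mul1r// gt_eqF.
Qed.

Let Z := row_mean id.

Let i_eps j : (j <= 6)%N -> P.-integrable setT (fun w => (eps w ^+ j)%:E).
Proof. exact: integrable_epsX. Qed.

Let mean_id_cvg0 (c : nat -> R) : c n ^+ 2 / (k n)%:R @[n --> \oo] --> (0 : R) ->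
  c nw.1 * Z nw.1 nw.2 @[nw --> prob_filter P] --> (0 : R).
Proof.
move=> ck; apply: row_mean_cvg0 => //.
- exact: (i_eps (isT : (1 <= 6)%N)).
- exact: (i_eps (isT : (2 <= 6)%N)).
- exact: eps_mean0.
Qed.

Lemma row_mean_scaled_cvg : Z nw.1 nw.2 / delta nw.1 @[nw --> prob_filter P] --> (0 : R).
Proof.
have := mean_id_cvg0 cvg_halfwidth_budget2.
by apply: cvg_trans; apply: near_eq_cvg; apply: nearW => nw; rewrite mulrC.
Qed.

Lemma row_mean_cvg : Z nw.1 nw.2 @[nw --> prob_filter P] --> (0 : R).
Proof.
have /mean_id_cvg0 : (fun=> 1 : R) n ^+ 2 / (k n)%:R @[n --> \oo] --> (0 : R).
  by under eq_fun do rewrite expr1n mul1r; exact: budget2_inv.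
by under eq_fun do rewrite mul1r.
Qed.

Variable b : nat * Omega -> R.
Let Y (nw : nat * Omega) (i : 'I_(k nw.1)) : R := b nw + er nw.1 i nw.2.

Let knear : \forall nw \near prob_filter P, (0 < k nw.1)%N.
Proof. exact: (prob_filter_near P k0). Qed.

Lemma unif_mean_translated nw : (0 < k nw.1)%N -> unif_mean (@Y nw) = b nw + Z nw.1 nw.2.
Proof.
by move=> kn0; rewrite /Y unif_meanD unif_mean_cst// card_ord.
Qed.

Let centered nw i : (0 < k nw.1)%N -> @Y nw i - unif_mean (@Y nw) = er nw.1 i nw.2 - Z nw.1 nw.2.
Proof. by move=> kn0; rewrite unif_mean_translated// /Y; ring. Qed.

(** The empirical variance is translation invariant, and equals the mean square
of the errors minus the square of their mean. *)
Lemma emp_variance_cvg : emp_cmoment 2 (@Y nw) @[nw --> prob_filter P] --> sigma ^+ 2.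
Proof.
pose phi (t : R) := t ^+ 2 - sigma ^+ 2.
have i2 := i_eps (isT : (2 <= 6)%N).
have i4 := i_eps (isT : (4 <= 6)%N).
have ic (c : R) : P.-integrable setT (fun=> c%:E) by exact: finite_measure_integrable_cst.
have H : (fun=> 1 : R) nw.1 * row_mean phi nw.1 nw.2 @[nw --> prob_filter P] --> (0 : R).
  apply: (@row_mean_cvg0 phi (fun=> 1)).
  - by apply: measurable_funB => //; exact: measurable_funX.
  - exact: (integrableB measurableT i2 (ic _)).
  - have := integrableD measurableT (integrableB measurableT i4 (integrableZl measurableT (2 * sigma ^+ 2) i2)) (ic (sigma ^+ 4)).
    apply: eq_integrable => // w _ /=; congr EFin.
    by rewrite /phi; ring.
  - rewrite (RintegralB measurableT i2 (ic _)) Rintegral_cst//.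
    rewrite (_ : fine (P setT) = 1) ?probability_setT// mulr1.
    by rewrite (eps_mean_sqr heps_mean heps_var) subrr.
  - by under eq_fun do rewrite expr1n mul1r; exact: budget2_inv.
have HZ := row_mean_cvg.
have : sigma ^+ 2 + (1 * row_mean phi nw.1 nw.2) - Z nw.1 nw.2 * Z nw.1 nw.2 @[nw --> prob_filter P]
    --> sigma ^+ 2 + 0 - 0 * 0.
  by apply: cvgB; [apply: cvgD => //; exact: cvg_cst|exact: cvgM].
rewrite mulr0 subr0 addr0; apply: cvg_trans; apply: near_eq_cvg.
apply: filterS knear => -[n w] /= kn0.
rewrite /emp_cmoment.
have I0 : (0 < #|'I_(k n)|)%N by rewrite card_ord.
rewrite (_ : (fun i => `|@Y (n, w) i - unif_mean (@Y (n, w))| ^+ 2) =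
  (fun i : 'I_(k n) => (phi (er n i w) + sigma ^+ 2) - 2 * Z n w * er n i w + Z n w ^+ 2)); last first.
  by apply/funext => i; rewrite centered// real_normK ?num_real// /phi; ring.
rewrite unif_meanD unif_meanB unif_meanD unif_meanZ !unif_mean_cst//.
by rewrite -/(row_mean phi n w) -[unif_mean (fun i : 'I_(k n) => er n i w)]/(Z n w); ring.
Qed.

(** |t - z|^3 <= 4 (1 + t^4 + |z|^3), and the fourth moment of the errors is
finite. *)
Lemma emp_third_moment_cvg :
  emp_cmoment 3 (@Y nw) * (Num.sqrt (k nw.1)%:R)^-1 @[nw --> prob_filter P] --> (0 : R).
Proof.
pose isk n : R := (Num.sqrt (k n)%:R)^-1.
have sk : isk n @[n --> \oo] --> (0 : R) by exact: sqrt_budget2_inv.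
have i4 := i_eps (isT : (4 <= 6)%N).
have H4 : isk nw.1 * row_mean (fun t => t ^+ 4) nw.1 nw.2 @[nw --> prob_filter P] --> (0 : R).
  apply: row_mean_ge0_cvg0 => //.
  - by move=> t; rewrite -[4%N]/(2 * 2)%N exprM sqr_ge0.
  - by move=> n; rewrite invr_ge0 sqrtr_ge0.
have skP : isk nw.1 @[nw --> prob_filter P] --> (0 : R) by exact: cvg_prob_filter_fst.
have HZ : `|Z nw.1 nw.2| ^+ 3 @[nw --> prob_filter P] --> `|0 : R| ^+ 3.
  apply: (cvg_comp _ (fun t => t ^+ 3) (cvg_norm row_mean_cvg)); exact: exprn_continuous.
have ub : 4 * (isk nw.1 + isk nw.1 * row_mean (fun t => t ^+ 4) nw.1 nw.2 + isk nw.1 * `|Z nw.1 nw.2| ^+ 3)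
     @[nw --> prob_filter P] --> 4 * (0 + 0 + 0 * `|0 : R| ^+ 3).
  apply: cvgM; first exact: cvg_cst.
  by apply: cvgD; [exact: cvgD|exact: cvgM].
rewrite mul0r !addr0 mulr0 in ub.
apply: (squeeze_cvgr _ (cvg_cst (0 : R)) ub).
apply: filterS knear => -[n w] /= kn0.
have I0 : (0 < #|'I_(k n)|)%N by rewrite card_ord.
have is0 : 0 <= isk n by rewrite invr_ge0 sqrtr_ge0.
apply/andP; split; first by rewrite mulr_ge0// cmoment_ge0.
have -> : 4 * (isk n + isk n * row_mean (fun t => t ^+ 4) n w + isk n * `|Z n w| ^+ 3) =
   (4 * (1 + row_mean (fun t => t ^+ 4) n w + `|Z n w| ^+ 3)) * isk n by ring.
rewrite ler_wpM2r// /emp_cmoment.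
have -> : 4 * (1 + row_mean (fun t => t ^+ 4) n w + `|Z n w| ^+ 3) =
  unif_mean (fun i : 'I_(k n) => 4 * (1 + er n i w ^+ 4 + `|Z n w| ^+ 3)).
  by rewrite unif_meanZ !unif_meanD !unif_mean_cst.
apply: le_unif_mean => i; rewrite centered//.
set t := er n i w; set z := Z n w.
have tz : `|t - z| <= `|t| + `|z| by exact: ler_normB.
have t3 : `|t| ^+ 3 <= 1 + t ^+ 4.
  have t4 : 0 <= t ^+ 4 by rewrite -[4%N]/(2 * 2)%N exprM sqr_ge0.
  have [t1|t1] := leP `|t| 1.
    by rewrite (le_trans (exprn_ile1 _ _ t1))// lerDl.
  apply: (@le_trans _ _ (`|t| ^+ 4)); first by rewrite ler_weXn2l// ltW.
  by rewrite -normrX ger0_norm// lerDr.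
apply: (@le_trans _ _ ((`|t| + `|z|) ^+ 3)).
  by rewrite lerXn2r ?nnegrE// addr_ge0.
have : (`|t| + `|z|) ^+ 3 <= 4 * (`|t| ^+ 3 + `|z| ^+ 3).
  rewrite -subr_ge0.
  have -> : 4 * (`|t| ^+ 3 + `|z| ^+ 3) - (`|t| + `|z|) ^+ 3 = 3 * ((`|t| + `|z|) * (`|t| - `|z|) ^+ 2) by ring.
  by rewrite mulr_ge0// mulr_ge0 ?sqr_ge0// addr_ge0.
by move: t3; move: (`|t| ^+ 3) (`|z| ^+ 3) ((_ + _) ^+ 3) => *; lra.
Qed.

End row_statistics.

(** * Measurability *)

Section measurability.
Context {R : realType} d {Omega : measurableType d}.
Implicit Types X Y : Omega -> R.

Lemma measurable_invr : measurable_fun [set: R] (fun t : R => t^-1).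
Proof.
have o0 : open [set~ (0 : R)] by apply: closed_openC; exact: closed_eq.
rewrite (_ : setT = [set~ 0] `|` [set (0 : R)]); last first.
  by apply/seteqP; split => t //= _; have [->|/eqP] := eqVneq t 0; [right|left].
apply/measurable_funU.
- by apply: open_measurable; exact: o0.
- exact: measurable_set1.
split; last exact: measurable_fun_set1.
apply: open_continuous_measurable_fun; first exact: o0.
by move=> t; rewrite inE/= => /eqP t0; exact: inv_continuous.
Qed.

Lemma measurable_fun_div X Y : measurable_fun setT X -> measurable_fun setT Y ->
  measurable_fun setT (fun w => X w / Y w).
Proof.
move=> mX mY; apply: measurable_funM => //.
exact: measurableT_comp measurable_invr mY.
Qed.

Lemma measurable_unif_mean (T : finType) (X : T -> Omega -> R) :
  (forall t, measurable_fun setT (X t)) -> measurable_fun setT (fun w => unif_mean (X ^~ w)).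
Proof.
by move=> mX; apply: measurable_funM => //; apply: measurable_sum.
Qed.

(** A variable determined by a finite-valued one has finitely many values. *)
Lemma measurable_factor_finite (T : finType) (B : Omega -> T) X :
  (forall b, measurable [set w | B w = b]) ->
  (forall w w', B w = B w' -> X w = X w') -> measurable_fun setT X.
Proof.
move=> mB XB _ A mA; rewrite setTI.
rewrite (_ : X @^-1` A = \bigcup_(b in [set b | exists w, B w = b /\ A (X w)]) [set w | B w = b]).
  by apply: fin_bigcup_measurable => // ; exact: finite_finset.
apply/seteqP; split => w /=.
  by move=> Aw; exists (B w) => //; exists w.
by move=> [_ [w' [<- Aw']] Bw]; rewrite (XB _ _ Bw).
Qed.

Section stage1.
Variables (m : nat) (x : nat -> R) (Y : Omega -> nat -> R) (theta : R).
Hypothesis m0 : (0 < m)%N.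
Hypothesis mY : forall i, (i < m)%N -> measurable_fun setT (Y ^~ i).

Let fit_ge w : {ffun 'I_m -> bool} := [ffun k : 'I_m => theta <= isotonic_fit m (Y w) k].

Let measurable_fit_ge (k : 'I_m) : measurable [set w | theta <= isotonic_fit m (Y w) k].
Proof.
pose S (i j : 'I_m) w := \sum_(i <= l < j.+1) (Y w l - theta).
have mS i j : measurable_fun setT (S i j).
  rewrite (_ : S i j = fun w => \sum_(l < m) (if (i <= l <= j)%N then Y w l - theta else 0)); last first.
    apply/funext => w; transitivity (\sum_(l < m | (i <= l <= j)%N) (Y w l - theta)).
      exact/esym/(sum_nat_widen i (fun l => Y w l - theta) (ltn_ord j)).
    exact: big_mkcond.
  apply: measurable_sum => l; case: (i <= l <= j)%N => //.
  by apply: measurable_funB => //; apply: mY.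
rewrite (_ : [set w | _] = \bigcup_(i in [set i : 'I_m | (i <= k)%N])
    \bigcap_(j in [set j : 'I_m | (k <= j)%N]) [set w | 0 <= S i j w]).
  apply: fin_bigcup_measurable; first exact: finite_finset.
  move=> i _; apply: fin_bigcap_measurable; first exact: finite_finset.
  by move=> j _; exact: measurable_ge_cst.
apply/seteqP; split => w /=; rewrite isotonic_fit_geP//.
  move=> /existsP[i /andP[ik /forallP H]]; exists i => // j /= kj.
  exact: (implyP (H j)).
move=> [i /= ik H]; apply/existsP; exists i; rewrite ik/=.
by apply/forallP => j; apply/implyP => kj; exact: H.
Qed.

(** The estimate depends on the responses through the Booleans
theta <= fit k only, and each of them is a finite combination of linear
inequalities by [isotonic_fit_geP]. *)
Lemma measurable_dhat1 : measurable_fun setT (fun w => dhat1 m x (Y w) theta).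
Proof.
apply: (@measurable_factor_finite _ fit_ge).
  move=> b; rewrite (_ : [set w | fit_ge w = b] = \bigcap_(k in [set: 'I_m]) [set w | (theta <= isotonic_fit m (Y w) k) = b k]).
    apply: fin_bigcap_measurable => [|k _]; first exact: finite_finset.
    case: (b k); first exact: measurable_fit_ge.
    rewrite (_ : [set w | _] = ~` [set w | theta <= isotonic_fit m (Y w) k]).
      by apply: measurableC; exact: measurable_fit_ge.
    by apply/seteqP; split => w /=; [move=> ->|move=> /negP/negbTE].
  apply/seteqP; split => w /=; first by move=> <- k _; rewrite /= ffunE.
  by move=> H; apply/ffunP => k; rewrite ffunE; exact: H.
move=> w w' ww'; rewrite /dhat1.
suff -> : [set t | 0 <= t <= 1 /\ theta <= isotonic_regression m x (Y w) t] =
   [set t | 0 <= t <= 1 /\ theta <= isotonic_regression m x (Y w') t] by [].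
have E t : (theta <= isotonic_regression m x (Y w) t) = (theta <= isotonic_regression m x (Y w') t).
  rewrite /isotonic_regression -/(design_count m x t).
  have jm : ((design_count m x t).-1 < m)%N.
    by have := design_count_le m x t; case: (design_count m x t).
  by have /ffunP/(_ (Ordinal jm)) := ww'; rewrite !ffunE.
by apply/seteqP; split => t /=; rewrite E.
Qed.

End stage1.

Section sup_distance.
Variables (T : finType) (X : T -> Omega -> R) (c : R).
Hypotheses (c0 : 0 < c) (mX : forall r, measurable_fun setT (X r)).
Let F w t : R := unif_mean (fun r => (X r w <= t)%R%:R).
Let h w t := `|F w t - Phi (c * t)|.

Let F01 w t : 0 <= F w t <= 1.
Proof.
rewrite /F /unif_mean divr_ge0 ?sumr_ge0//=.
have [T0|T0] := posnP #|T|; first by rewrite T0 invr0 mulr0.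
rewrite ler_pdivrMr ?ltr0n// mul1r -sum1_card natr_sum; apply: ler_sum => r _.
by rewrite ler_nat leq_b1.
Qed.

Let h1 w t : h w t <= 2.
Proof.
have /andP[F0 F1] := F01 w t; have P0 := Phi_ge0 (c * t); have P1 := Phi_le1 (c * t).
by rewrite /h ler_norml; apply/andP; split; lra.
Qed.

Let right_step w t a : a < h w t -> exists q : rat, a < h w (ratr q).
Proof.
move=> ah.
have : \forall q \near t^'+, a < h w q.
  near=> q.
  have Xq : forall r, (X r w <= q) = (X r w <= t).
    near: q; apply: filter_forall => r; have [Xt|tX] := leP (X r w) t; near=> q.
      by rewrite (le_trans Xt)//.
    by apply/negbTE; rewrite -ltNge; near: q; exact: nbhs_right_lt.
  have Fq : F w q = F w t.
    by rewrite /F; congr unif_mean; apply/funext => r; rewrite Xq.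
  rewrite /h Fq.
  have qt : t < q by near: q; exact: nbhs_right_gt.
  have qd : q - t < (h w t - a) / c.
    by rewrite ltrBlDl; near: q; apply: nbhs_right_lt; rewrite ltrDl divr_gt0// subr_gt0.
  have H := Phi_dist (c * q) (c * t).
  rewrite -mulrBr normrM (gtr0_norm c0) (gtr0_norm (_ : 0 < q - t)) ?subr_gt0// in H.
  rewrite ltr_pdivlMr// mulrC in qd.
  have H2 : h w t <= `|F w t - Phi (c * q)| + `|Phi (c * q) - Phi (c * t)|.
    by rewrite /h; apply: le_trans (ler_normD _ _); rewrite le_eqVlt; apply/orP; left; apply/eqP; congr `|_|; ring.
  by move: H H2 qd; move: (h w t) (`|_ - Phi (c * q)|) => *; lra.
rewrite near_withinE => /nbhs_ballP[e /= e0 H].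
have [q] := @rat_in_itvoo R t (t + e) (ltr_pwDr e0 (lexx t)).
rewrite in_itv/= => /andP[tq qe]; exists q; apply: H => //.
by rewrite /ball/= ltr_norml; apply/andP; split; lra.
Unshelve. all: by end_near. Qed.

(** Both distribution functions are right-continuous, so the supremum is over
the rationals. *)
Lemma measurable_sup_distance a : 0 <= a ->
  measurable [set w | a < `|sup [set `|F w t - Phi (c * t)| | t in [set: R]] - 0|].
Proof.
move=> a0.
rewrite (_ : [set w | _] = \bigcup_(q in [set: rat]) [set w | a < h w (ratr q)]).
  apply: bigcupT_measurable_rat => q; apply: measurable_gt_cst.
  apply: measurableT_comp => //; apply: measurable_funB => //.
  apply: measurable_unif_mean => r.
  rewrite (_ : (fun w => (X r w <= ratr q)%R%:R) = \1_[set w | X r w <= ratr q]); last first.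
    by apply/funext => w; rewrite indicE; congr (nat_of_bool _)%:R; apply/idP/idP; rewrite inE.
  by apply: measurable_indic; exact: measurable_le_cst.
have hs w : has_sup [set h w t | t in [set: R]].
  by split; [exists (h w 0), 0|exists 2 => _ [t _ <-]].
have s0 w : 0 <= sup [set h w t | t in [set: R]].
  by apply: (@le_trans _ _ (h w 0)) ; [exact: normr_ge0|apply: (sup_upper_bound (hs w)); exists 0].
apply/seteqP; split => w /=; rewrite subr0 (ger0_norm (s0 w)).
  move=> /(sup_gt (hs w).1)[_ [t _ <-] aht].
  by have [q aq] := right_step aht; exists q.
move=> [q _ aq]; apply: (lt_le_trans aq); apply: (sup_upper_bound (hs w)).
by exists (ratr q).
Qed.

End sup_distance.
End measurability.

(** * The two-stage bootstrap *)

Lemma class_F0_slope {R : realType} (d0 : R) (f : R -> R) : class_F0 d0 f ->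
  0 < f^`() d0 /\ is_derive d0 1 f (f^`() d0).
Proof.
move=> [_ /nbhs_singleton[df a0 _]]; split => //.
by rewrite derive1E; exact: (DeriveDef df).
Qed.

Lemma normal_prob_scaled {R : realType} (C t : R) : 0 < C ->
  fine (normal_prob 0 1 [set z : R | C * z <= t]) = Phi (C^-1 * t).
Proof.
move=> C0; rewrite /Phi; congr (fine (normal_prob 0 1 _)).
by apply/seteqP; split => z /=; rewrite [C^-1 * t]mulrC ler_pdivlMr// [z * C]mulrC.
Qed.

Section two_stage_bootstrap.
Context {R : realType} d {Omega : measurableType d} (P : probability Omega R).
Variables (f : R -> R) (d0 p gamma K sigma : R) (x : nat -> nat -> R)
    (eps : {RV P >-> R}) (e e' e'' : nat -> nat -> {RV P >-> R}).
Hypotheses (hp : 0 < p < 1) (hK : 0 < K).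
Local Notation n1 := (budget1 p).
Local Notation n2 := (budget2 p).
Local Notation delta n := (halfwidth gamma K (n1 n)).
Local Notation dhat := (stage1_estimate f d0 p x e).
Local Notation Lpt := (Lpoint f d0 p gamma K x e).
Local Notation Upt := (Upoint f d0 p gamma K x e).
Local Notation bcdf := (bootstrap_cdf f d0 p gamma K x e e' e'').

Lemma Upoint_Lpoint n w : Upt n w = Lpt n w + 2 * delta n.
Proof. by rewrite /Upoint /Lpoint /halfwidth; ring. Qed.

Lemma bootstrap_cdf_unif n w t : bcdf n w t =
  unif_mean (fun r : resampling (n2 n) * resampling (n2 n) =>
    (Num.sqrt n%:R * (bootstrap_estimate f d0 gamma K x e e' e'' w r
       - stage2_estimate f d0 p gamma K x e e' e'' n w) <= t)%R%:R).
Proof. by rewrite /bootstrap_cdf bootstrap_probE. Qed.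

Lemma bootstrap_cdf01 n w t : 0 <= bcdf n w t <= 1.
Proof.
rewrite /bootstrap_cdf /bootstrap_prob divr_ge0//=.
set N := #|{: _}|.
have [->|N0] := posnP N; first by rewrite invr0 mulr0.
by rewrite ler_pdivrMr ?ltr0n// mul1r ler_nat max_card.
Qed.

Lemma bootstrap_cdf_homo n w t t' : t <= t' -> bcdf n w t <= bcdf n w t'.
Proof.
move=> tt'; rewrite !bootstrap_cdf_unif /unif_mean ler_wpM2r ?invr_ge0//.
apply: ler_sum => r _; rewrite ler_nat.
have [H|//] := leP _ t.
by rewrite (le_trans H tt').
Qed.

Lemma delta_gt0 : \forall n \near \oo, 0 < delta n.
Proof.
have H := @budget1_cvg R p hp _ (nbhs_infty_ge 1).
near=> n; apply: halfwidth_gt0 => //; near: n; exact: H.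
Unshelve. all: by end_near.
Qed.

Section limit.
Hypotheses (hd0 : 0 < d0 < 1) (hgamma : 0 < gamma < 3^-1)
    (fmon : {in `[0, 1] &, {homo f : x y / x <= y}}) (a : R) (a0 : 0 < a) (df : is_derive d0 1 f a)
    (hx : is_design x) (hA1 : assumption_A1 d0 x) (hsigma : 0 < sigma)
    (heps_mean : ('E_P[eps] = 0)%E) (heps_var : ('V_P[eps] = (sigma ^+ 2)%:E)%E)
    (hA5 : ('E_P[fun w => (eps w ^+ 6)%R] < +oo)%E)
    (herr : iid_copies eps pooled_dom (pooled e e' e'')).

Let delta_near : \forall nw \near prob_filter P, 0 < delta nw.1.
Proof. exact: (prob_filter_near P delta_gt0). Qed.

Let delta_cvg : delta nw.1 @[nw --> prob_filter P] --> (0 : R).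
Proof.
apply: (@cvg_prob_filter_fst _ _ _ P _ _ (fun n => delta n)).
exact: (cvg_comp _ _ (budget1_cvg hp) (cvg_halfwidth K hgamma)).
Qed.

Let rate := stage1_rate hd0 hp hK hgamma fmon a0 df hx hA1 heps_mean heps_var hA5 herr.

(* The second-stage points are the estimate plus s delta with s = -1 and s = 1;
   as the estimate is d0 + o(delta), they are d0 + (s + o(1)) delta. *)
Let response_cvg (s : R) : (f (dhat nw.1 nw.2 + s * delta nw.1) - f d0) / delta nw.1
  @[nw --> prob_filter P] --> s * a.
Proof.
pose u nw := (dhat nw.1 nw.2 - d0) / delta nw.1 + s.
have u_cvg : u nw @[nw --> prob_filter P] --> s.
  by rewrite -[X in _ --> X]add0r; apply: cvgD => //; exact: cvg_cst.
have : (f (d0 + u nw * delta nw.1) - f d0) / delta nw.1 @[nw --> prob_filter P] --> s * a.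
  exact: cvg_scaled_diff df delta_cvg delta_near u_cvg.
apply: cvg_trans; apply: near_eq_cvg; apply: filterS delta_near => nw dl0.
congr ((f _ - _) / _).
by rewrite /u mulrDl divfK ?gt_eqF//; ring.
Qed.

Let n20 : \forall nw \near prob_filter P, (0 < n2 nw.1)%N.
Proof. exact: (prob_filter_near P (budget2_gt0 hp)). Qed.

Lemma arm_mean_cvg (iota : nat -> nat -> pooled_index) (s : R) (X : nat -> Omega -> R) :
  (forall n i j, iota n i = iota n j -> i = j) ->
  (forall n i, (i < n)%N -> pooled_dom (iota n i)) ->
  (forall n w, X n w = dhat n w + s * delta n) ->
  (unif_mean (fun i : 'I_(n2 nw.1) => f (X nw.1 nw.2) + pooled e e' e'' (iota nw.1 i) nw.2) - f d0)
    / delta nw.1 @[nw --> prob_filter P] --> s * a.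
Proof.
move=> iota_inj iota_dom XE.
have Zc := row_mean_scaled_cvg hp hK hgamma heps_mean hA5 herr iota_inj iota_dom.
have : (f (dhat nw.1 nw.2 + s * delta nw.1) - f d0) / delta nw.1
    + row_mean p e e' e'' iota id nw.1 nw.2 / delta nw.1 @[nw --> prob_filter P] --> s * a + 0.
  exact: cvgD (response_cvg (s := s)) Zc.
rewrite addr0; apply: cvg_trans; apply: near_eq_cvg; apply: filterS n20 => nw kn0.
rewrite (unif_mean_translated e e' e'' iota (fun nw => f (X nw.1 nw.2)) kn0).
by rewrite -XE -mulrDl; congr (_ / _); ring.
Qed.

(** The limit Phi (a r0 sqrt 2 / sigma t) of [bootstrap_cvg] has
r0 = sqrt ((1 - p) / 2), the limit of sqrt (n2 / n), so that the factor sqrt 2,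
due to the two samples, cancels. *)
Lemma bootstrap_cdf_cvg t : bcdf nw.1 nw.2 t @[nw --> prob_filter P]
  --> Phi ((sigma / (a * Num.sqrt (1 - p)))^-1 * t).
Proof.
pose i1 n i : pooled_index := inl (inr (n, i)).
pose i2 n i : pooled_index := inr (n, i).
have i1_inj n i j : i1 n i = i1 n j -> i = j by case.
have i2_inj n i j : i2 n i = i2 n j -> i = j by case.
have i1_dom n i : (i < n)%N -> pooled_dom (i1 n i) by [].
have i2_dom n i : (i < n)%N -> pooled_dom (i2 n i) by [].
have /andP[p0 p1] := hp.
have q0 : 0 < 1 - p by rewrite subr_gt0.
have r0 : 0 < Num.sqrt ((1 - p) / 2) by rewrite sqrtr_gt0 divr_gt0.
have lE n w : Lpt n w = dhat n w + -1 * delta n by rewrite /Lpoint /halfwidth mulN1r.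
have uE n w : Upt n w = dhat n w + 1 * delta n by rewrite /Upoint /halfwidth mul1r.
have rho := arm_mean_cvg i1_inj i1_dom lE.
have beta := arm_mean_cvg i2_inj i2_dom uE.
rewrite mulN1r in rho; rewrite mul1r in beta.
have v1 := emp_variance_cvg hp heps_mean heps_var hA5 herr i1_inj i1_dom (fun nw => f (Lpt nw.1 nw.2)).
have v2 := emp_variance_cvg hp heps_mean heps_var hA5 herr i2_inj i2_dom (fun nw => f (Upt nw.1 nw.2)).
have m1 := emp_third_moment_cvg hp heps_mean hA5 herr i1_inj i1_dom (fun nw => f (Lpt nw.1 nw.2)).
have m2 := emp_third_moment_cvg hp heps_mean hA5 herr i2_inj i2_dom (fun nw => f (Upt nw.1 nw.2)).
have n_near : \forall nw \near prob_filter P, (0 < nw.1)%N.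
  exact: (prob_filter_near P (nbhs_infty_gt 0%N)).
have isk := cvg_prob_filter_fst P (sqrt_budget2_inv hp).
have ee := cvg_prob_filter_fst P (cvg_sqrtn_halfwidth hp hK hgamma).
have kn := cvg_prob_filter_fst P (sqrt_budget2_ratio hp).
have lim := @bootstrap_cvg R _ (prob_filter P) (prob_filter_filter P) (f d0) a (Num.sqrt ((1 - p) / 2)) sigma
  (fun nw => n2 nw.1) fst _ _ (fun nw => Lpt nw.1 nw.2) (fun nw => delta nw.1)
  a0 r0 hsigma n20 n_near delta_near rho beta v1 v2 m1 m2 isk ee kn t.
have -> : (sigma / (a * Num.sqrt (1 - p)))^-1 = a * Num.sqrt ((1 - p) / 2) * Num.sqrt 2 / sigma.
  rewrite -[1 - p in LHS](divfK (_ : 2 != 0)) ?pnatr_eq0// sqrtrM ?divr_ge0 ?(ltW q0)//.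
  by rewrite invf_div !mulrA.
apply: cvg_trans lim; apply: near_eq_cvg; apply: nearW => -[n w] /=.
by rewrite /bootstrap_cdf /bootstrap_estimate /stage2_estimate /Ysecond Upoint_Lpoint.
Qed.

Lemma sup_distance_cvg :
  sup [set `|bcdf nw.1 nw.2 t - Phi ((sigma / (a * Num.sqrt (1 - p)))^-1 * t)| | t in [set: R]]
  @[nw --> prob_filter P] --> (0 : R).
Proof.
have /andP[_ p1] := hp.
have c0 : 0 < (sigma / (a * Num.sqrt (1 - p)))^-1.
  by rewrite invr_gt0 divr_gt0// mulr_gt0// sqrtr_gt0 subr_gt0.
apply/cvgrPdist_le => eta eta0.
have near_eta : \forall nw \near prob_filter P, forall t,
    `|bcdf nw.1 nw.2 t - Phi ((sigma / (a * Num.sqrt (1 - p)))^-1 * t)| <= eta.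
  exact: (polya c0 (fun nw => bootstrap_cdf01 nw.1 nw.2)
    (fun nw => @bootstrap_cdf_homo nw.1 nw.2) bootstrap_cdf_cvg eta0).
apply: filterS near_eta => nw H; rewrite sub0r normrN.
pose h t := `|bcdf nw.1 nw.2 t - Phi ((sigma / (a * Num.sqrt (1 - p)))^-1 * t)|.
have hs : has_sup [set h t | t in [set: R]].
  by split; [exists (h 0), 0|exists eta => _ [t _ <-]; exact: H].
rewrite ger0_norm; first by rewrite ge_sup//; [exact: hs.1|move=> _ [t _ <-]; exact: H].
by apply: (@le_trans _ _ (h 0)); [exact: normr_ge0|apply: (sup_upper_bound hs); exists 0].
Qed.

End limit.

Section measurability.
Hypothesis hf_meas : measurable_fun [set: R] f.

Lemma measurable_stage1_estimate n : (0 < n1 n)%N -> measurable_fun setT (dhat n).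
Proof.
move=> m0; apply: measurable_dhat1 => // i _.
by apply: measurable_funD => //; exact: measurable_cst.
Qed.

Lemma measurable_bootstrap_deviation n : (0 < n1 n)%N -> (0 < n2 n)%N ->
  forall r : resampling (n2 n) * resampling (n2 n),
  measurable_fun setT (fun w => Num.sqrt n%:R * (bootstrap_estimate f d0 gamma K x e e' e'' w r
       - stage2_estimate f d0 p gamma K x e e' e'' n w)).
Proof.
move=> m0 k0 r.
have mh := measurable_stage1_estimate m0.
have mL : measurable_fun setT (Lpt n) by apply: measurable_funB => //; exact: measurable_cst.
have mU : measurable_fun setT (Upt n) by apply: measurable_funD => //; exact: measurable_cst.
have LU w : Lpt n w != Upt n w.
  by rewrite Upoint_Lpoint lt_eqF// ltrDl mulr_gt0// halfwidth_gt0.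
have my' i : measurable_fun setT (fun w => Yprime f d0 gamma K x e e' w (i : 'I_(n2 n))).
  by apply: measurable_funD => //; exact: measurableT_comp hf_meas mL.
have my'' i : measurable_fun setT (fun w => Ysecond f d0 gamma K x e e'' w (i : 'I_(n2 n))).
  by apply: measurable_funD => //; exact: measurableT_comp hf_meas mU.
suff md (r1 r2 : 'I_(n2 n) -> 'I_(n2 n)) : measurable_fun setT (fun w =>
    dtilde2 (f d0) (Lpt n w) (Upt n w) (fun i => Yprime f d0 gamma K x e e' w (r1 i))
      (fun i => Ysecond f d0 gamma K x e e'' w (r2 i))).
  by apply: measurable_funM => //; apply: measurable_funB; [exact: (md r.1 r.2)|exact: (md id id)].
under eq_fun do rewrite dtilde2E//.
have m1 : measurable_fun setT (fun w => unif_mean (fun i => Yprime f d0 gamma K x e e' w (r1 i))).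
  exact: measurable_unif_mean.
have m2 : measurable_fun setT (fun w => unif_mean (fun i => Ysecond f d0 gamma K x e e'' w (r2 i))).
  exact: measurable_unif_mean.
have msl := measurable_fun_div (measurable_funB m2 m1) (measurable_funB mU mL).
apply: measurable_fun_div => //; apply: measurable_funB; first exact: measurable_cst.
by apply: measurable_funB => //; exact: measurable_funM.
Qed.

End measurability.
End two_stage_bootstrap.

Theorem theorem3p5 (R : realType)
    (d : measure_display) (Omega : measurableType d) (P : probability Omega R)
    (f : R -> R) (d0 p gamma K sigma : R) (x : nat -> nat -> R)
    (eps : {RV P >-> R}) (e e' e'' : nat -> nat -> {RV P >-> R})
    (hd0 : 0 < d0 < 1) (hp : 0 < p < 1) (hK : 0 < K)
    (hgamma : 0 < gamma < 3^-1)
    (hf_meas : measurable_fun [set: R] f)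
    (hf : class_F d0 f)
    (hx : is_design x)
    (hA1 : assumption_A1 d0 x)
    (heps_cont : continuous (cdf eps))
    (hsigma : 0 < sigma)
    (heps_mean : ('E_P[eps] = 0)%E)
    (heps_var : ('V_P[eps] = (sigma ^+ 2)%:E)%E)
    (hA5 : ('E_P[fun w => (eps w ^+ 6)%R] < +oo)%E)
    (herr : iid_copies eps pooled_dom (pooled e e' e'')) :
  let C2 := sigma / (f^`()%classic d0 * Num.sqrt (1 - p)) in
  cvg_in_probability P
    (fun n w =>
       sup [set `|bootstrap_cdf f d0 p gamma K x e e' e'' n w t
                  - fine (normal_prob 0 1 [set z : R | C2 * z <= t])|
           | t in [set: R]])
    0.
Proof.
move=> C2.
have [hf0 _] := hf; have [fmon _] := hf0; have [a0 df] := class_F0_slope hf0.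
have C0 : 0 < C2.
  have /andP[_ p1] := hp.
  by rewrite /C2 divr_gt0// mulr_gt0// sqrtr_gt0 subr_gt0.
under eq_fun do under eq_fun do under eq_imagel do rewrite normal_prob_scaled//.
apply: prob_filter_cvg_in_probability; last first.
  exact: (sup_distance_cvg hp hK hd0 hgamma fmon a0 df hx hA1 hsigma heps_mean heps_var hA5 herr).
move=> eta eta0.
have m0 := budget1_cvg hp (nbhs_infty_gt 0%N).
have k0 := budget2_gt0 hp.
near=> n.
under eq_set do under eq_imagel do rewrite bootstrap_cdf_unif.
apply: measurable_sup_distance; [by rewrite invr_gt0| |exact: ltW].
by apply: measurable_bootstrap_deviation => //; near: n; [exact: m0|exact: k0].
Unshelve. all: by end_near. Qed.
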